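(* Let $\alpha\in(0,1)$, let $u\in H^3(0,\pi)$ and let $w\in X_N^3$. Then $\tilde A_N^{\alpha}u\in C(0,\pi)\cap L^1(0,\pi)$, and $$\int_0^\pi \tilde A_N^{\alpha}u(x)\,w(x)\,dx=\int_0^\pi u(x)\,A_N^{\alpha}w(x)\,dx .$$
   Context: $A_N=-\frac{d^2}{dx^2}$ is the Neumann Laplacian on $(0,\pi)$, with operator domain $\{u\in H^2(0,\pi):u'(0)=u'(\pi)=0\}$. It is self-adjoint and non-negative on $L^2(0,\pi)$, and $A_N^{\alpha}$ is defined by the spectral theorem. For $p\ge 0$, $X_N^p$ denotes the operator domain of $A_N^{p/2}$. $C(0,\pi)$ is the space of continuous functions on the open interval $(0,\pi)$. Let $p_N(t,x,y)$ be the heat kernel of $A_N$ (the integral kernel of $e^{-tA_N}$) on $(0,\pi)$, and for $x\ne y$ put $$J_N(x,y)=\frac{\alpha}{\Gamma(1-\alpha)}\int_0^\infty p_N(t,x,y)\,t^{-\alpha-1}\,dt .$$ The extended spectral fractional Neumann Laplacian is $$\tilde A_N^{\alpha}u(x)=\mathrm{PV}\int_0^\pi (u(x)-u(y))J_N(x,y)\,dy:=\lim_{\epsilon\to0^+}\int_{\{y\in(0,\pi):\,|x-y|\ge\epsilon\}}(u(x)-u(y))J_N(x,y)\,dy .$$ It is applied to functions $u$ that need not satisfy the homogeneous Neumann boundary conditions. *)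

(* Defs.v *)
From HB Require Import structures.
From mathcomp Require Import all_boot all_order all_algebra.
From mathcomp Require Import all_classical all_reals all_analysis.
Set Implicit Arguments.
Unset Strict Implicit.
Unset Printing Implicit Defensive.
Import Order.TTheory GRing.Theory Num.Theory.
Import numFieldNormedType.Exports.

Local Open Scope classical_set_scope.
Local Open Scope ring_scope.

(* Functions on (0, pi) are total functions R -> R whose values off (0, pi)
   are irrelevant; elements of L^2 are represented by functions, so that
   equality in L^2 is almost-everywhere equality on (0, pi). *)

Section Neumann.
Context {R : realType}.
Local Notation mu := (@lebesgue_measure R).
Implicit Types (u v w f g phi : R -> R) (alpha p t x y : R).

Definition L2 f : Prop :=
  measurable_fun `]0, pi[ f /\
  mu.-integrable `]0, pi[ (fun x => (f x ^+ 2)%:E).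

Definition L2dot f g : R := \int[mu]_(x in `]0, pi[) (f x * g x).

(* The square of the L^2 distance. *)
Definition L2dist2 f g : \bar R :=
  (\int[mu]_(x in `]0%R, pi[) ((f x - g x) ^+ 2)%:E)%E.

(* C_c^oo(0, pi) *)
Definition test_function phi : Prop :=
  (forall n x, derivable (derive1n n phi) x 1) /\
  exists a b : R, [/\ 0 < a, b < pi & forall x, x \notin `[a, b] -> phi x = 0].

Definition weak_derivative (k : nat) u v : Prop :=
  forall phi, test_function phi ->
    L2dot u (derive1n k phi) = (-1) ^+ k * L2dot v phi.

Definition sobolevH (k : nat) u : Prop :=
  L2 u /\
  forall j, (0 < j <= k)%N -> exists2 v, L2 v & weak_derivative j u v.

(* Graph of A_N: u is in H^2(0, pi), - u'' = f and u'(0) = u'(pi) = 0, the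
   boundary values being those of the representative of u' that is continuous
   on [0, pi]. *)
Definition neumann_laplacian u f : Prop :=
  [/\ sobolevH 2 u,
      L2 f,
      weak_derivative 2 u (fun x => - f x) &
      exists du, [/\ weak_derivative 1 u du, {within `[0, pi], continuous du},
                     du 0 = 0 & du pi = 0]].

(* An orthonormal basis of L^2(0, pi) made of eigenfunctions of A_N. *)
Definition neumann_eigenbasis (e : nat -> R -> R) (lam : nat -> R) : Prop :=
  [/\ forall n, neumann_laplacian (e n) (fun x => lam n * e n x),
      forall m n, L2dot (e m) (e n) = (m == n)%:R &
      forall f, L2 f -> (forall n, L2dot f (e n) = 0) ->
        {ae mu, forall x, `]0, pi[%classic x -> f x = 0}].

(* Graph of h(A_N), as given by the spectral theorem: A_N has compact
   resolvent, and h(A_N) w = \sum_n h(lam n) <w, e n> e n, the domain being the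
   set of those w for which the series converges in L^2(0, pi). Since A_N is
   self-adjoint, this does not depend on the eigenbasis. *)
Definition neumann_calculus (h : R -> R) w v : Prop :=
  [/\ L2 w, L2 v &
      exists e lam, neumann_eigenbasis e lam /\
        (fun N : nat => L2dist2 v
           (fun x => \sum_(n < N) h (lam n) * L2dot w (e n) * e n x))
          @ \oo --> 0%E].

(* X_N^p, the domain of A_N^(p/2). *)
Definition neumann_space p w : Prop :=
  exists v, neumann_calculus (fun l => l `^ (p / 2)) w v.

(* A representative of A_N^alpha w (and 0 if w is not in its domain). *)
Definition neumann_power alpha w : R -> R :=
  xget (fun=> 0) [set v | neumann_calculus (fun l => l `^ alpha) w v].

(* The operator exp(- t A_N) determines its kernel almost everywhere only;
   continuity makes it unique at every point of (0, pi) x (0, pi). *)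
Definition is_neumann_heat_kernel (k : R -> R -> R -> R) : Prop :=
  forall t, 0 < t ->
    (forall x y, x \in `]0, pi[ -> y \in `]0, pi[ ->
       {for (x, y), continuous (fun z : R * R => k t z.1 z.2)}) /\
    (forall f, L2 f ->
       {ae mu, forall x, `]0, pi[%classic x ->
          mu.-integrable `]0, pi[ (fun y => (k t x y * f y)%:E)} /\
       neumann_calculus (fun l => expR (- (t * l))) f
         (fun x => \int[mu]_(y in `]0, pi[) (k t x y * f y))).

Definition neumann_heat_kernel : R -> R -> R -> R :=
  xget (fun _ _ _ => 0) [set k | is_neumann_heat_kernel k].

Definition Gamma (s : R) : R :=
  \int[mu]_(t in `]0, +oo[) (t `^ (s - 1) * expR (- t)).

(* J_N and the truncated integrals are extended real, so that no divergent
   integral is silently given a finite value. *)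
Definition jump_kernel alpha x y : \bar R :=
  ((alpha / Gamma (1 - alpha))%:E *
   \int[mu]_(t in `]0%R, +oo[)
      (neumann_heat_kernel t x y * t `^ (- alpha - 1))%R%:E)%E.

Definition truncated_domain x (eps : R) : set R :=
  [set y | `]0, pi[%classic y /\ eps <= `|x - y|].

Definition truncated_laplacian alpha u x (eps : R) : \bar R :=
  (\int[mu]_(y in truncated_domain x eps)
     ((u x - u y)%R%:E * jump_kernel alpha x y))%E.

(* The principal value, meaningful where the limit exists and is finite. *)
Definition extended_laplacian alpha u x : R :=
  fine (lim (truncated_laplacian alpha u x eps @[eps --> 0^'+])).

End Neumann.

(* Main.v *)
(* The kernel splits as p_N(t,x,y) = theta(t,x-y) + theta(t,x+y), where theta is
   the nonnegative, even, 2pi-periodic heat kernel, so that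
   J_N(x,y) = K(x-y) + K(x+y) for an even 2pi-periodic K >= 0.  Extending u to
   an even 2pi-periodic U and unfolding the integral over y gives
     A u(x) = \int_0^pi (2 U(x) - U(x+z) - U(x-z)) K(z) dz.
   No pointwise bound on K is needed: by Tonelli's theorem and the Gamma
   integral, \int_0^pi (2 - 2 cos(m z)) K(z) dz = m^(2 alpha), and m = 1 shows
   that z^2 K(z) is integrable.  As u is in H^3, it is Lipschitz, and its second
   differences are O(z^2) as long as x - z and x + z stay in (0,pi).  Dominated
   convergence then yields the principal value and its continuity, and Tonelli's
   theorem the integrability, the integral over x of the second difference being
   O(z^2).  By Fubini's theorem the cosine coefficients of A u are m^(2 alpha)
   times those of u; summing them against w, whose coefficients are absolutely
   summable with weight m^(2 alpha) because m^3 w_m is square summable, gives the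
   identity. *)

Require Import Defs.
From HB Require Import structures.
From mathcomp Require Import all_boot all_order all_algebra.
From mathcomp Require Import all_classical all_reals all_analysis.
From mathcomp Require Import measurable_realfun ring lra.
Import Order.TTheory GRing.Theory Num.Theory.
Import numFieldNormedType.Exports.
Local Open Scope classical_set_scope.
Local Open Scope ring_scope.
Set Implicit Arguments.
Unset Strict Implicit.
Unset Printing Implicit Defensive.

(** * Changes of variable and iterated integrals *)

(** The definitions only assert that an eigenbasis, a heat kernel and a representative of A_N^alpha
    w exist. Hence the cosines are proved complete, every eigenbasis is shown to give the same
    coefficients, and continuity pins down the kernel at each point. Positivity of theta, usually a
    consequence of Poisson summation, is read off the cosine series as positivity of Toeplitz forms.
    It drives both Korovkin's argument for completeness and the use of Tonelli's theorem on K, which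
    is only known to be finite almost everywhere. As u' need not vanish at 0 and pi, the even
    extension of u may have corners there, and its second difference is only O(z) when x is within z
    of an end. Those x have measure 2 z, which restores O(z^2) after integration in x. Sobolev
    regularity enters by duality: if v and its weak derivative are in L^2, then |<v, psi>| <= M
    |psi|_1 for test functions psi. Testing u against combinations of narrow bumps then bounds its
    first differences through u'' in L^2 and its second differences through u''' in L^2. *)

Section Affine.
Context {R : realType}.
Local Notation mu := (@lebesgue_measure R).

(** The type [measurableTypeR R] lets the map be declared a measurable function, along which
    Lebesgue measure is pushed forward. *)
Definition reflR (c : R) : measurableTypeR R -> measurableTypeR R :=
  fun x => c - x.

Let mrefl (c : R) : measurable_fun setT (reflR c).
Proof. exact: measurable_funB. Qed.

HB.instance Definition _ c := isMeasurableFun.Build _ _ _ _ _ (mrefl c).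

(** Lebesgue measure is determined by the intervals []a, b]], and reflection turns these into [[c -
    b, c - a[], of the same length. *)
Lemma lebesgue_measure_reflect (c : R) (A : set (measurableTypeR R)) : measurable A ->
  pushforward mu (reflR c) A = mu A.
Proof.
move=> mA; apply/esym/lebesgue_measure_unique => //= _ [[a b]] _ <-.
rewrite /pushforward /reflR.
rewrite (_ : _ @^-1` _ = `[c - b, c - a[%classic); last first.
  by apply/seteqP; split => x /=; rewrite !in_itv/= ltrBrDl -ltrBrDr lerBlDl -lerBlDr andbC.
rewrite !lebesgue_measure_itv/= !lte_fin ltrD2l ltrN2 -!EFinB; congr (if _ then _ else _).
by congr EFin; ring.
Qed.

Lemma integral_reflect_oo (c a b : R) (f : R -> \bar R) : measurable_fun `]a, b[ f ->
  (\int[mu]_(x in `](c - b)%R, (c - a)%R[) f (c - x)%R = \int[mu]_(x in `]a, b[) f x)%E.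
Proof.
move=> mf.
have -> : `](c - b), (c - a)[%classic = reflR c @^-1` `]a, b[ :> set R.
  by apply/seteqP; split => x; rewrite /reflR /= !in_itv/= => /andP[? ?]; apply/andP; split; lra.
(* The image-measure formula is for nonnegative functions, so the positive and negative parts are
   moved separately. *)
rewrite [LHS]integralE [RHS]integralE.
have H (g : R -> \bar R) : measurable_fun `]a, b[ g -> (forall x, (0 <= g x)%E) ->
  (\int[mu]_(x in reflR c @^-1` `]a, b[) g (c - x)%R = \int[mu]_(x in `]a, b[) g x)%E.
  move=> mg g0; rewrite -(@ge0_integral_pushforward _ _ _ _ _ _ (mrefl c) mu _ g)//.
  by apply: eq_measure_integral => A mA _; exact: lebesgue_measure_reflect.
rewrite -(H f^\+%E (measurable_funepos mf) (funepos_ge0 f)).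
rewrite -(H f^\-%E (measurable_funeneg mf) (funeneg_ge0 f)).
by congr (_ - _)%E; apply: eq_integral => x _; rewrite !unlock.
Qed.
End Affine.

Section Tonelli.
Context {R : realType}.
Local Notation mu := (@lebesgue_measure R).
Local Open Scope ereal_scope.
Implicit Types (A B : set R) (f : R -> R -> \bar R).

(** Extension by 0 turns an integral over a rectangle into one over the plane, where the theorems of
    Tonelli and Fubini are stated. *)
Let restrX A B f : R * R -> \bar R := (fun z : R * R => f z.1 z.2) \_ (A `*` B).

Let restrXE A B f x y :
  restrX A B f (x, y) = if (x \in A) && (y \in B) then f x y else 0.
Proof. by rewrite /restrX patchE in_setX. Qed.

Let integral_restrX12 A B f :
  \int[mu]_(x in A) \int[mu]_(y in B) f x y =
  \int[mu]_x \int[mu]_y restrX A B f (x, y).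
Proof.
rewrite integral_mkcond; apply: eq_integral => x _; rewrite patchE.
have [xA|xA] := boolP (x \in A).
  rewrite integral_mkcond; apply: eq_integral => y _.
  by rewrite restrXE xA patchE.
by rewrite integral0_eq// => y _; rewrite restrXE (negbTE xA).
Qed.

Let integral_restrX21 A B f :
  \int[mu]_(y in B) \int[mu]_(x in A) f x y =
  \int[mu]_y \int[mu]_x restrX A B f (x, y).
Proof.
rewrite (integral_restrX12 B A (fun y x => f x y)).
by apply: eq_integral => y _; apply: eq_integral => x _; rewrite !restrXE andbC.
Qed.

Let measurable_restrX A B f : measurable A -> measurable B ->
  measurable_fun (A `*` B) (fun z : R * R => f z.1 z.2) ->
  measurable_fun setT (restrX A B f).
Proof.
by move=> mA mB mf; apply/(measurable_restrictT _ _).1 => //; exact: measurableX.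
Qed.

Let restrX_ge0 A B f : (forall x y, A x -> B y -> 0 <= f x y) ->
  forall z, 0 <= restrX A B f z.
Proof.
move=> f0 [x y]; rewrite restrXE; case: ifPn => // /andP[/set_mem xA /set_mem yB].
exact: f0.
Qed.

Lemma tonelli_in A B f :
  measurable A -> measurable B ->
  measurable_fun (A `*` B) (fun z : R * R => f z.1 z.2) ->
  (forall x y, A x -> B y -> 0 <= f x y) ->
  \int[mu]_(x in A) \int[mu]_(y in B) f x y =
  \int[mu]_(y in B) \int[mu]_(x in A) f x y.
Proof.
move=> mA mB mf f0; rewrite integral_restrX12 [RHS]integral_restrX21.
exact: (@fubini_tonelli _ _ _ _ _ mu mu _ (measurable_restrX mA mB mf) (restrX_ge0 f0)).
Qed.

Lemma measurable_tonelli_in A B f :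
  measurable A -> measurable B ->
  measurable_fun (A `*` B) (fun z : R * R => f z.1 z.2) ->
  (forall x y, A x -> B y -> 0 <= f x y) ->
  measurable_fun A (fun x => \int[mu]_(y in B) f x y).
Proof.
move=> mA mB mf f0.
apply: (@eq_measurable_fun _ _ _ _ _ (fun x => \int[mu]_y restrX A B f (x, y))).
  move=> x xA; rewrite [RHS]integral_mkcond; apply: eq_integral => y _.
  by rewrite restrXE xA patchE.
apply: measurable_funTS.
exact: (@measurable_fun_fubini_tonelli_F _ _ _ _ _ mu _ (measurable_restrX mA mB mf) (restrX_ge0 f0)).
Qed.

Lemma fubini_in A B f :
  measurable A -> measurable B ->
  measurable_fun (A `*` B) (fun z : R * R => f z.1 z.2) ->
  \int[mu]_(x in A) \int[mu]_(y in B) `|f x y| < +oo ->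
  \int[mu]_(x in A) \int[mu]_(y in B) f x y =
  \int[mu]_(y in B) \int[mu]_(x in A) f x y.
Proof.
move=> mA mB mf; rewrite integral_restrX12 => foo.
rewrite integral_restrX12 [RHS]integral_restrX21; apply: Fubini.
apply/integrable12ltyP; first exact: measurable_restrX.
apply: le_lt_trans foo; rewrite le_eqVlt; apply/orP; left; apply/eqP.
apply: eq_integral => x _; apply: eq_integral => y _.
by rewrite !restrXE; case: ifP => //; rewrite abse0.
Qed.
End Tonelli.

(** * Functions on (0, pi) *)
Section L2.
Context {R : realType}.
Local Notation mu := (@lebesgue_measure R).
Local Notation I0 := (`]0, pi[%classic : set R).
Implicit Types (f g h : R -> R).

Lemma aeS (P Q : R -> Prop) : (forall x, P x -> Q x) ->
  {ae mu, forall x, P x} -> {ae mu, forall x, Q x}.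
Proof.
by move=> PQ; apply: filterS; first exact: (ae_filter_ringOfSetsType mu).
Qed.

Lemma aeI (P Q : R -> Prop) : {ae mu, forall x, P x} -> {ae mu, forall x, Q x} ->
  {ae mu, forall x, P x /\ Q x}.
Proof.
by apply: filterS2; first exact: (ae_filter_ringOfSetsType mu).
Qed.

Definition L1 f := mu.-integrable I0 (EFin \o f).

Lemma measure_I0 : mu I0 = pi%:E.
Proof. by rewrite lebesgue_measure_itv/= lte_fin pi_gt0 oppr0 adde0. Qed.

Lemma measurable_L1 f : L1 f -> measurable_fun I0 f.
Proof. by move=> /integrableP[/measurable_EFinP]. Qed.

Lemma L1_bounded f (M : R) : measurable_fun I0 f ->
  (forall x, I0 x -> `|f x| <= M) -> L1 f.
Proof.
move=> mf fM; apply: measurable_bounded_integrable => //.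
  by rewrite [X in (X < _)%E]measure_I0 ltry.
by exists M; split; [exact: num_real|move=> y My x Dx; apply: le_trans (fM _ Dx) (ltW My)].
Qed.

Lemma le_L1 f g : measurable_fun I0 f -> L1 g ->
  (forall x, I0 x -> `|f x| <= g x) -> L1 f.
Proof.
move=> mf ig fg; apply: le_integrable ig => //; first exact/measurable_EFinP.
move=> x Dx /=; rewrite lee_fin; apply: le_trans (fg _ Dx) (ler_norm _).
Qed.

Lemma L1D f g : L1 f -> L1 g -> L1 (fun x => f x + g x).
Proof.
by move=> hf hg; apply: eq_integrable (integrableD _ hf hg).
Qed.

Lemma L1B f g : L1 f -> L1 g -> L1 (fun x => f x - g x).
Proof.
by move=> hf hg; apply: eq_integrable (integrableB _ hf hg).
Qed.

Lemma L1Z (k : R) f : L1 f -> L1 (fun x => k * f x).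
Proof.
by move=> hf; apply: eq_integrable (integrableZl _ k hf).
Qed.

Lemma L1_norm f : L1 f -> L1 (fun x => `|f x|).
Proof. by move=> hf; exact: integrable_norm. Qed.

Lemma L1_cst (k : R) : L1 (cst k).
Proof. by apply: (@L1_bounded _ `|k|). Qed.

Lemma L1M_bounded f g (M : R) : L1 f -> measurable_fun I0 g ->
  (forall x, I0 x -> `|g x| <= M) -> L1 (fun x => f x * g x).
Proof.
move=> hf mg gM; apply: (@le_L1 _ (fun x => M * `|f x|)).
- by apply: measurable_funM => //; exact: measurable_L1.
- by apply: L1Z; exact: L1_norm.
- by move=> x Dx; rewrite normrM mulrC ler_wpM2r ?gM.
Qed.

Lemma eq_L1 f g : (forall x, I0 x -> f x = g x) -> L1 f -> L1 g.
Proof.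
by move=> fg; apply: eq_integrable => //= x /set_mem/fg /= ->.
Qed.

Lemma L2_L1M f g : L2 f -> L2 g -> L1 (fun x => f x * g x).
Proof.
move=> [mf if2] [mg ig2]; apply: (@le_L1 _ (fun x => f x ^+ 2 + g x ^+ 2)).
- exact: measurable_funM.
- exact: L1D.
- move=> x _; rewrite normrM; move: (sqr_ge0 (`|f x| - `|g x|)) (sqr_ge0 (`|f x| + `|g x|)).
  rewrite -(real_normK (num_real (f x))) -(real_normK (num_real (g x))); nra.
Qed.

Lemma L2_bounded f (M : R) : measurable_fun I0 f ->
  (forall x, I0 x -> `|f x| <= M) -> L2 f.
Proof.
move=> mf fM; split=> //; apply: (@L1_bounded _ (M ^+ 2)).
  exact: measurable_funX.
by move=> x Dx; rewrite normrX; apply: lerXn2r (fM _ Dx); rewrite nnegrE ?(le_trans _ (fM _ Dx)).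
Qed.

Lemma L2_cst (k : R) : L2 (cst k).
Proof. by apply: (@L2_bounded _ `|k|). Qed.

Lemma L2_L1 f : L2 f -> L1 f.
Proof.
move=> hf; apply: eq_L1 (L2_L1M hf (L2_cst 1)) => x _ /=.
by rewrite mulr1.
Qed.

Lemma L2D f g : L2 f -> L2 g -> L2 (fun x => f x + g x).
Proof.
move=> hf hg; have [mf if2] := hf; have [mg ig2] := hg; split.
  exact: measurable_funD.
apply: (@eq_L1 (fun x => (f x ^+ 2 + g x ^+ 2) + 2 * (f x * g x))).
  by move=> x _; ring.
by apply: L1D; [exact: L1D|apply: L1Z; exact: L2_L1M].
Qed.

Lemma L2Z (k : R) f : L2 f -> L2 (fun x => k * f x).
Proof.
move=> [mf if2]; split; first exact: measurable_funM.
by apply: (eq_L1 _ (L1Z (k ^+ 2) if2)) => x _; ring.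
Qed.

Lemma L2B f g : L2 f -> L2 g -> L2 (fun x => f x - g x).
Proof.
move=> hf hg; have := L2D hf (L2Z (-1) hg).
by congr (L2 _); apply/funext => x; ring.
Qed.

Lemma L2_sum (N : nat) (F : nat -> R -> R) : (forall n, L2 (F n)) ->
  L2 (fun x => \sum_(n < N) F n x).
Proof.
move=> hF; elim: N => [|N IH].
  by have := L2_cst 0; congr (L2 _); apply/funext => x; rewrite big_ord0.
by have := L2D IH (hF N); congr (L2 _); apply/funext => x; rewrite big_ord_recr.
Qed.

Lemma Rintegral_L1D f g : L1 f -> L1 g ->
  \int[mu]_(x in I0) (f x + g x) = \int[mu]_(x in I0) f x + \int[mu]_(x in I0) g x.
Proof. by move=> hf hg; rewrite RintegralD. Qed.

Lemma Rintegral_L1B f g : L1 f -> L1 g ->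
  \int[mu]_(x in I0) (f x - g x) = \int[mu]_(x in I0) f x - \int[mu]_(x in I0) g x.
Proof. by move=> hf hg; rewrite RintegralB. Qed.

Lemma Rintegral_L1Z (k : R) f : L1 f ->
  \int[mu]_(x in I0) (k * f x) = k * \int[mu]_(x in I0) f x.
Proof. by move=> hf; rewrite RintegralZl. Qed.

Lemma le_Rintegral_L1 f g : L1 f -> L1 g -> (forall x, I0 x -> f x <= g x) ->
  \int[mu]_(x in I0) f x <= \int[mu]_(x in I0) g x.
Proof. by move=> hf hg fg; exact: le_Rintegral. Qed.

Lemma le_normr_Rintegral_L1 f : L1 f ->
  `|\int[mu]_(x in I0) f x| <= \int[mu]_(x in I0) `|f x|.
Proof. by move=> hf; exact: le_normr_Rintegral. Qed.

Lemma Rintegral_I0_cst (k : R) : \int[mu]_(x in I0) k = k * pi.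
Proof. by rewrite Rintegral_cst// [X in fine X]measure_I0. Qed.

Lemma eq_L2dot f f' g g' : (forall x, I0 x -> f x = f' x) ->
  (forall x, I0 x -> g x = g' x) -> L2dot f g = L2dot f' g'.
Proof.
by move=> ff gg; apply: eq_Rintegral => x /set_mem Dx; rewrite ff ?gg.
Qed.

Lemma L2dotC f g : L2dot f g = L2dot g f.
Proof. by apply: eq_Rintegral => x _; rewrite mulrC. Qed.

Lemma L2dotDl f g h : L2 f -> L2 g -> L2 h ->
  L2dot (fun x => f x + g x) h = L2dot f h + L2dot g h.
Proof.
move=> hf hg hh; rewrite -RintegralD//; [|exact: L2_L1M|exact: L2_L1M].
by apply: eq_Rintegral => x _; rewrite mulrDl.
Qed.

Lemma L2dotZl (k : R) f h : L2 f -> L2 h ->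
  L2dot (fun x => k * f x) h = k * L2dot f h.
Proof.
move=> hf hh; rewrite -RintegralZl//; last exact: L2_L1M.
by apply: eq_Rintegral => x _; rewrite mulrA.
Qed.

Lemma L2dotBl f g h : L2 f -> L2 g -> L2 h ->
  L2dot (fun x => f x - g x) h = L2dot f h - L2dot g h.
Proof.
move=> hf hg hh; rewrite -RintegralB//; [|exact: L2_L1M|exact: L2_L1M].
by apply: eq_Rintegral => x _; rewrite mulrBl.
Qed.

Lemma L2dot_suml (N : nat) (F : nat -> R -> R) h : (forall n, L2 (F n)) -> L2 h ->
  L2dot (fun x => \sum_(n < N) F n x) h = \sum_(n < N) L2dot (F n) h.
Proof.
move=> hF hh; elim: N => [|N IH].
  rewrite big_ord0 /L2dot (@eq_Rintegral _ _ _ _ _ (cst 0)) ?Rintegral_cst ?mul0r//.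
  by move=> x _; rewrite big_ord0 mul0r.
rewrite big_ord_recr/= -IH -L2dotDl//; last exact: L2_sum.
by apply: eq_L2dot => // x _; rewrite big_ord_recr.
Qed.

Lemma L2dot_ge0 f : 0 <= L2dot f f.
Proof. by apply: Rintegral_ge0 => x _; rewrite -expr2 sqr_ge0. Qed.

Lemma EFin_Rintegral_L1 f : L1 f -> (\int[mu]_(x in I0) f x)%:E = (\int[mu]_(x in I0) (f x)%:E)%E.
Proof. by move=> hf; rewrite /Rintegral fineK//; apply: integrable_fin_num. Qed.

Lemma L2dist2E f g : L2 f -> L2 g ->
  L2dist2 f g = (L2dot (fun x => f x - g x) (fun x => f x - g x))%:E.
Proof.
move=> hf hg; have hfg := L2B hf hg.
rewrite /L2dot EFin_Rintegral_L1; last exact: L2_L1M.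
by apply: eq_integral => x _; rewrite expr2.
Qed.

Lemma L2dot_CS f g : L2 f -> L2 g -> (L2dot f g) ^+ 2 <= L2dot f f * L2dot g g.
Proof.
move=> hf hg.
set a := L2dot f f; set b := L2dot f g; set c := L2dot g g.
have a0 : 0 <= a := L2dot_ge0 f.
have c0 : 0 <= c := L2dot_ge0 g.
have H (s : R) : 0 <= a - 2 * s * b + s ^+ 2 * c.
  have := L2dot_ge0 (fun x => f x - s * g x).
  have hsg := L2Z s hg.
  have hfsg : L2 (fun x => f x - s * g x) := L2B hf hsg.
  have E1 : L2dot (fun x => f x - s * g x) f = a - s * b.
    by rewrite L2dotBl// L2dotZl// (L2dotC g f).
  have E2 : L2dot (fun x => f x - s * g x) g = b - s * c.
    by rewrite L2dotBl// L2dotZl.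
  rewrite L2dotBl// (L2dotZl s hg hfsg) (L2dotC f) E1 (L2dotC g) E2.
  by rewrite (_ : _ - _ = a - 2 * s * b + s ^+ 2 * c)//; ring.
(* If c = 0 the polynomial in s is affine, and for b nonzero s = (a + 1) / (2 b) would make it -1.
   Otherwise s = b / c is the minimiser. *)
have [c0'|cN0] := eqVneq c 0.
  rewrite c0' mulr0; have [->|bN0] := eqVneq b 0; first by rewrite expr0n.
  have := H ((a + 1) / (2 * b)); rewrite c0' mulr0 addr0.
  rewrite (_ : _ - _ = -1); last by field.
  by rewrite ler0N1.
have cp : 0 < c by rewrite lt_neqAle eq_sym cN0.
have := H (b / c); rewrite (_ : _ + _ = (a * c - b ^+ 2) / c); last by field.
by rewrite pmulr_lge0 ?invr_gt0// subr_ge0.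
Qed.

Lemma L2dot_ae f f' g : L2 f -> L2 f' -> L2 g ->
  {ae mu, forall x, I0 x -> f x = f' x} -> L2dot f g = L2dot f' g.
Proof.
move=> [mf _] [mf' _] [mg _] ff'; rewrite /L2dot /Rintegral; congr fine.
apply: ae_eq_integral => //.
- by apply/measurable_EFinP; exact: measurable_funM.
- by apply/measurable_EFinP; exact: measurable_funM.
- by apply: aeS ff' => x /= H Dx; rewrite H.
Qed.

Lemma dominated_cvg_L1 (f_ : nat -> R -> R) f g :
  (forall n, measurable_fun I0 (f_ n)) -> measurable_fun I0 f ->
  {ae mu, forall x, I0 x -> f_ ^~ x @ \oo --> f x} -> L1 g ->
  (forall n x, I0 x -> `|f_ n x| <= g x) ->
  L1 f /\ (fun n => \int[mu]_(x in I0) f_ n x) @ \oo --> \int[mu]_(x in I0) f x.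
Proof.
move=> mf_ mf f_f ig f_g.
have hf_ n : L1 (f_ n) by apply: le_L1 ig _ => //; exact: f_g.
have ae1 : {ae mu, forall x, I0 x -> (EFin \o f_ n) x @[n --> \oo] --> (EFin \o f) x}.
  by apply: aeS f_f => x H Dx; apply: cvg_EFin; [exact: nearW|exact: H].
have ae2 : {ae mu, forall x (n : nat), I0 x -> (`|(EFin \o f_ n) x| <= (EFin \o g) x)%E}.
  by apply: aeS ae1 => x _ n Dx; rewrite lee_fin f_g.
have [hf _ c] := @dominated_convergence _ _ _ mu I0 (measurable_itv _)
  (fun n => EFin \o f_ n) (EFin \o f) (EFin \o g) (fun n => measurable_int _ (hf_ n))
  (measurableT_comp (@EFin_measurable _ _) mf) ae1 ig ae2.
split=> //; apply: fine_cvg; rewrite EFin_Rintegral_L1//.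
Qed.
End L2.

(** * Cosine series *)
Section CosineSystem.
Context {R : realType}.
Local Notation mu := (@lebesgue_measure R).
Local Notation I0 := (`]0, pi[%classic : set R).
Implicit Types (f g h F : R -> R) (a : nat -> R).

Lemma continuous_measurable_in f (A : set R) : measurable A -> continuous f -> measurable_fun A f.
Proof.
by move=> mA cf; apply: measurable_funTS; exact: continuous_measurable_fun.
Qed.

Lemma continuous_integrable_oo f (a b : R) : continuous f ->
  mu.-integrable `]a, b[ (EFin \o f).
Proof.
move=> cf; apply: (@integrableS _ _ _ mu `[a, b]%classic) => //.
  by apply: subset_itv; rewrite bnd_simp.
apply: continuous_compact_integrable; first exact: segment_compact.
exact: continuous_subspaceT.
Qed.

Lemma continuous_L1 f : continuous f -> L1 f.
Proof. exact: continuous_integrable_oo. Qed.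

Lemma continuous_bounded_I0 f : continuous f ->
  exists M : R, forall x, I0 x -> `|f x| <= M.
Proof.
move=> cf; have cN : {within `[0, pi], continuous (fun x => `|f x|)}.
  apply: continuous_subspaceT => x; apply: continuous_comp; first exact: cf.
  exact: norm_continuous.
have [c _ Hc] := EVT_max (@pi_ge0 R) cN.
exists `|f c| => x /=; rewrite in_itv/= => /andP[x0 xpi]; apply: Hc.
by rewrite in_itv/= !ltW.
Qed.

Lemma continuous_L2 f : continuous f -> L2 f.
Proof.
move=> cf; have [M HM] := continuous_bounded_I0 cf.
by apply: (@L2_bounded _ _ M) => //; exact: continuous_measurable_in.
Qed.

Lemma Rintegral_FTC2 f F (a b : R) : a <= b -> continuous f ->
  (forall x : R, is_derive x (1 : R) F (f x)) ->
  \int[mu]_(x in `]a, b[) f x = F b - F a.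
Proof.
move=> ab cf dF; have [->|ba] := eqVneq a b.
  by rewrite set_itv_ge ?bnd_simp ?ltxx// Rintegral_set0 subrr.
have {}ab : a < b by rewrite lt_neqAle ba.
have cF : continuous F.
  move=> x; apply: differentiable_continuous; apply/derivable1_diffP.
  by case: (dF x).
have := @continuous_FTC2 R f F a b ab (continuous_subspaceT cf).
have H1 : derivable_oo_LRcontinuous F a b.
  split; first by move=> x _; case: (dF x).
  - by apply: cvg_at_right_filter; exact: cF.
  - by apply: cvg_at_left_filter; exact: cF.
have H2 : {in `]a, b[, derive1 F =1 f}.
  by move=> x _; rewrite derive1E; exact: derive_val.
move=> /(_ H1 H2) E.
have fi : mu.-integrable `[a, b[ (EFin \o f).
  apply: (@integrableS _ _ _ mu `[a, b]%classic) => //.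
    by apply: subset_itv; rewrite bnd_simp.
  apply: continuous_compact_integrable; first exact: segment_compact.
  exact: continuous_subspaceT.
rewrite Rintegral_itv_obnd_cbnd; last exact: continuous_integrable_oo.
by rewrite Rintegral_itv_bndo_bndc// /Rintegral E.
Qed.

Lemma is_derive_cosM (k x : R) :
  is_derive x (1 : R) (fun y => cos (k * y)) (- (k * sin (k * x))).
Proof.
have d : is_derive x (1 : R) (fun y : R => k * y) k.
  have := is_deriveZ k (is_derive_id x (1 : R)).
  by rewrite scaler1.
have := is_derive1_comp (is_derive_cos (k * x)) d.
by rewrite mulNr mulrC.
Qed.

Lemma is_derive_sinM (k x : R) :
  is_derive x (1 : R) (fun y => sin (k * y)) (k * cos (k * x)).
Proof.
have d : is_derive x (1 : R) (fun y : R => k * y) k.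
  have := is_deriveZ k (is_derive_id x (1 : R)).
  by rewrite scaler1.
have := is_derive1_comp (is_derive_sin (k * x)) d.
by rewrite mulrC.
Qed.

Lemma continuous_cosM (k : R) : continuous (fun y : R => cos (k * y)).
Proof.
move=> x; apply: (@continuous_comp _ _ _ (fun y => k * y)); last exact: continuous_cos.
exact: mulrl_continuous.
Qed.

Lemma sin_natpi (n : nat) : sin (n%:R * pi) = 0 :> R.
Proof.
elim: n => [|n IH]; first by rewrite mul0r sin0.
by rewrite -natr1 mulrDl mul1r sinDpi IH oppr0.
Qed.

Lemma Rintegral_cos_nat (n : nat) :
  \int[mu]_(x in I0) cos (n%:R * x) = (n == 0)%:R * pi.
Proof.
case: n => [|n].
  rewrite (@eq_Rintegral _ _ _ _ _ (cst 1)) => [|x _]; last by rewrite mul0r cos0.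
  by rewrite Rintegral_cst// eqxx !mul1r [X in fine X]measure_I0.
have dS (x : R) : is_derive x (1 : R) (fun y => n.+1%:R^-1 * sin (n.+1%:R * y)) (cos (n.+1%:R * x)).
  have := is_deriveZ n.+1%:R^-1 (is_derive_sinM n.+1%:R x).
  by rewrite /GRing.scale/= mulKf.
rewrite mul0r (Rintegral_FTC2 (@pi_ge0 R) (@continuous_cosM n.+1%:R) dS).
by rewrite sin_natpi !mulr0 sin0 mulr0 subrr.
Qed.

(** The inverse of the L^2(0, pi) norm of cos (n x), whose square is pi for n = 0 and pi / 2
    otherwise. *)
Definition nb (n : nat) : R := Num.sqrt ((if n == 0 then 1 else 2) / pi).
Definition cb (n : nat) (x : R) : R := nb n * cos (n%:R * x).

Lemma nb_ge0 n : 0 <= nb n. Proof. exact: sqrtr_ge0. Qed.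

Lemma nb_gt0 n : 0 < nb n.
Proof. by rewrite sqrtr_gt0 divr_gt0 ?pi_gt0//; case: ifP. Qed.

Lemma nb_sqr n : nb n ^+ 2 = (if n == 0 then 1 else 2) / pi.
Proof. by rewrite sqr_sqrtr// divr_ge0 ?pi_ge0//; case: ifP. Qed.

Lemma nb_le1 n : nb n <= 1.
Proof.
rewrite -sqrtr1 ler_sqrt// ler_pdivrMr ?pi_gt0// mul1r.
by case: ifP => _; [apply: le_trans (@pi_ge2 R); rewrite ler1n|exact: pi_ge2].
Qed.

Lemma cb_le1 n x : `|cb n x| <= 1.
Proof.
rewrite normrM (ger0_norm (nb_ge0 n)) -[leRHS]mulr1 ler_pM ?nb_ge0 ?nb_le1//.
exact: cos_max.
Qed.

Lemma continuous_cb n : continuous (cb n).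
Proof.
by move=> x; apply: cvgM; [exact: cvg_cst|exact: continuous_cosM].
Qed.

Lemma L2_cb n : L2 (cb n).
Proof. by apply: continuous_L2; exact: continuous_cb. Qed.

Lemma cosM_cos (x y : R) : cos x * cos y = 2^-1 * (cos (x - y) + cos (x + y)).
Proof. by rewrite cosB cosD; field. Qed.

Lemma L2dot_cb m n : L2dot (cb m) (cb n) = (m == n)%:R :> R.
Proof.
(* The difference of the two indices has to be a natural number for [Rintegral_cos_nat]. *)
wlog mn : m n / (n <= m)%N.
  move=> H; have [/H//|nm] := leqP n m.
  by rewrite L2dotC H ?(ltnW nm)// eq_sym.
have -> : L2dot (cb m) (cb n) = \int[mu]_(x in I0) ((2^-1 * nb m * nb n) *
  (cos ((m - n)%N%:R * x) + cos ((m + n)%N%:R * x))).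
  apply: eq_Rintegral => x _; rewrite natrB// natrD mulrBl mulrDl.
  by rewrite /cb mulrACA cosM_cos; ring.
rewrite RintegralZl//; last first.
  by apply: L1D; apply: continuous_L1; exact: continuous_cosM.
rewrite RintegralD//; [|by apply: continuous_L1; exact: continuous_cosM..].
rewrite !Rintegral_cos_nat subn_eq0 addn_eq0.
have pi0 : (pi : R) != 0 by rewrite gt_eqF ?pi_gt0.
have [->|mNn] := eqVneq m n.
  rewrite leqnn andbb mul1r (_ : 2^-1 * nb n * nb n = 2^-1 * nb n ^+ 2); last by ring.
  rewrite nb_sqr; move: (pi : R) pi0 => p p0.
  by case: eqP => _ /=; rewrite ?mul1r ?mul0r; field.
rewrite leqNgt ltn_neqAle eq_sym mNn mn/= (_ : (m == 0%N) && _ = false) ?mul0r ?addr0 ?mulr0//.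
by apply/negbTE/negP => /andP[/eqP m0 /eqP n0]; rewrite m0 n0 eqxx in mNn.
Qed.

Definition nsum a := cvgn (series (fun n => `|a n|)).

Definition cser a (x : R) : R := limn (series (fun n => a n * cb n x)).

Lemma nsum_le a (b : nat -> R) : (forall n, `|a n| <= b n) -> cvgn (series b) -> nsum a.
Proof.
move=> ab; apply: series_le_cvg => // n; exact: le_trans (ab n).
Qed.

Lemma cser_cvg a x : nsum a -> series (fun n => a n * cb n x) @ \oo --> cser a x.
Proof.
move=> na; apply: normed_cvg; apply: series_le_cvg na => n /=; rewrite ?normr_ge0//.
by rewrite normrM ler_piMr// cb_le1.
Qed.

(** As |cb n x| <= 1, the remainder of the series of |a n| bounds that of the cosine series
    uniformly in x. Continuity, termwise integration and convergence in L^2 all rest on this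
    bound. *)
Lemma cser_tail a : nsum a -> exists tl : nat -> R, [/\ tl @ \oo --> 0,
  forall N, 0 <= tl N &
  forall N x, `|cser a x - \sum_(n < N) a n * cb n x| <= tl N].
Proof.
move=> na; pose A : nat -> R := series (fun n => `|a n|).
have ndA : nondecreasing_seq A.
  by apply: nondecreasing_series => n _ _.
exists (fun N => limn A - A N); split.
- by rewrite -(subrr (limn A)); apply: cvgB => //; exact: cvg_cst.
- by move=> N; rewrite subr_ge0; exact: nondecreasing_cvgn_le.
move=> N x; have := @cser_cvg a x na.
set S := series _ => cS.
have -> : \sum_(n < N) a n * cb n x = S N by rewrite /S seriesEord.
have cD : (fun M => `|S M - S N|) @ \oo --> `|cser a x - S N|.
  by apply: cvg_norm; apply: cvgB => //; exact: cvg_cst.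
rewrite -(cvg_lim _ cD)//; apply: limr_le; first by apply/cvg_ex; eexists; exact: cD.
near=> M; have NM : (N <= M)%N by near: M; exact: nbhs_infty_ge.
rewrite /S sub_series_geq//; apply: (@le_trans _ _ (A M - A N)).
  rewrite /A sub_series_geq//; apply: le_trans (ler_norm_sum _ _ _) _.
  by apply: ler_sum => n _; rewrite normrM ler_piMr// cb_le1.
by rewrite lerD2r; exact: nondecreasing_cvgn_le.
Unshelve. all: by end_near. Qed.

Lemma continuous_sum_fun (N : nat) (F : nat -> R -> R) : (forall n, continuous (F n)) ->
  continuous (fun x => \sum_(n < N) F n x).
Proof.
move=> cF; elim: N => [|N IH].
  by under eq_fun do rewrite big_ord0; move=> x; exact: cvg_cst.
under eq_fun do rewrite big_ord_recr/=.
by move=> x; apply: cvgD; [exact: IH|exact: cF].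
Qed.

Lemma continuous_cser a : nsum a -> continuous (cser a).
Proof.
move=> na x; have [tl [tl0 tlge0 Htl]] := cser_tail na.
apply/cvgrPdist_le => /= e e0.
have e3 : 0 < e / 3 by rewrite divr_gt0.
have /cvgrPdist_le /(_ _ e3) [N _ HN] := tl0.
have {}HN : tl N <= e / 3.
  by have := HN N (leqnn N); rewrite /= sub0r normrN ger0_norm.
pose S y := \sum_(n < N) a n * cb n y.
have cS : continuous S.
  apply: (@continuous_sum_fun N (fun n y => a n * cb n y)) => n y.
  by apply: cvgM; [exact: cvg_cst|exact: continuous_cb].
have /cvgrPdist_le /(_ _ e3) := cS x; apply: filterS => y Hy.
have Hx := Htl N x; have Hy' := Htl N y; rewrite -/(S x) -/(S y) in Hx Hy'.
rewrite (_ : cser a x - cser a y = (cser a x - S x) + (S x - S y) - (cser a y - S y)); last by ring.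
apply: le_trans (ler_normB _ _) _.
apply: (@le_trans _ _ (`|cser a x - S x| + `|S x - S y| + `|cser a y - S y|)).
  by rewrite lerD2r; exact: ler_normD.
by move: (le_trans Hx HN) Hy (le_trans Hy' HN); lra.
Qed.

(** The error of the N-th partial sum is at most [tl N] times the L^1 norm of f. This plays the part
    of Parseval's identity: one factor is merely in L^1, the other has absolutely summable
    coefficients. *)
Lemma RintegralM_cser f a : L1 f -> nsum a ->
  series (fun n => a n * \int[mu]_(x in I0) (f x * cb n x)) @ \oo -->
  \int[mu]_(x in I0) (f x * cser a x).
Proof.
move=> hf na; have [tl [tl0 tlge0 Htl]] := cser_tail na.
have mcb n : measurable_fun I0 (cb n).
  by apply: continuous_measurable_in => //; exact: continuous_cb.
have hfc n : L1 (fun x => f x * cb n x).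
  by apply: (@L1M_bounded _ _ _ 1) => // x _; exact: cb_le1.
have cC := continuous_cser na.
have [M HM] := continuous_bounded_I0 cC.
have mC : measurable_fun I0 (cser a) by exact: continuous_measurable_in.
have hfC : L1 (fun x => f x * cser a x) by exact: (@L1M_bounded _ _ _ M).
have H N : L1 (fun x => \sum_(n < N) a n * (f x * cb n x)) /\
   \int[mu]_(x in I0) (\sum_(n < N) a n * (f x * cb n x)) =
   \sum_(n < N) a n * \int[mu]_(x in I0) (f x * cb n x).
  elim: N => [|N [IH1 IH2]].
    split; first by apply: eq_L1 (L1_cst 0) => x _; rewrite big_ord0.
    rewrite big_ord0 (@eq_Rintegral _ _ _ _ _ (cst 0)) ?Rintegral_cst ?mul0r// => x _.
    by rewrite big_ord0.
  split.
    apply: eq_L1 (L1D IH1 (L1Z (a N) (hfc N))) => x _.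
    by rewrite big_ord_recr.
  rewrite big_ord_recr/= -IH2 -Rintegral_L1Z// -Rintegral_L1D//; last exact: L1Z.
  by apply: eq_Rintegral => x _; rewrite big_ord_recr.
have T N : `|\int[mu]_(x in I0) (f x * cser a x) -
    series (fun n => a n * \int[mu]_(x in I0) (f x * cb n x)) N| <=
    tl N * \int[mu]_(x in I0) `|f x|.
  have [H1 H2] := H N; rewrite seriesEord/= -H2 -RintegralB//.
  apply: le_trans (le_normr_Rintegral _ _) _ => //; first exact: L1B.
  rewrite -RintegralZl//; last exact: L1_norm.
  apply: le_Rintegral => //.
  - by apply: L1_norm; exact: L1B.
  - by apply: L1Z; exact: L1_norm.
  - move=> x _ /=.
    under eq_bigr do rewrite mulrCA.
    by rewrite -mulr_sumr -mulrBr normrM mulrC ler_wpM2r// Htl.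
apply/cvgrPdist_le => /= e e0.
have : (fun N => tl N * \int[mu]_(x in I0) `|f x|) @ \oo --> 0.
  by rewrite -[X in _ --> X](mul0r (\int[mu]_(x in I0) `|f x|)); apply: cvgMl.
move=> /cvgrPdist_le /(_ _ e0); apply: filterS => N; rewrite sub0r normrN => HN.
exact: le_trans (T N) (le_trans (ler_norm _) HN).
Qed.
End CosineSystem.

(** * The heat kernel *)
Section HeatSeries.
Context {R : realType}.
Local Notation mu := (@lebesgue_measure R).
Local Notation I0 := (`]0, pi[%classic : set R).
Implicit Types (f g h F : R -> R) (a : nat -> R) (t x y z : R).

Lemma cvg_sum_ord (N : nat) (F : nat -> nat -> R) (l : nat -> R) :
  (forall i, F i @ \oo --> l i) ->
  (fun n => \sum_(i < N) F i n) @ \oo --> \sum_(i < N) l i.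
Proof.
move=> Fl; elim: N => [|N IH].
  by under eq_fun do rewrite big_ord0; rewrite big_ord0; exact: cvg_cst.
by under eq_fun do rewrite big_ord_recr/=; rewrite big_ord_recr/=; exact: cvgD.
Qed.

Lemma cserN a x : cser a (- x) = cser a x.
Proof.
by rewrite /cser; congr (limn (series _)); apply/funext => n; rewrite /cb mulrN cosN.
Qed.

Lemma cos_nat2piB (n : nat) z : cos (n%:R * (2 * pi - z)) = cos (n%:R * z).
Proof.
have per (w : R) (k : nat) : cos (w + k%:R * (2 * pi)) = cos w.
  elim: k => [|k IH]; first by rewrite mul0r addr0.
  by rewrite -natr1 mulrDl mul1r addrA (mulr_natl pi 2) cosD2pi -(mulr_natl pi 2).
by rewrite mulrBr addrC per cosN.
Qed.

Lemma cser2piB a x : cser a (2 * pi - x) = cser a x.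
Proof.
by rewrite /cser; congr (limn (series _)); apply/funext => n; rewrite /cb cos_nat2piB.
Qed.

Lemma L2dot_cser a m : nsum a -> L2dot (cser a) (cb m) = a m.
Proof.
move=> na; have := RintegralM_cser (L2_L1 (L2_cb m)) na.
rewrite L2dotC; set S := series _ => cS.
have : S @ \oo --> a m.
  apply: cvg_near_cst; exists m.+1 => // N /= mN.
  rewrite /S seriesEord/= (bigD1 (Ordinal mN))//= big1 ?addr0.
    by rewrite -/(L2dot (cb m) (cb m)) L2dot_cb eqxx mulr1.
  move=> i /eqP im; rewrite -/(L2dot (cb m) (cb i)) L2dot_cb.
  by case: eqP => [mi|_]; rewrite ?mulr0//; case: im; apply/val_inj.
by move=> /(cvg_unique _ cS) => /(_ (@Rhausdorff R)).
Qed.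

Lemma Rintegral_cser_cos a m : nsum a ->
  \int[mu]_(y in I0) (cser a y * cos (m%:R * y)) = a m / nb m.
Proof.
move=> na; have n0 : (nb m : R) != 0 by rewrite gt_eqF// nb_gt0.
rewrite -(L2dot_cser m na) mulrC; apply: (mulfI n0); rewrite mulVKf// -Rintegral_L1Z.
  by apply: eq_Rintegral => y _; rewrite /cb mulrCA.
apply: continuous_L1 => y; apply: cvgM; first exact: continuous_cser.
exact: continuous_cosM.
Qed.

Definition gcoef t (n : nat) : R := expR (- (t * n%:R ^+ 2)).

Lemma nsum_gcoef t : 0 < t -> nsum (gcoef t).
Proof.
move=> t0; apply: (@nsum_le _ _ (geometric 1 (expR (- t)))).
  move=> n; rewrite ger0_norm ?expR_ge0//= mul1r -expRM_natl ler_expR mulrN lerN2.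
  by rewrite mulrC ler_pM2l// -natrX ler_nat; case: n => // n; rewrite -mulnn leq_pmulr.
by apply: is_cvg_geometric_series; rewrite ger0_norm ?expR_ge0// expR_lt1 oppr_lt0.
Qed.

Lemma nsumM a (b : nat -> R) (M : R) : (forall n, `|b n| <= M) -> nsum a ->
  nsum (fun n => a n * b n).
Proof.
move=> bM na; apply: (@nsum_le _ _ (fun n => M * `|a n|)).
  by move=> n; rewrite normrM mulrC ler_wpM2r.
exact: (is_cvg_seriesZ (k := M) na).
Qed.

(** Since [nb n ^+ 2 / 2] is 1 / (2 pi) for n = 0 and 1 / pi otherwise, this is (2 pi)^-1 times the
    sum over all integers n of exp (- t n^2) cos (n z), the heat kernel of the circle of length 2
    pi. *)
Definition theta t z := cser (fun n => gcoef t n * (nb n / 2)) z.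

(** The eigenfunction expansion of the heat kernel, arranged as a cosine series in y so that the
    results on [cser] apply for fixed x. *)
Definition hk t x y := cser (fun n => gcoef t n * cb n x) y.

Lemma nb2_le1 n : `|nb n / 2| <= 1 :> R.
Proof.
rewrite ger0_norm ?divr_ge0 ?nb_ge0// ler_pdivrMr// mul1r.
by apply: le_trans (nb_le1 n) _; rewrite ler1n.
Qed.

Lemma nsum_theta t : 0 < t -> nsum (fun n => gcoef t n * (nb n / 2)).
Proof. by move=> t0; apply: nsumM (nsum_gcoef t0); exact: nb2_le1. Qed.

Lemma nsum_hk t x : 0 < t -> nsum (fun n => gcoef t n * cb n x).
Proof. by move=> t0; apply: nsumM (nsum_gcoef t0) => n; exact: cb_le1. Qed.

(** The method of images: 2 cos a cos b = cos (a - b) + cos (a + b), term by term. *)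
Lemma hkE t x y : 0 < t -> hk t x y = theta t (x - y) + theta t (x + y).
Proof.
move=> t0; apply/cvg_lim => //.
rewrite (_ : series _ = series (fun n => gcoef t n * (nb n / 2) * cb n (x - y)) +
                        series (fun n => gcoef t n * (nb n / 2) * cb n (x + y))).
  by apply: cvgD; apply: cser_cvg; exact: nsum_theta.
rewrite -seriesD; congr series; apply/funext => n.
by rewrite !fctE /cb mulrBr mulrDr cosB cosD; field.
Qed.

Lemma thetaN t z : theta t (- z) = theta t z. Proof. exact: cserN. Qed.

Lemma theta2piB t z : theta t (2 * pi - z) = theta t z. Proof. exact: cser2piB. Qed.

Lemma continuous_theta t : 0 < t -> continuous (theta t).
Proof. by move=> t0; apply: continuous_cser; exact: nsum_theta. Qed.

Lemma Rintegral_theta_cos t m : 0 < t ->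
  \int[mu]_(z in I0) (theta t z * cos (m%:R * z)) = gcoef t m / 2.
Proof.
move=> t0; rewrite (Rintegral_cser_cos m (nsum_theta t0)).
by field; rewrite gt_eqF// nb_gt0.
Qed.

(** The mass of theta over half a period is 1 / 2. The weight vanishes at z = 0, and the result is
    O(t) as t tends to 0, so that it can be integrated against t^(-alpha-1). *)
Lemma Rintegral_theta_1B t m : 0 < t ->
  \int[mu]_(z in I0) ((2 - 2 * cos (m%:R * z)) * theta t z) = 1 - gcoef t m.
Proof.
move=> t0; have ct := continuous_theta t0.
have E0 := Rintegral_theta_cos 0 t0; have Em := Rintegral_theta_cos m t0.
have ck (k : nat) : L1 (fun z => theta t z * cos (k%:R * z)).
  by apply: continuous_L1 => z; apply: cvgM; [exact: ct|exact: continuous_cosM].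
transitivity (2 * \int[mu]_(z in I0) (theta t z * cos (0%:R * z)) -
   2 * \int[mu]_(z in I0) (theta t z * cos (m%:R * z))); last first.
  by rewrite E0 Em /gcoef expr0n/= mulr0 oppr0 expR0; field.
rewrite -!Rintegral_L1Z// -Rintegral_L1B//; [|exact: L1Z..].
by apply: eq_Rintegral => z _; rewrite mul0r cos0 mulr1; ring.
Qed.

Section positivity.
Variables (t z : R).
Hypothesis t0 : 0 < t.

Let G (j k : R) := expR (- (t * (j - k) ^+ 2)) * cos ((j - k) * z).

(* Since (j - k)^2 = j^2 - 2 j k + k^2, expanding exp(2 t j k) in powers of j k
   turns the double sum into a sum of squares. *)
Let toeplitz_ge0 M : 0 <= \sum_(j < M) \sum_(k < M) G j%:R k%:R.
Proof.
pose w (j : nat) : R := expR (- (t * j%:R ^+ 2)).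
pose T (L : nat) : R := \sum_(j < M) \sum_(k < M) (w j * w k *
  series (exp_coeff (2 * t * j%:R * k%:R)) L * cos ((j%:R - k%:R) * z)).
have T0 L : 0 <= T L.
  have -> : T L = \sum_(l < L) ((2 * t) ^+ l / l`!%:R *
      ((\sum_(j < M) w j * j%:R ^+ l * cos (j%:R * z)) ^+ 2 +
       (\sum_(j < M) w j * j%:R ^+ l * sin (j%:R * z)) ^+ 2)).
    rewrite /T; under eq_bigr => j _.
      under eq_bigr => k _.
        rewrite seriesEord/= mulr_sumr mulr_suml; over.
      rewrite exchange_big/=; over.
    rewrite exchange_big/=; apply: eq_bigr => l _.
    rewrite !expr2 !big_distrlr/= -big_split/= mulr_sumr; apply: eq_bigr => j _.
    rewrite -big_split/= mulr_sumr; apply: eq_bigr => k _.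
    rewrite /exp_coeff/= mulrBl cosB !exprMn; ring.
  apply: sumr_ge0 => l _; apply: mulr_ge0; last by rewrite addr_ge0 ?sqr_ge0.
  by rewrite divr_ge0 ?exprn_ge0// mulr_ge0// ltW.
have cT : T @ \oo --> \sum_(j < M) \sum_(k < M) G j%:R k%:R.
  apply: (@cvg_sum_ord M (fun j L => \sum_(k < M) (w j * w k *
    series (exp_coeff (2 * t * j%:R * k%:R)) L * cos ((j%:R - k%:R) * z)))
    (fun j => \sum_(k < M) G j%:R k%:R)) => j.
  apply: (@cvg_sum_ord M (fun k L => w j * w k *
    series (exp_coeff (2 * t * j%:R * k%:R)) L * cos ((j%:R - k%:R) * z))
    (fun k => G j%:R k%:R)) => k.
  have -> : G j%:R k%:R = w j * w k * expR (2 * t * j%:R * k%:R) * cos ((j%:R - k%:R) * z).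
    by rewrite /G /w -!expRD; congr (expR _ * _); ring.
  apply: cvgM; last exact: cvg_cst.
  by apply: cvgM; [exact: cvg_cst|exact: is_cvg_series_exp_coeff].
by rewrite -(cvg_lim _ cT)//; apply: limr_ge; [apply/cvg_ex; eexists; exact: cT|apply: nearW].
Qed.

(* The Cesaro means of the series are the Toeplitz sums above. *)
Lemma theta_ge0 : 0 <= theta t z.
Proof.
pose S N := series (fun n => gcoef t n * (nb n / 2) * cb n z) N.+1.
have cS : S @ \oo --> theta t z.
  rewrite /S (cvg_shiftS (series (fun n => gcoef t n * (nb n / 2) * cb n z))).
  exact: cser_cvg (nsum_theta t0).
pose D M : R := \sum_(j < M) \sum_(k < M) G j%:R k%:R.
(* The new row and column contribute equally and the new diagonal entry is 1. This is 2 pi times a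
   partial sum of the series, as 2 pi (nb n)^2 / 2 is 1 for n = 0 and 2 otherwise. *)
have DS M : D M.+1 = D M + 2 * pi * S M.
  have GM : \sum_(k < M) G M%:R k%:R =
      \sum_(k < M) gcoef t k.+1 * cos (k.+1%:R * z).
    rewrite (reindex_inj rev_ord_inj)/=; apply: eq_bigr => k _.
    by rewrite /G natrB ?ltn_ord// subKr.
  have Gs : \sum_(j < M) G j%:R M%:R = \sum_(k < M) G M%:R k%:R.
    apply: eq_bigr => k _; rewrite /G -(opprB M%:R) sqrrN mulNr.
    by rewrite cosN.
  rewrite /D big_ord_recr/=; under eq_bigr do rewrite big_ord_recr/=.
  rewrite big_split/= -/(D M) big_ord_recr/= Gs GM -!addrA; congr (_ + _).
  have -> : G M%:R M%:R = 1 by rewrite /G subrr expr0n/= mulr0 oppr0 expR0 mul0r cos0 mulr1.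
  have pi0 : (pi : R) != 0 by rewrite gt_eqF ?pi_gt0.
  rewrite /S seriesEord/= big_ord_recl/= mulrDr.
  rewrite (_ : 2 * pi * _ = 1); last first.
    rewrite /cb /gcoef expr0n/= mulr0 oppr0 expR0 mul1r mul0r cos0 mulr1.
    rewrite (_ : nb 0 / 2 * nb 0 = nb 0 ^+ 2 / 2); last by rewrite expr2 mulrAC.
    by rewrite nb_sqr eqxx; move: (pi : R) pi0 => p p0; field.
  rewrite mulr_sumr addrA addrC; congr (_ + _).
  rewrite -big_split/=; apply: eq_bigr => k _; rewrite /bump/= add1n /cb.
  rewrite (_ : _ * _ * (nb _ * _) = gcoef t k.+1 * cos (k.+1%:R * z) * (nb k.+1 ^+ 2 / 2)); last first.
    by field.
  by rewrite nb_sqr/=; move: (pi : R) pi0 => p p0; field.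
have DE M : D M.+1 = 2 * pi * \sum_(k < M.+1) S k.
  elim: M => [|M IH]; rewrite DS; last by rewrite IH -mulrDr [in RHS]big_ord_recr.
  by rewrite /D big_ord0 add0r big_ord1.
have := cesaro cS; set A := (X in X @ _ --> _) => cA.
rewrite -(cvg_lim _ cA)//; apply: limr_ge; first by apply/cvg_ex; eexists; exact: cA.
apply: nearW => M; rewrite /A /arithmetic_mean/= mulr_ge0// seriesEord/=.
have : 0 <= D M.+1 := toeplitz_ge0 M.+1.
by rewrite DE pmulr_rge0// mulr_gt0// pi_gt0.
Qed.
End positivity.
End HeatSeries.

(** * Completeness of the cosine system *)

Section Completeness.
Context {R : realType}.
Local Notation mu := (@lebesgue_measure R).
Local Notation I0 := (`]0, pi[%classic : set R).
Implicit Types (f g h F : R -> R) (a : nat -> R) (t x y z : R).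

Lemma hk_ge0 t x y : 0 < t -> 0 <= hk t x y.
Proof. by move=> t0; rewrite hkE// addr_ge0// theta_ge0. Qed.

Lemma continuous_hk t x : 0 < t -> continuous (hk t x).
Proof. by move=> t0; apply: continuous_cser; exact: nsum_hk. Qed.

Lemma Rintegral_hk_cos t x m : 0 < t ->
  \int[mu]_(y in I0) (hk t x y * cos (m%:R * y)) = gcoef t m * cos (m%:R * x).
Proof.
move=> t0; rewrite (Rintegral_cser_cos m (@nsum_hk _ t x t0)) /cb.
by field; rewrite gt_eqF// nb_gt0.
Qed.

Lemma L1_hkM t x h : 0 < t -> continuous h -> L1 (fun y => hk t x y * h y).
Proof.
move=> t0 ch; apply: continuous_L1 => y; apply: cvgM; last exact: ch.
exact: continuous_hk.
Qed.

Lemma Rintegral_hk t x : 0 < t -> \int[mu]_(y in I0) hk t x y = 1.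
Proof.
move=> t0; have := Rintegral_hk_cos x 0 t0.
rewrite mul0r cos0 /gcoef expr0n/= mulr0 oppr0 expR0 mulr1 => <-.
by apply: eq_Rintegral => y _; rewrite mul0r cos0 mulr1.
Qed.

(** By cos^2 y = (1 + cos (2 y)) / 2 the square is a combination of 1, cos y and cos (2 y), on which
    the kernel acts by the factors [gcoef t]. When these tend to 1, the right-hand side tends to
    0. *)
Lemma Rintegral_hk_sqr t x : 0 < t ->
  \int[mu]_(y in I0) (hk t x y * (cos x - cos y) ^+ 2) =
  cos x ^+ 2 - 2 * cos x * (gcoef t 1 * cos x) + 2^-1 * (1 + gcoef t 2 * cos (2 * x)).
Proof.
move=> t0.
have E1 := Rintegral_hk_cos x 1 t0; have E2 := Rintegral_hk_cos x 2 t0.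
have E0 := Rintegral_hk x t0.
have c1 (k : nat) : L1 (fun y => hk t x y * cos (k%:R * y)).
  by apply: L1_hkM => //; exact: continuous_cosM.
have c0 : L1 (hk t x) by apply: continuous_L1; exact: continuous_hk.
transitivity (cos x ^+ 2 * \int[mu]_(y in I0) hk t x y -
   2 * cos x * \int[mu]_(y in I0) (hk t x y * cos (1%:R * y)) +
   2^-1 * (\int[mu]_(y in I0) hk t x y +
           \int[mu]_(y in I0) (hk t x y * cos (2%:R * y)))); last first.
  by rewrite E0 E1 E2 mul1r mulr1.
rewrite -Rintegral_L1D// -!Rintegral_L1Z//; last exact: L1D.
rewrite -Rintegral_L1B//; [|exact: L1Z..].
rewrite -Rintegral_L1D//; [|by apply: L1B; exact: L1Z|by apply: L1Z; exact: L1D].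
apply: eq_Rintegral => y _; rewrite mul1r [2 * y]mulr_natl cos_mulr2n -mulr_natl.
by field.
Qed.

Lemma cvg_gcoef m : (fun n => gcoef (harmonic n : R) m) @ \oo --> (1 : R).
Proof.
have -> : (1 : R) = expR (- (0 * m%:R ^+ 2)) by rewrite mul0r oppr0 expR0.
have c : {for 0 * m%:R ^+ 2, continuous (fun z : R => expR (- z))}.
  by apply: continuous_comp; [exact: opp_continuous|exact: continuous_expR].
apply: (cvg_comp (fun n => harmonic n * m%:R ^+ 2) (fun z : R => expR (- z)) _ c).
by apply: cvgM; [exact: cvg_harmonic|exact: cvg_cst].
Qed.

(** Its inner product with f is the primitive of f at c, so that orthogonality to these steps alone
    forces f to vanish. *)
Definition heaviside (c y : R) : R := if y < c then 1 else 0.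

Lemma heaviside_le1 c y : `|heaviside c y| <= 1.
Proof. by rewrite /heaviside; case: ifP; rewrite ?normr1 ?normr0. Qed.

Lemma measurable_heaviside c : measurable_fun I0 (heaviside c).
Proof.
apply: measurable_funTS; apply: measurable_fun_ifT; last 2 first.
- exact: measurable_cst.
- exact: measurable_cst.
by apply: measurable_fun_ltr => //; exact: measurable_cst.
Qed.

Definition heat_op t f x : R := \int[mu]_(y in I0) (hk t x y * f y).

Lemma nsum_coef t f : 0 < t -> L2 f -> nsum (fun n => gcoef t n * L2dot f (cb n)).
Proof.
move=> t0 hf; apply: (@nsumM _ _ _ (\int[mu]_(x in I0) `|f x|)) (nsum_gcoef t0).
have mcb n : measurable_fun I0 (cb n).
  by apply: continuous_measurable_in => //; exact: continuous_cb.
have h1 := L2_L1 hf.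
move=> n; rewrite /L2dot; apply: le_trans (le_normr_Rintegral_L1 (L2_L1M hf (L2_cb n))) _.
apply: le_Rintegral_L1 => //.
- by apply: L1_norm; exact: L2_L1M (L2_cb n).
- exact: L1_norm.
- by move=> x _; rewrite normrM ler_piMr// cb_le1.
Qed.

Lemma heat_opE t f x : 0 < t -> L2 f ->
  heat_op t f x = cser (fun n => gcoef t n * L2dot f (cb n)) x.
Proof.
move=> t0 hf; have := RintegralM_cser (L2_L1 hf) (@nsum_hk _ t x t0).
rewrite -/(hk t x) => c.
have -> : heat_op t f x = \int[mu]_(y in I0) (f y * hk t x y).
  by apply: eq_Rintegral => y _; rewrite mulrC.
rewrite -(cvg_lim _ c)//; congr (limn (series _)); apply/funext => n.
by rewrite mulrAC.
Qed.

(* Korovkin's argument: the kernel has mass 1 and its second moment in cos y tends to 0. *)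
Lemma cvg_heat_heaviside c x : I0 c -> I0 x -> x != c ->
  (fun n => heat_op (harmonic n) (heaviside c) x) @ \oo --> heaviside c x.
Proof.
move=> /=; rewrite !in_itv/= => /andP[c0 cpi] /andP[x0 xpi] xc.
pose d := cos x - cos c.
have d0 : d != 0.
  rewrite subr_eq0; apply/eqP => /cos_inj; rewrite !in_itv/= !ltW// => /(_ isT isT).
  by move/eqP: xc.
have mono y z : 0 < y < pi -> 0 < z < pi -> (cos y < cos z) = (z < y).
  move=> /andP[y1 y2] /andP[z1 z2]; apply: ltr_cos; rewrite in_itv/= !ltW//.
(* If the step takes different values at x and y, then c lies between them, and monotonicity of cos
   gives |cos x - cos y| >= |cos x - cos c| = |d|. *)
have bnd y : I0 y -> `|heaviside c y - heaviside c x| <= d ^- 2 * (cos x - cos y) ^+ 2.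
  rewrite /= in_itv/= => /andP[y0 ypi].
  have le0 : 0 <= d ^- 2 * (cos x - cos y) ^+ 2.
    by rewrite mulr_ge0 ?sqr_ge0// invr_ge0 sqr_ge0.
  have H : (y < c) != (x < c) -> 1 <= d ^- 2 * (cos x - cos y) ^+ 2.
    move=> yx; rewrite mulrC ler_pdivlMr ?exprn_even_gt0// mul1r.
    rewrite /d; case: (ltgtP x c) xc yx => // xc _.
      rewrite eqb_id -leNgt => cy.
      have h1 : cos c < cos x by rewrite mono ?c0 ?x0.
      have h2 : cos y <= cos c by rewrite leNgt mono ?c0 ?y0// -leNgt.
      nra.
    rewrite eqbF_neg negbK => yc.
    have h1 : cos x < cos c by rewrite mono ?c0 ?x0.
    have h2 : cos c < cos y by rewrite mono ?c0 ?y0.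
    nra.
  rewrite /heaviside; case: (boolP (y < c)) H => yc; case: (boolP (x < c)) => xc' /= H.
  - by rewrite subrr normr0.
  - by rewrite subr0 normr1 H.
  - by rewrite sub0r normrN normr1 H.
  - by rewrite subrr normr0.
pose e t := cos x ^+ 2 - 2 * cos x * (gcoef t 1 * cos x) + 2^-1 * (1 + gcoef t 2 * cos (2 * x)).
have He (n : nat) : `|heaviside c x - heat_op (harmonic n) (heaviside c) x| <= d ^- 2 * e (harmonic n).
  have t0 : 0 < harmonic n :> R := harmonic_gt0 n.
  rewrite distrC /e -Rintegral_hk_sqr//.
  have hc := continuous_L1 (continuous_hk (x:=x) t0).
  have hh : L1 (fun y => hk (harmonic n) x y * heaviside c y).
    apply: (@L1M_bounded _ _ _ 1) => //; first exact: measurable_heaviside.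
    by move=> y _; exact: heaviside_le1.
  have -> : heaviside c x = \int[mu]_(y in I0) (heaviside c x * hk (harmonic n) x y).
    by rewrite Rintegral_L1Z// Rintegral_hk// mulr1.
  rewrite /heat_op -Rintegral_L1B//; last exact: L1Z.
  have hsq : L1 (fun y => hk (harmonic n) x y * (cos x - cos y) ^+ 2).
    apply: (@eq_L1 _ (fun y => hk (harmonic n) x y * ((cos x - cos y) * (cos x - cos y)))).
      by move=> y _; rewrite expr2.
    apply: L1_hkM => // y.
    have h : cos x - cos z @[z --> y] --> cos x - cos y.
      by apply: cvgB; [exact: cvg_cst|exact: continuous_cos].
    exact: cvgM.
  apply: le_trans (le_normr_Rintegral_L1 _) _; first by apply: L1B => //; exact: L1Z.
  rewrite -Rintegral_L1Z//; apply: le_Rintegral_L1.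
  - by apply: L1_norm; apply: L1B => //; exact: L1Z.
  - exact: L1Z.
  - move=> y Dy; rewrite [heaviside c x * _]mulrC -mulrBr normrM ger0_norm ?hk_ge0//.
    by rewrite mulrCA ler_wpM2l ?hk_ge0// bnd.
have ce : (fun n => d ^- 2 * e (harmonic n)) @ \oo --> 0.
  have E : d ^- 2 * (cos x ^+ 2 - 2 * cos x * (1 * cos x) + 2^-1 * (1 + 1 * cos (2 * x))) = 0.
    have c2 : cos (2 * x) = 2 * cos x ^+ 2 - 1 by rewrite mulr_natl cos_mulr2n mulr_natl.
    by rewrite c2; field.
  rewrite -[X in _ --> X]E; apply: cvgM; first exact: cvg_cst.
  apply: cvgD; last first.
    apply: cvgM; first exact: cvg_cst.
    apply: cvgD; first exact: cvg_cst.
    by apply: cvgM; [exact: cvg_gcoef|exact: cvg_cst].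
  apply: cvgB; first exact: cvg_cst.
  apply: cvgM; first exact: cvg_cst.
  by apply: cvgM; [exact: cvg_gcoef|exact: cvg_cst].
apply/cvgrPdist_le => /= eps eps0.
move/cvgrPdist_le: ce => /(_ _ eps0); apply: filterS => n.
rewrite sub0r normrN => Hn.
exact: le_trans (He n) (le_trans (ler_norm _) Hn).
Qed.

Lemma L2_heaviside c : L2 (heaviside c).
Proof.
by apply: (@L2_bounded _ _ 1) => [|x _]; [exact: measurable_heaviside|exact: heaviside_le1].
Qed.

Lemma heat_heaviside_le1 t c x : 0 < t -> `|heat_op t (heaviside c) x| <= 1.
Proof.
move=> t0; have hc := continuous_L1 (continuous_hk (x:=x) t0).
rewrite -(Rintegral_hk x t0) /heat_op.
have hh : L1 (fun y => hk t x y * heaviside c y).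
  apply: (@L1M_bounded _ _ _ 1) => //; first exact: measurable_heaviside.
  by move=> y _; exact: heaviside_le1.
apply: le_trans (le_normr_Rintegral_L1 hh) _.
apply: le_Rintegral_L1 => //; first exact: L1_norm.
by move=> y _; rewrite normrM ger0_norm ?hk_ge0// ler_piMr ?hk_ge0// heaviside_le1.
Qed.

Lemma ae_neq (c : R) : {ae mu, forall x, x != c}.
Proof.
exists [set c]; split; [exact: measurable_set1|exact: lebesgue_measure_set1|].
by move=> x /= /negP; rewrite negbK => /eqP.
Qed.

(** At positive time the heat flow of the step is an absolutely summable cosine series, hence
    orthogonal to f. It is bounded by 1 and tends to the step off the point c, so dominated
    convergence transfers the orthogonality to the step. *)
Lemma Rintegral_below_eq0 f c : L2 f -> (forall n, L2dot f (cb n) = 0) -> I0 c ->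
  \int[mu]_(x in I0) (f x * heaviside c x) = 0.
Proof.
move=> hf f0 Ic; have hf1 := L2_L1 hf.
pose P n x := heat_op (harmonic n) (heaviside c) x.
have PE n : P n = cser (fun k => gcoef (harmonic n) k * L2dot (heaviside c) (cb k)).
  by apply/funext => x; apply: heat_opE; [exact: harmonic_gt0|exact: L2_heaviside].
have nP n : nsum (fun k => gcoef (harmonic n) k * L2dot (heaviside c) (cb k)).
  by apply: nsum_coef; [exact: harmonic_gt0|exact: L2_heaviside].
have cP n : continuous (P n) by rewrite PE; exact: continuous_cser.
have P0 n : \int[mu]_(x in I0) (f x * P n x) = 0.
  rewrite PE -(cvg_lim _ (RintegralM_cser hf1 (nP n)))//.
  rewrite (_ : series _ = cst 0); first exact: lim_cst.
  apply/funext => N; rewrite /series/= big1// => k _.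
  by rewrite -/(L2dot f (cb k)) f0 mulr0.
have hfP n : L1 (fun x => f x * P n x).
  apply: (@L1M_bounded _ _ _ 1) => //; first exact: continuous_measurable_in.
  by move=> x _; apply: heat_heaviside_le1; exact: harmonic_gt0.
have hfh : L1 (fun x => f x * heaviside c x).
  apply: (@L1M_bounded _ _ _ 1) => //; first exact: measurable_heaviside.
  by move=> x _; exact: heaviside_le1.
have mP n : measurable_fun I0 (fun x => f x * P n x) := measurable_L1 (hfP n).
have aec : {ae mu, forall x, I0 x -> f x * P n x @[n --> \oo] --> f x * heaviside c x}.
  apply: aeS (ae_neq c) => x xc Dx.
  by apply: cvgM; [exact: cvg_cst|exact: cvg_heat_heaviside].
have [|_] := dominated_cvg_L1 mP (measurable_L1 hfh) aec (L1_norm hf1).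
  move=> n x _; rewrite normrM ler_piMr//.
  by apply: heat_heaviside_le1; exact: harmonic_gt0.
under eq_fun do rewrite P0.
by move=> /(cvg_unique _ (@cvg_cst _ _ _ _ _)) => /(_ (@Rhausdorff R)) <-.
Qed.

(* The primitive of f vanishes, by the orthogonality of f to the heat flow of step functions. *)
Lemma cosine_complete f : L2 f -> (forall n, L2dot f (cb n) = 0) ->
  {ae mu, forall x, I0 x -> f x = 0}.
Proof.
move=> hf f0; have hf1 := L2_L1 hf.
pose F := f \_ I0.
have iF : mu.-integrable setT (EFin \o F).
  by rewrite /F -restrict_EFin; apply/integrable_restrict => //=; rewrite setTI.
have lF : locally_integrable setT F by exact: integrable_locally.
have iFy (y : R) : mu.-integrable [set` Interval (BRight 0) (BRight y)] (EFin \o F).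
  by apply: integrableS iF.
have := FTC1 iFy lF; apply: aeS => x /= + Ix.
move: (Ix); rewrite /= in_itv/= => /andP[x0 xpi].
rewrite lte_fin => /(_ x0)[_].
set G := (X in derive1 X).
have G0 : \forall y \near x, G y = 0.
  near=> y.
  have Iy : I0 y.
    rewrite /= in_itv/=; apply/andP; split.
      by near: y; exact: lt_nbhsr.
    by near: y; exact: lt_nbhsl.
  rewrite -(Rintegral_below_eq0 hf f0 Iy) /G -Rintegral_itv_bndo_bndc; last first.
    by apply: integrableS iF.
  rewrite Rintegral_mkcond [RHS]Rintegral_mkcond; apply: eq_Rintegral => z _.
  rewrite /F !patchE; move: Iy; rewrite /= in_itv/= => /andP[y0 ypi].
  case: (boolP (z \in `]0, y[%classic)) => [/set_mem|] zy.
    move: zy; rewrite /= in_itv/= => /andP[z0 zy].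
    have Iz : z \in I0 by rewrite inE/= in_itv/= z0 (lt_trans zy).
    by rewrite Iz /heaviside zy mulr1.
  case: (boolP (z \in I0)) => // /set_mem; rewrite /= in_itv/= => /andP[z0 zpi].
  rewrite /heaviside; case: ifP; rewrite ?mulr0// => zy'.
  by move/negP: zy; case; rewrite inE/= in_itv/= z0.
rewrite derive1E (@near_eq_derive _ _ _ _ (cst 0) _ _ G0) derive_cst => /esym.
by rewrite /F patchE mem_set.
Unshelve. all: by end_near. Qed.

End Completeness.

(** * Test functions *)
Section Smooth.
Context {R : realType}.
Local Notation mu := (@lebesgue_measure R).
Implicit Types (f g h F : R -> R) (t x y z : R).

(** Existence of n + 1 derivatives. The recursion goes through the derivative of f, whereas
    [derive1n] adds derivatives on the outside; closure under sums, products and affine changes of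
    variable then follows by induction on n. *)
Fixpoint diffn (n : nat) f : Prop :=
  (forall x, derivable f x 1) /\ (if n is n'.+1 then diffn n' (derive1 f) else True).

Definition smooth f : Prop := forall n, diffn n f.

Lemma diffn_derivable n f : diffn n f -> forall x, derivable f x 1.
Proof. by case: n => [|n] []. Qed.

Lemma diffnS n f : diffn n.+1 f -> diffn n f.
Proof.
elim: n f => [|n IH] f [df h]; first exact: (conj df I).
by split; [exact: df|exact: IH].
Qed.

Lemma smoothP f : (forall n x, derivable (derive1n n f) x 1) <-> smooth f.
Proof.
split.
  move=> H n; elim: n f H => [|n IH] f H; first exact: (conj (H 0%N) I).
  split; first exact: (H 0%N).
  by apply: IH => k x; have := H k.+1 x; rewrite /derive1n iterSr.
move=> H n; elim: n f H => [|n IH] f H x; first exact: (diffn_derivable (H 0%N)).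
rewrite /derive1n iterSr; apply: IH => k; by case: (H k.+1).
Qed.

Lemma eq_diffn n f g : f =1 g -> diffn n f -> diffn n g.
Proof. by move=> /funext ->. Qed.

Lemma diffn_is_derive n f g : (forall x : R, is_derive x (1 : R) f (g x)) -> diffn n g -> diffn n.+1 f.
Proof.
move=> H hg; split; first by move=> x; case: (H x).
by apply: eq_diffn hg => x; rewrite derive1E; case: (H x).
Qed.

Lemma smooth_is_derive f g : (forall x : R, is_derive x (1 : R) f (g x)) -> smooth g -> smooth f.
Proof.
by move=> H hg n; apply: diffnS; apply: diffn_is_derive H _; exact: hg.
Qed.

Lemma smooth_derive1 f : smooth f -> smooth (derive1 f).
Proof. by move=> hf n; case: (hf n.+1). Qed.

Lemma smooth_derive f : smooth f -> forall x : R, is_derive x (1 : R) f (derive1 f x).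
Proof.
by move=> hf x; rewrite derive1E; apply: derivableP; exact: (diffn_derivable (hf 0%N)).
Qed.

Lemma derivable_continuous f : (forall x : R, derivable f x 1) -> continuous f.
Proof. by move=> df x; apply: differentiable_continuous; apply/derivable1_diffP. Qed.

Lemma smooth_continuous f : smooth f -> continuous f.
Proof. by move=> hf; apply: derivable_continuous; exact: (diffn_derivable (hf 0%N)). Qed.

Lemma diffn_cst n (c : R) : diffn n (cst c).
Proof.
elim: n c => [|n IH] c.
  by split; [move=> x; exact: derivable_cst|exact: I].
by apply: diffn_is_derive (IH 0) => x; exact: is_derive_cst.
Qed.

Lemma diffnD n f g : diffn n f -> diffn n g -> diffn n (fun x => f x + g x).
Proof.
elim: n f g => [|n IH] f g [df hf] [dg hg].
  by split; [move=> x; exact: derivableD|exact: I].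
apply: (diffn_is_derive (g := fun x => derive1 f x + derive1 g x)); last exact: IH.
by move=> x; rewrite !derive1E; apply: is_deriveD; exact: derivableP.
Qed.

Lemma diffnM n f g : diffn n f -> diffn n g -> diffn n (fun x => f x * g x).
Proof.
elim: n f g => [|n IH] f g hf hg.
  split; last exact: I.
  by move=> x; apply: derivableM; [case: hf|case: hg].
have [df hf'] := hf; have [dg hg'] := hg.
apply: (diffn_is_derive (g := fun x => f x * derive1 g x + g x * derive1 f x)); last first.
  by apply: diffnD; apply: IH => //; exact: diffnS.
by move=> x; rewrite !derive1E; apply: is_deriveM; exact: derivableP.
Qed.

Lemma smooth_cst (c : R) : smooth (cst c).
Proof. by move=> n; exact: diffn_cst. Qed.

Lemma smoothD f g : smooth f -> smooth g -> smooth (fun x => f x + g x).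
Proof. by move=> hf hg n; exact: diffnD. Qed.

Lemma smoothM f g : smooth f -> smooth g -> smooth (fun x => f x * g x).
Proof. by move=> hf hg n; exact: diffnM. Qed.

Lemma smoothZ (k : R) f : smooth f -> smooth (fun x => k * f x).
Proof. by move=> hf; apply: smoothM => //; exact: smooth_cst. Qed.

Lemma smoothB f g : smooth f -> smooth g -> smooth (fun x => f x - g x).
Proof.
move=> hf hg n; have := smoothD hf (smoothZ (-1) hg) n.
by apply: eq_diffn => x; rewrite mulN1r.
Qed.

Lemma is_derive_affine (a b x : R) : is_derive x (1 : R) (fun y => a * y + b) a.
Proof.
have := is_deriveD (is_deriveZ a (is_derive_id x (1 : R))) (is_derive_cst b x 1).
by rewrite scaler1 addr0.
Qed.

Lemma is_derive_comp_affine f (a b d x : R) : is_derive (a * x + b) (1 : R) f d ->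
  is_derive x (1 : R) (fun y => f (a * y + b)) (a * d).
Proof.
move=> H; rewrite mulrC.
exact: (@is_derive1_comp _ f (fun y => a * y + b) x d a H (is_derive_affine a b x)).
Qed.

Lemma smooth_comp_affine f (a b : R) : smooth f -> smooth (fun x => f (a * x + b)).
Proof.
move=> hf n; elim: n f hf => [|n IH] f hf.
  split; last exact: I.
  by move=> x; have [] := is_derive_comp_affine (smooth_derive hf (a * x + b)).
apply: (diffn_is_derive (g := fun x => a * derive1 f (a * x + b))).
  by move=> x; apply: is_derive_comp_affine; exact: smooth_derive.
apply: diffnM; first exact: diffn_cst.
by apply: IH; exact: smooth_derive1.
Qed.

Lemma diffn_trig n (a b k : R) : diffn n (fun x => a * cos (k * x) + b * sin (k * x)).
Proof.
have H (a' b' : R) (x : R) : is_derive x (1 : R) (fun x => a' * cos (k * x) + b' * sin (k * x))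
    ((b' * k) * cos (k * x) + (- (a' * k)) * sin (k * x)).
  have := is_deriveD (is_deriveZ a' (is_derive_cosM k x)) (is_deriveZ b' (is_derive_sinM k x)).
  by rewrite /GRing.scale/= (_ : _ + _ = b' * k * cos (k * x) + - (a' * k) * sin (k * x))//; ring.
elim: n a b => [|n IH] a b.
  by split; [move=> x; case: (H a b x)|exact: I].
exact: diffn_is_derive (H a b) (IH _ _).
Qed.

Lemma smooth_cos (k : R) : smooth (fun x => cos (k * x)).
Proof. by move=> n; apply: eq_diffn (diffn_trig n 1 0 k) => x; rewrite mul1r mul0r addr0. Qed.

Lemma smooth_sin (k : R) : smooth (fun x => sin (k * x)).
Proof. by move=> n; apply: eq_diffn (diffn_trig n 0 1 k) => x; rewrite mul1r mul0r add0r. Qed.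

(** The span of the functions x^(-k) exp (- 1 / x), extended by 0, is stable under derivation, which
    gives smoothness of all of them by one induction. *)
Definition flat (k : nat) (x : R) : R := if 0 < x then x^-1 ^+ k * expR (- x^-1) else 0.

Lemma pow_le_expR (k : nat) (s : R) : 0 <= s -> s ^+ k <= k`!%:R * expR s.
Proof.
move=> s0; case: k => [|k]; first by rewrite expr0 fact0 mul1r -expR0 ler_expR.
have := expR_ge1Dxn k s0.
have f0 : 0 < k.+1`!%:R :> R by rewrite ltr0n fact_gt0.
rewrite -ler_pdivrMl// => H; apply: le_trans H.
by rewrite [leLHS]mulrC lerDr.
Qed.

(** From s^(k+2) <= (k+2)! e^s at s = 1 / x. A quadratic bound makes the difference quotient at 0
    tend to 0. *)
Lemma flat_le (k : nat) (x : R) : `|flat k x| <= k.+2`!%:R * x ^+ 2.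
Proof.
rewrite /flat; case: ifP => x0; last by rewrite normr0 mulr_ge0// sqr_ge0.
rewrite ger0_norm; last by rewrite mulr_ge0 ?expR_ge0// exprn_ge0// invr_ge0 ltW.
have := @pow_le_expR k.+2 x^-1; rewrite invr_ge0 ltW// => /(_ isT) H.
have -> : x^-1 ^+ k * expR (- x^-1) = (x^-1 ^+ k.+2 / expR x^-1) * x ^+ 2.
  rewrite expRN -addn2 exprD (exprVn x 2); field.
  by rewrite gt_eqF ?expR_gt0//= gt_eqF.
by rewrite ler_wpM2r ?sqr_ge0// ler_pdivrMr ?expR_gt0.
Qed.

Lemma is_derive_flat (k : nat) (x : R) :
  is_derive x (1 : R) (flat k) (- k%:R * flat k.+1 x + flat k.+2 x).
Proof.
have [x0|x0|->] := ltgtP x 0.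
- rewrite /flat ltNge (ltW x0)/= mulr0 addr0.
  apply: near_eq_is_derive (is_derive_cst 0 x 1).
  by near=> y; rewrite ifF//; apply/negbTE; rewrite -leNgt ltW//; near: y; exact: lt_nbhsl.
- have dV : is_derive x (1 : R) (fun y => y^-1) (- x^-1 ^+ 2).
    have x0' : x != 0 by rewrite gt_eqF.
    have := @derivableV _ _ id x 1 x0' (@derivable_id _ _ _ _).
    move=> d; apply: (DeriveDef d).
    rewrite (@deriveV _ _ id x 1 x0' (@derivable_id _ _ _ _)).
    by rewrite derive_id /GRing.scale/= mulr1 exprVn.
  have dE : is_derive x (1 : R) (fun y => expR (- y^-1)) (x^-1 ^+ 2 * expR (- x^-1)).
    have := @is_derive1_comp _ expR (fun y => - y^-1) x _ _ (is_derive_expR (- x^-1)) (is_deriveN dV).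
    by rewrite opprK mulrC.
  have dP : is_derive x (1 : R) (fun y => y^-1 ^+ k) (- k%:R * x^-1 ^+ k.+1).
    have := is_deriveX k dV; rewrite exprfctE /GRing.scale/=.
    rewrite (_ : k%:R * x^-1 ^+ k.-1 * - _ = - k%:R * x^-1 ^+ k.+1)//.
    by case: (k) => [|k'] /=; rewrite ?mulr0n !exprS ?expr0; ring.
  have := is_deriveM dP dE; rewrite /GRing.scale/= => dPE.
  rewrite {2 3}/flat x0 (_ : _ + _ = x^-1 ^+ k * (x^-1 ^+ 2 * expR (- x^-1)) +
      expR (- x^-1) * (- k%:R * x^-1 ^+ k.+1)); last first.
    by rewrite /= !exprS; ring.
  apply: near_eq_is_derive dPE; near=> y.
  by rewrite /flat ifT//; near: y; exact: lt_nbhsr.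
- have f0 j : flat j 0 = 0 by rewrite /flat ltxx.
  rewrite !f0 mulr0 addr0.
  have H : h^-1 *: (flat k (h *: 1 + 0) - flat k 0) @[h --> 0^'] --> (0 : R).
    apply/cvgrPdist_le => /= e e0; near=> h.
    have h0 : h != 0 by near: h; exact: nbhs_dnbhs_neq.
    rewrite f0 sub0r normrN /GRing.scale/= mulr1 addr0 subr0 normrM normfV.
    rewrite ler_pdivrMl ?normr_gt0//; apply: le_trans (flat_le k h) _.
    rewrite -real_normK ?num_real// expr2 mulrA mulrC ler_wpM2l//.
    rewrite -ler_pdivlMl ?ltr0n ?fact_gt0//.
    by near: h; apply: dnbhs0_le; rewrite mulr_gt0// invr_gt0 ltr0n fact_gt0.
  have d : derivable (flat k) 0 1 by apply/cvg_ex; exists 0.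
  by apply: (DeriveDef d); apply/cvg_lim => //; exact: Rhausdorff.
Unshelve. all: by end_near. Qed.

Lemma smooth_flat k : smooth (flat k).
Proof.
move=> n; elim: n k => [|n IH] k.
  by split; [move=> x; case: (is_derive_flat k x)|exact: I].
apply: diffn_is_derive (is_derive_flat k) _.
by apply: diffnD (IH _); apply: diffnM (IH _); exact: diffn_cst.
Qed.

End Smooth.

(** * A smooth step function, its primitive and its derivative *)

Section Step.
Context {R : realType}.
Local Notation mu := (@lebesgue_measure R).
Implicit Types (f g h F : R -> R) (t x y z : R).

Lemma is_derive_continuous F f : (forall x : R, is_derive x (1 : R) F (f x)) -> continuous F.
Proof. by move=> dF; apply: derivable_continuous => x; case: (dF x). Qed.

Lemma mean_value F f (a b : R) : (forall x : R, is_derive x (1 : R) F (f x)) -> a <= b ->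
  exists2 c, a <= c <= b & F b - F a = f c * (b - a).
Proof.
move=> dF ab; have cF : {within `[a, b], continuous F}.
  by apply: continuous_subspaceT; exact: is_derive_continuous dF.
have [c cab E] := @MVT_segment R F f a b ab (fun x _ => dF x) cF.
by exists c => //; move: cab; rewrite in_itv.
Qed.

Lemma primitive f (a : R) : continuous f -> (forall x, x <= a -> f x = 0) ->
  exists2 F, (forall x : R, is_derive x (1 : R) F (f x)) & (forall x, x <= a -> F x = 0).
Proof.
(* Starting at a - 1, where f still vanishes, rather than at a leaves the values unchanged and makes
   every x >= a interior, as the fundamental theorem of calculus requires. *)
move=> cf f0; pose F x := \int[mu]_(t in `[a - 1, x]) f t.
have F0 x : x <= a -> F x = 0.
  move=> xa; rewrite /F (@eq_Rintegral _ _ _ _ _ (cst 0)).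
    by rewrite Rintegral_cst// mul0r.
  move=> y; rewrite inE/= in_itv/= => /andP[_ yx]; apply: f0; exact: le_trans xa.
exists F => // x; have [xa|ax] := ltP x a.
  rewrite f0 ?ltW//; apply: near_eq_is_derive (is_derive_cst 0 x 1).
  by near=> y; rewrite F0// ltW//; near: y; exact: lt_nbhsl.
have fi : mu.-integrable `[a - 1, x + 1] (EFin \o f).
  apply: continuous_compact_integrable; first exact: segment_compact.
  exact: continuous_subspaceT.
have x1 : x < x + 1 by rewrite ltrDl.
have a1 : a - 1 < x by lra.
have [d E] := @continuous_FTC1_closed R f (a - 1) x (x + 1) x1 fi a1 (cf x).
by apply: (DeriveDef d); rewrite -derive1E.
Unshelve. all: by end_near. Qed.

(* H is a smooth step function, H2 a primitive of it and r its derivative. *)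
Definition step_spec (H2 H r : R -> R) (c K : R) : Prop :=
  [/\ (forall x : R, is_derive x (1 : R) H2 (H x)) /\ (forall x : R, is_derive x (1 : R) H (r x)),
      smooth r, (forall x, 0 <= H x <= 1) /\ (forall x, 0 <= r x <= K),
      forall x, x <= -1 -> [/\ H2 x = 0, H x = 0 & r x = 0] &
      forall x, 1 <= x -> [/\ H2 x = x + c, H x = 1 & r x = 0]].

(** The derivative r is the bump exp (- 1 / (1 + x)) exp (- 1 / (1 - x)) on (-1, 1), divided by its
    integral [B 1]. *)
Lemma exists_step : exists H2 H r c K, step_spec H2 H r c K.
Proof.
pose b (x : R) := flat 0 (1 * x + 1) * flat 0 (-1 * x + 1).
have sb : smooth b.
  by apply: smoothM; apply: smooth_comp_affine; exact: smooth_flat.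
have flat_ge0 (x : R) : 0 <= flat 0 x.
  by rewrite /flat expr0 mul1r; case: ifP => // _; exact: expR_ge0.
have flat_le1 (x : R) : flat 0 x <= 1.
  rewrite /flat expr0 mul1r; case: ifP => // x0.
  by rewrite -expR0 ler_expR oppr_le0 invr_ge0 ltW.
have flat_gt0 (x : R) : 0 < x -> 0 < flat 0 x.
  by move=> x0; rewrite /flat x0 expr0 mul1r expR_gt0.
have flat_eq0 (x : R) : x <= 0 -> flat 0 x = 0.
  by move=> x0; rewrite /flat ltNge x0.
have b0 x : 0 <= b x by rewrite mulr_ge0.
have b1 x : b x <= 1 by rewrite mulr_ile1.
have bl x : x <= -1 -> b x = 0.
  by move=> xl; rewrite /b flat_eq0 ?mul0r//; lra.
have br x : 1 <= x -> b x = 0.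
  by move=> xl; rewrite /b [flat 0 (-1 * _ + _)]flat_eq0 ?mulr0//; lra.
have [B dB B0] := primitive (smooth_continuous sb) bl.
have mono x y : x <= y -> B x <= B y.
  move=> xy; have [c _] := mean_value dB xy => E.
  by rewrite -subr_ge0 E mulr_ge0// subr_ge0.
have Bp : 0 < B 1.
  have h1 : -(1/2) <= 1/2 :> R by lra.
  have [c /andP[c1 c2] E] := mean_value dB h1.
  have bc : 0 < b c by rewrite mulr_gt0// flat_gt0//; lra.
  have : B (1/2) <= B 1 by apply: mono; lra.
  have : B (-1) <= B (-(1/2)) by apply: mono; lra.
  rewrite (B0 (-1))//; nra.
have B1 x : 1 <= x -> B x = B 1.
  move=> x1; have [c /andP[c1 _]] := mean_value dB x1.
  by rewrite br// mul0r => /eqP; rewrite subr_eq0 => /eqP.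
pose H x := (B 1)^-1 * B x.
pose r x := (B 1)^-1 * b x.
have dH (x : R) : is_derive x (1 : R) H (r x) := is_deriveZ _ (dB x).
have H0 x : x <= -1 -> H x = 0 by move=> xl; rewrite /H (B0 x)// mulr0.
have H1 x : 1 <= x -> H x = 1 by move=> xl; rewrite /H (B1 x)// mulVf// gt_eqF.
have [H2 dH2 H20] := primitive (is_derive_continuous dH) H0.
(* Beyond 1 the function H2 has slope 1, so H2 x = x + (H2 1 - 1); and r <= (B 1)^-1 because the
   bump is at most 1. *)
exists H2, H, r, (H2 1 - 1), (B 1)^-1; split.
- by split.
- exact: smoothZ.
- split=> x.
    have Bx0 : 0 <= B x.
      have [xl|/ltW xl] := leP x (-1); first by rewrite (B0 x).
      by rewrite -(B0 (-1))// mono.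
    have BxB : B x <= B 1.
      have [xl|/ltW xl] := leP x 1; first exact: mono.
      by rewrite (B1 x).
    rewrite /H; apply/andP; split; first by rewrite mulr_ge0// invr_ge0 ltW.
    by rewrite mulrC ler_pdivrMr// mul1r.
  rewrite /r; apply/andP; split; first by rewrite mulr_ge0// invr_ge0 ltW.
  by rewrite ler_piMr// invr_ge0 ltW.
- by move=> x xl; rewrite H20// H0// /r bl// mulr0.
- move=> x xl; rewrite H1// /r br// mulr0; split=> //.
  have [c /andP[c1 _]] := mean_value dH2 xl.
  by rewrite H1// mul1r; lra.
Qed.

End Step.

(** * Test functions, approximate identities and the duality bound *)

Section TestFunctions.
Context {R : realType}.
Local Notation mu := (@lebesgue_measure R).
Local Notation I0 := (`]0, pi[%classic : set R).
Implicit Types (f g h F u v w phi psi : R -> R) (t x y z : R).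

Lemma test_smooth phi : test_function phi -> smooth phi.
Proof. by move=> [/smoothP]. Qed.

Lemma test_functionI phi (a b : R) : smooth phi -> 0 < a -> b < pi ->
  (forall x, x <= a -> phi x = 0) -> (forall x, b <= x -> phi x = 0) -> test_function phi.
Proof.
move=> /smoothP sp a0 bpi pa pb; split=> //; exists a, b; split=> // x.
rewrite in_itv/= negb_and -!ltNge => /orP[xa|xb]; first by rewrite pa// ltW.
by rewrite pb// ltW.
Qed.

Lemma test_functionE phi : test_function phi ->
  exists a b : R, [/\ 0 < a, a < b, b < pi, (forall x, x <= a -> phi x = 0) &
    forall x, b <= x -> phi x = 0].
Proof.
move=> [_ [a [b [a0 bpi H]]]].
have pi0 := @pi_gt0 R.
(* The given a and b may come in the wrong order, when phi is 0. Pushing them outwards, below pi / 4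
   and above pi / 2, puts them in order and makes phi vanish at the new end points too. *)
pose a' := Num.min (a / 2) (pi / 4); pose b' := Num.max ((b + pi) / 2) (pi / 2).
exists a', b'; split.
- by rewrite lt_min; apply/andP; split; lra.
- by rewrite gt_min; apply/orP; right; rewrite lt_max; apply/orP; right; lra.
- by rewrite gt_max; apply/andP; split; lra.
- move=> x; rewrite le_min => /andP[xa _]; apply: H.
  by rewrite in_itv/= negb_and -ltNge; apply/orP; left; lra.
- move=> x; rewrite ge_max => /andP[xb _]; apply: H.
  by rewrite in_itv/= negb_and -!ltNge; apply/orP; right; lra.
Qed.

Lemma test_derive1 phi : test_function phi -> test_function (derive1 phi).
Proof.
move=> tp; have [a [b [a0 ab bpi pa pb]]] := test_functionE tp.
apply: (@test_functionI _ (a / 2) ((b + pi) / 2)); [exact/smooth_derive1/test_smooth|lra|lra| |].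
- move=> x xa; have xa' : x < a by lra.
  rewrite derive1E (@near_eq_derive _ _ _ _ (cst 0)) ?derive_cst//.
  by near=> y; rewrite pa// ltW//; near: y; exact: lt_nbhsl.
- move=> x xb; have xb' : b < x by lra.
  rewrite derive1E (@near_eq_derive _ _ _ _ (cst 0)) ?derive_cst//.
  by near=> y; rewrite pb// ltW//; near: y; exact: lt_nbhsr.
Unshelve. all: by end_near. Qed.

Lemma test_continuous phi : test_function phi -> continuous phi.
Proof. by move=> /test_smooth/smooth_continuous. Qed.

Lemma test_L2 phi : test_function phi -> L2 phi.
Proof. by move=> /test_continuous/continuous_L2. Qed.

Lemma testM phi f : test_function phi -> smooth f -> test_function (fun x => phi x * f x).
Proof.
move=> tp sf; have [a [b [a0 ab bpi pa pb]]] := test_functionE tp.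
apply: (@test_functionI _ a b) => //; first exact: smoothM (test_smooth tp) sf.
- by move=> x xa; rewrite pa ?mul0r.
- by move=> x xa; rewrite pb ?mul0r.
Qed.

Lemma testB phi psi : test_function phi -> test_function psi ->
  test_function (fun x => phi x - psi x).
Proof.
move=> tp tq; have [a [b [a0 ab bpi pa pb]]] := test_functionE tp.
have [a' [b' [a0' ab' bpi' pa' pb']]] := test_functionE tq.
apply: (@test_functionI _ (Num.min a a') (Num.max b b')).
- exact: smoothB (test_smooth tp) (test_smooth tq).
- by rewrite lt_min a0 a0'.
- by rewrite gt_max bpi bpi'.
- by move=> x; rewrite le_min => /andP[x1 x2]; rewrite pa// pa'// subrr.
- by move=> x; rewrite ge_max => /andP[x1 x2]; rewrite pb// pb'// subrr.
Qed.

Lemma testZ (k : R) phi : test_function phi -> test_function (fun x => k * phi x).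
Proof.
move=> tp; have := testM tp (smooth_cst k); congr (test_function _).
by apply/funext => x; rewrite mulrC.
Qed.

Lemma weak_derivative1E u v : weak_derivative 1 u v <->
  forall phi, test_function phi -> L2dot u (derive1 phi) = - L2dot v phi.
Proof.
by split=> H phi tp; have := H _ tp; rewrite expr1 mulN1r.
Qed.

Lemma weak_derivativeS (k : nat) u v w : weak_derivative k u v ->
  weak_derivative k.+1 u w -> weak_derivative 1 v w.
Proof.
move=> hv hw; apply/weak_derivative1E => phi tp.
have := hv _ (test_derive1 tp); rewrite -[derive1n k _]iterSr -/(derive1n k.+1 phi).
rewrite hw// => E; apply: (@mulfI _ ((-1) ^+ k)); first by rewrite signr_eq0.
by rewrite -E exprS mulN1r mulNr mulrN.
Qed.

Section step.
Variables (H2 H r : R -> R) (c K : R).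
Hypothesis sp : step_spec H2 H r c K.

(** The three functions centred at a at scale d, normalised so that each is the derivative of the
    preceding one; [bump_at] then has mass 1. The argument keeps the affine form expected by
    [is_derive_comp_affine]. *)
Definition step2_at (a d y : R) : R := d * H2 (d^-1 * y + - (d^-1 * a)).
Definition step_at (a d y : R) : R := H (d^-1 * y + - (d^-1 * a)).
Definition bump_at (a d y : R) : R := d^-1 * r (d^-1 * y + - (d^-1 * a)).

Let scE (a d y : R) : d^-1 * y + - (d^-1 * a) = (y - a) / d.
Proof. by rewrite -mulrBr mulrC. Qed.

Lemma is_derive_step_at a d y : is_derive y (1 : R) (step_at a d) (bump_at a d y).
Proof.
by case: sp => -[_ dH] _ _ _ _; apply: is_derive_comp_affine; exact: dH.
Qed.

Lemma is_derive_step2_at a d y : d != 0 -> is_derive y (1 : R) (step2_at a d) (step_at a d y).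
Proof.
move=> d0; case: sp => -[dH _] _ _ _ _.
have := is_deriveZ d (is_derive_comp_affine (dH (d^-1 * y + - (d^-1 * a)))).
by rewrite /GRing.scale/= mulrA mulfV// mul1r.
Qed.

Lemma smooth_bump_at a d : smooth (bump_at a d).
Proof. by case: sp => _ sr _ _ _; apply: smoothZ; exact: smooth_comp_affine. Qed.

Lemma smooth_step_at a d : smooth (step_at a d).
Proof. exact: smooth_is_derive (is_derive_step_at a d) (smooth_bump_at a d). Qed.

Lemma smooth_step2_at a d : d != 0 -> smooth (step2_at a d).
Proof.
move=> d0; apply: smooth_is_derive (smooth_step_at a d) => y.
exact: is_derive_step2_at.
Qed.

Lemma step_left a d y : 0 < d -> y <= a - d ->
  [/\ step2_at a d y = 0, step_at a d y = 0 & bump_at a d y = 0].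
Proof.
move=> d0 yad; rewrite /step2_at /step_at /bump_at scE.
have yl : (y - a) / d <= -1 by rewrite ler_pdivrMr// mulN1r; lra.
by case: sp => _ _ _ /(_ _ yl)[-> -> ->] _; rewrite !mulr0.
Qed.

Lemma step_right a d y : 0 < d -> a + d <= y ->
  [/\ step2_at a d y = y - a + c * d, step_at a d y = 1 & bump_at a d y = 0].
Proof.
move=> d0 yad; rewrite /step2_at /step_at /bump_at scE.
have yl : 1 <= (y - a) / d by rewrite ler_pdivlMr// mul1r; lra.
case: sp => _ _ _ _ /(_ _ yl)[-> -> ->]; rewrite !mulr0; split=> //.
by field; rewrite gt_eqF.
Qed.

Lemma step_at_itv a d y : 0 <= step_at a d y <= 1.
Proof. by case: sp => _ _ [h _] _ _; exact: h. Qed.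

Lemma bump_at_itv a d y : 0 < d -> 0 <= bump_at a d y <= d^-1 * K.
Proof.
move=> d0; case: sp => _ _ [_ /(_ (d^-1 * y + - (d^-1 * a)))/andP[h1 h2]] _ _.
rewrite /bump_at; apply/andP; split; first by rewrite mulr_ge0// invr_ge0 ltW.
by rewrite ler_pM2l// invr_gt0.
Qed.

Lemma test_bump_at a d : 0 < d -> 0 < a - d -> a + d < pi -> test_function (bump_at a d).
Proof.
move=> d0 a1 a2; apply: (test_functionI _ a1 a2); first exact: smooth_bump_at.
- by move=> x xa; have [] := step_left d0 xa.
- by move=> x xa; have [] := step_right d0 xa.
Qed.

Lemma test_step_atB a b d : 0 < d -> a <= b -> 0 < a - d -> b + d < pi ->
  test_function (fun y => step_at a d y - step_at b d y).
Proof.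
move=> d0 ab a1 a2; apply: (test_functionI _ a1 a2).
- by apply: smoothB; exact: smooth_step_at.
- move=> x xa; have [_ -> _] := step_left d0 xa.
  have xb : x <= b - d by lra.
  by have [_ -> _] := step_left d0 xb; rewrite subrr.
- move=> x xb; have [_ -> _] := step_right d0 xb.
  have xa : a + d <= x by lra.
  by have [_ -> _] := step_right d0 xa; rewrite subrr.
Qed.

Lemma Rintegral_bump_at a d : 0 < d -> 0 < a - d -> a + d < pi ->
  \int[mu]_(y in I0) bump_at a d y = 1.
Proof.
move=> d0 a1 a2.
rewrite (Rintegral_FTC2 (@pi_ge0 R) (smooth_continuous (@smooth_bump_at a d)) (is_derive_step_at a d)).
have [_ -> _] := step_right d0 (ltW a2); have [_ -> _] := step_left d0 (ltW a1).
by rewrite subr0.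
Qed.

(** Valid for every small d, so that several points can be tested with bumps of one common width. *)
Lemma approx_identity u a (e : R) : L2 u -> I0 a -> {for a, continuous u} -> 0 < e ->
  exists2 d0, 0 < d0 & forall d, 0 < d -> d <= d0 ->
    [/\ 0 < a - d, a + d < pi & `|L2dot u (bump_at a d) - u a| <= e].
Proof.
move=> hu; rewrite /= in_itv/= => /andP[a0 api] cu e0.
move/cvgrPdist_le : cu => /(_ _ e0)/nbhs_ballP[d1 /= d10 Hd].
exists (Num.min (d1 / 2) (Num.min (a / 2) ((pi - a) / 2))).
  by rewrite !lt_min; apply/and3P; split; lra.
move=> d dp; rewrite !le_min => /and3P[dd1 da dpi].
have h1 : 0 < a - d by lra.
have h2 : a + d < pi by lra.
split=> //.
have hb : L2 (bump_at a d) by apply: test_L2; exact: test_bump_at.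
have I1 := Rintegral_bump_at dp h1 h2.
have hb1 := L2_L1 hb; have hub := L2_L1M hu hb.
have -> : L2dot u (bump_at a d) - u a =
    \int[mu]_(y in I0) (u y * bump_at a d y - u a * bump_at a d y).
  rewrite Rintegral_L1B//; last exact: L1Z.
  by rewrite Rintegral_L1Z// I1 mulr1.
apply: le_trans (le_normr_Rintegral_L1 _) _; first by apply: L1B => //; exact: L1Z.
rewrite -[leRHS]mulr1 -I1 -Rintegral_L1Z//; apply: le_Rintegral_L1.
- by apply: L1_norm; apply: L1B => //; exact: L1Z.
- exact: L1Z.
- move=> y _; have /andP[b0 _] := bump_at_itv a y dp.
  rewrite -mulrBl normrM (ger0_norm b0).
  have [yl|yl] := leP y (a - d); first by have [_ _ ->] := step_left dp yl; rewrite !mulr0.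
  have [yr|yr] := leP (a + d) y; first by have [_ _ ->] := step_right dp yr; rewrite !mulr0.
  rewrite ler_wpM2r// distrC; apply: Hd; rewrite /ball/= ltr_distlC; lra.
Qed.

(* Up to a multiple of a fixed bump, psi is the derivative of a test function that
   is bounded by the L^1 norm of psi. *)
Lemma weak_derivative_bound v w : L2 v -> L2 w -> weak_derivative 1 v w ->
  exists2 M, 0 <= M & forall psi, test_function psi ->
    `|L2dot v psi| <= M * \int[mu]_(x in I0) `|psi x|.
Proof.
move=> hv hw /weak_derivative1E wd.
have pi0 := @pi_gt0 R.
pose rho := bump_at (pi / 2) (pi / 4).
have d0 : 0 < pi / 4 :> R by lra.
have h1 : 0 < pi / 2 - pi / 4 :> R by lra.
have h2 : pi / 2 + pi / 4 < pi :> R by lra.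
have trho : test_function rho by exact: test_bump_at.
have Irho : \int[mu]_(x in I0) rho x = 1 by exact: Rintegral_bump_at.
have rho0 x : 0 <= rho x by have /andP[] := bump_at_itv (pi / 2) x d0.
have hw1 := L2_L1 hw.
pose W := \int[mu]_(x in I0) `|w x|.
have W0 : 0 <= W by exact: Rintegral_ge0.
exists (`|L2dot v rho| + 2 * W); first by rewrite addr_ge0// mulr_ge0.
move=> psi tpsi; pose k := \int[mu]_(x in I0) psi x; pose P := \int[mu]_(x in I0) `|psi x|.
have psi1 := continuous_L1 (test_continuous tpsi).
have rho1 := continuous_L1 (test_continuous trho).
have kP : `|k| <= P by exact: le_normr_Rintegral_L1.
(* Removing the mean of psi makes the primitive vanish again near pi, so that it is a test function.
   It is bounded by the L^1 norm of g, at most 2 P, whence the term 2 W of the constant. *)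
pose g x := psi x - k * rho x.
have tg : test_function g by apply: testB => //; exact: testZ.
have cg := test_continuous tg.
have g1 := continuous_L1 cg.
have Ig : \int[mu]_(x in I0) g x = 0.
  by rewrite /g Rintegral_L1B//; [rewrite Rintegral_L1Z// Irho mulr1 subrr|exact: L1Z].
have Ng : \int[mu]_(x in I0) `|g x| <= 2 * P.
  apply: (@le_trans _ _ (\int[mu]_(x in I0) (`|psi x| + `|k| * rho x))).
    apply: le_Rintegral_L1; [exact: L1_norm|apply: L1D; [exact: L1_norm|exact: L1Z]|].
    by move=> x _; apply: le_trans (ler_normB _ _) _; rewrite normrM (ger0_norm (rho0 x)).
  rewrite Rintegral_L1D; [|exact: L1_norm|exact: L1Z].
  by rewrite Rintegral_L1Z// Irho -/P; lra.
have [a [b [a0 ab bpi ga gb]]] := test_functionE tg.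
have [X dX X0] := primitive cg ga.
have XE x : 0 <= x -> X x = \int[mu]_(y in `]0, x[) g y.
  by move=> x0; rewrite (Rintegral_FTC2 x0 cg dX) (X0 0) ?subr0// ltW.
have Xpi : X pi = 0 by rewrite XE ?ltW.
have Xb x : b <= x -> X x = 0.
  move=> bx; have H' y z : b <= y -> y <= z -> X y = X z.
    move=> yb yz; have [q /andP[q1 _]] := mean_value dX yz.
    rewrite gb ?mul0r; last exact: le_trans q1.
    by move/eqP; rewrite subr_eq0 => /eqP.
  have [xpi|/ltW pix] := leP x pi; first by rewrite (H' x pi).
  by rewrite -(H' pi x)// ltW.
have tX : test_function X.
  apply: (test_functionI _ a0 bpi X0 Xb).
  exact: smooth_is_derive dX (test_smooth tg).
have X'E : derive1 X = g.
  by apply/funext => x; rewrite derive1E; case: (dX x).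
have XN x : I0 x -> `|X x| <= 2 * P.
  rewrite /= in_itv/= => /andP[x0 xpi]; rewrite XE; last exact: ltW.
  have sub : `]0, x[%classic `<=` I0 by apply: subset_itvl; rewrite bnd_simp ltW.
  have ix : mu.-integrable `]0, x[ (EFin \o g) by apply: integrableS g1.
  have Hn : `|\int[mu]_(y in `]0, x[) g y| <= \int[mu]_(y in `]0, x[) `|g y|.
    exact: le_normr_Rintegral.
  apply: (le_trans Hn); apply: (le_trans _ Ng).
  rewrite Rintegral_mkcond [leRHS]Rintegral_mkcond; apply: le_Rintegral => //.
  - rewrite -restrict_EFin; apply/integrable_restrict => //=; rewrite setTI.
    exact: integrable_norm.
  - rewrite -restrict_EFin; apply/integrable_restrict => //=; rewrite setTI.
    exact: integrable_norm.
  - move=> y _; rewrite !patchE; case: ifPn => [/set_mem/sub/mem_set ->//|_].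
    by case: ifP => _; [exact: normr_ge0|exact: lexx].
have E : L2dot v psi = k * L2dot v rho - L2dot w X.
  have := wd _ tX; rewrite X'E /g => Ev.
  have hrho := test_L2 trho; have hpsi := test_L2 tpsi.
  have hkr : L2 (fun x => k * rho x) := L2Z k hrho.
  move: Ev; rewrite L2dotC L2dotBl// L2dotZl// (L2dotC psi) (L2dotC rho) => Ev.
  by rewrite -(subrK (k * L2dot v rho) (L2dot v psi)) Ev addrC.
have hX := test_L2 tX.
rewrite E; apply: le_trans (ler_normB _ _) _; rewrite normrM mulrDl mulrC; apply: lerD.
  by rewrite ler_wpM2l.
rewrite -/P; apply: le_trans (le_normr_Rintegral_L1 (L2_L1M hw hX)) _.
rewrite -mulrA [W * _]mulrC mulrA -Rintegral_L1Z; last exact: L1_norm.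
apply: le_Rintegral_L1; [exact/L1_norm/L2_L1M|by apply: L1Z; exact: L1_norm|].
by move=> x Ix; rewrite normrM mulrC ler_wpM2r// XN.
Qed.

End step.
End TestFunctions.

(** * Regularity of functions in H^3 *)
Section Regularity.
Context {R : realType}.
Local Notation mu := (@lebesgue_measure R).
Local Notation I0 := (`]0, pi[%classic : set R).
Implicit Types (f g h F u v w phi psi : R -> R) (t x y z : R).

Lemma Rintegral_norm_le f (k p q : R) : L1 f -> p <= q -> 0 <= k ->
  (forall y, `|f y| <= k) -> (forall y, y <= p -> f y = 0) ->
  (forall y, q <= y -> f y = 0) ->
  \int[mu]_(y in I0) `|f y| <= k * (q - p).
Proof.
move=> hf pq k0 fk fp fq.
have -> : k * (q - p) = \int[mu]_(y in `]p, q[) k.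
  have E : mu `]p, q[%classic = (q - p)%:E.
    rewrite lebesgue_measure_itv/= lte_fin EFinB; case: ltP => // qp.
    by rewrite (_ : q = p) ?subee//; lra.
  by rewrite Rintegral_cst// [X in fine X]E.
rewrite Rintegral_mkcond [leRHS]Rintegral_mkcond; apply: le_Rintegral => //.
- rewrite -restrict_EFin; apply/integrable_restrict => //=; rewrite setTI.
  exact: L1_norm.
- rewrite -restrict_EFin; apply/integrable_restrict => //=; rewrite setTI.
  apply: measurable_bounded_integrable => //; last first.
    by exists k; split; [exact: num_real|move=> t kt y _ /=; rewrite ger0_norm// ltW].
  by rewrite [X in (X < _)%E]lebesgue_measure_itv/=; case: ifP => // _; rewrite ltry.
- move=> y _; rewrite !patchE; case: (boolP (y \in `]p, q[%classic)) => ypq.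
    by case: ifP.
  suff -> : f y = 0 by rewrite normr0; case: ifP.
  move: ypq; rewrite notin_setE/= in_itv/= => /negP; rewrite negb_and -!leNgt.
  by move=> /orP[]; [exact: fp|exact: fq].
Qed.

Lemma L2dotZr (k : R) f h : L2 f -> L2 h -> L2dot h (fun x => k * f x) = k * L2dot h f.
Proof. by move=> hf hh; rewrite L2dotC L2dotZl// L2dotC. Qed.

Lemma L2dotBr f g h : L2 f -> L2 g -> L2 h ->
  L2dot h (fun x => f x - g x) = L2dot h f - L2dot h g.
Proof. by move=> hf hg hh; rewrite L2dotC L2dotBl// !(L2dotC h). Qed.

Lemma L2dotDr f g h : L2 f -> L2 g -> L2 h ->
  L2dot h (fun x => f x + g x) = L2dot h f + L2dot h g.
Proof. by move=> hf hg hh; rewrite L2dotC L2dotDl// !(L2dotC h). Qed.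

(* Tests u' on a smoothed indicator of [a, b]. *)
Lemma sobolev_lipschitz u v1 v2 : L2 u -> L2 v1 -> L2 v2 ->
  weak_derivative 1 u v1 -> weak_derivative 2 u v2 -> {in `]0, pi[, continuous u} ->
  exists2 L, 0 <= L &
  forall a b, I0 a -> I0 b -> `|u a - u b| <= L * `|a - b|.
Proof.
move=> hu hv1 hv2 wd1 wd2 uC.
have uCat a : I0 a -> {for a, continuous u} by move=> Ia; exact: uC.
have [H2 [H [r [c [K sp]]]]] := @exists_step R.
have [M M0 HM] := weak_derivative_bound sp hv1 hv2 (weak_derivativeS wd1 wd2).
exists M => // a b; wlog ab : a b / a <= b.
  move=> Hw Ia Ib; have [/Hw|/ltW/Hw] := leP a b; first exact.
  by rewrite distrC [`|a - b|]distrC; exact.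
move=> Ia Ib; rewrite (ler0_norm (_ : a - b <= 0)) ?subr_le0// opprB.
have M2 : 0 < 2 * M + 2 by lra.
(* The smoothed indicator has L^1 norm at most b - a + 2 d, which costs 2 M e beyond the expected
   bound, and each of the two point values costs e. *)
apply/ler_addgt0Pr => e' e'0; pose e := e' / (2 * M + 2).
have e0 : 0 < e by rewrite divr_gt0.
have [da da0 Hda] := approx_identity sp hu Ia (uCat _ Ia) e0.
have [db db0 Hdb] := approx_identity sp hu Ib (uCat _ Ib) e0.
pose d := Num.min e (Num.min da db).
have d0 : 0 < d by rewrite !lt_min; apply/and3P; split.
have [de dda ddb] : [/\ d <= e, d <= da & d <= db].
  by rewrite /d; split; rewrite !ge_min lexx ?orbT.
have [a1 a2 Ha] := Hda _ d0 dda; have [b1 b2 Hb] := Hdb _ d0 ddb.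
have tphi := test_step_atB sp d0 ab a1 b2.
set phi := (fun y => _) in tphi.
have phi' : derive1 phi = (fun y => bump_at r a d y - bump_at r b d y).
  apply/funext => y; rewrite derive1E.
  by have [_ ->] := is_deriveB (is_derive_step_at sp a d y) (is_derive_step_at sp b d y).
have ta := test_bump_at sp d0 a1 a2; have tb := test_bump_at sp d0 b1 b2.
have := (weak_derivative1E _ _).1 wd1 _ tphi.
rewrite phi' L2dotBr//; [|exact: test_L2..] => E.
have Nphi : \int[mu]_(y in I0) `|phi y| <= 1 * ((b + d) - (a - d)).
  apply: Rintegral_norm_le => //; [exact/L2_L1/test_L2|lra| | |].
  - move=> y; rewrite /phi.
    have /andP[s1 s2] := step_at_itv sp a d y; have /andP[s3 s4] := step_at_itv sp b d y.
    by rewrite ler_norml; move: s1 s2 s3 s4; clear; move=> *; apply/andP; split; lra.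
  - move=> y ya; have [_ Ea _] := step_left sp d0 ya; have yb : y <= b - d by lra.
    by have [_ Eb _] := step_left sp d0 yb; rewrite /phi Ea Eb subrr.
  - move=> y yb; have [_ Eb _] := step_right sp d0 yb; have ya : a + d <= y by lra.
    by have [_ Ea _] := step_right sp d0 ya; rewrite /phi Ea Eb subrr.
have := HM _ tphi; rewrite -normrN -E => Hv.
have {Nphi Hv} Hv := le_trans Hv (ler_wpM2l M0 Nphi).
have -> : u a - u b = (L2dot u (bump_at r a d) - L2dot u (bump_at r b d)) -
  (L2dot u (bump_at r a d) - u a) + (L2dot u (bump_at r b d) - u b) by ring.
have N3 (p q s : R) : `|p - q + s| <= `|p| + `|q| + `|s|.
  by apply: le_trans (ler_normD _ _) _; rewrite lerD2r ler_normB.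
apply: le_trans (N3 _ _ _) _.
have e'E : e' = (2 * M + 2) * e by rewrite /e mulrC divfK// gt_eqF.
have Md : M * d <= M * e by rewrite ler_wpM2l.
rewrite e'E; move: Hv Ha Hb Md; clear; lra.
Qed.

(* Tests u'' on a smoothed tent function on [x - z, x + z], whose second derivative
   is a second difference of bumps and whose integral is O(z^2). *)
Lemma sobolev_second_diff u v2 v3 : L2 u -> L2 v2 -> L2 v3 ->
  weak_derivative 2 u v2 -> weak_derivative 3 u v3 -> {in `]0, pi[, continuous u} ->
  exists2 C, 0 <= C &
  forall x z, 0 < z -> I0 (x - z) -> I0 (x + z) ->
    `|2 * u x - u (x + z) - u (x - z)| <= C * z ^+ 2.
Proof.
move=> hu hv2 hv3 wd2 wd3 uC.
have uCat a : I0 a -> {for a, continuous u} by move=> Ia; exact: uC.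
have [H2 [H [r [c [K sp]]]]] := @exists_step R.
have [M M0 HM] := weak_derivative_bound sp hv2 hv3 (weak_derivativeS wd2 wd3).
(* The smoothed tent has slope at most 2 and support of length 2 (z + d), so its height is at most 4
   (z + d) and its integral at most 8 (z + d)^2. Below, d <= 1 and d <= e turn (z + d)^2 into z^2 +
   (2 z + 1) e, and the three point values cost e + 2 e + e. *)
exists (8 * M) => [|x z z0 Ia Ib]; first by rewrite mulr_ge0.
have Ix : I0 x.
  by move: Ia Ib; rewrite /= !in_itv/= => /andP[? ?] /andP[? ?]; apply/andP; split; lra.
have N4 : 0 < 8 * M * (2 * z + 1) + 4.
  by rewrite ltr_wpDl// mulr_ge0 ?mulr_ge0//; lra.
apply/ler_addgt0Pr => e' e'0; pose e := e' / (8 * M * (2 * z + 1) + 4).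
have e0 : 0 < e by rewrite divr_gt0.
have [da da0 Hda] := approx_identity sp hu Ia (uCat _ Ia) e0.
have [db db0 Hdb] := approx_identity sp hu Ib (uCat _ Ib) e0.
have [dx dx0 Hdx] := approx_identity sp hu Ix (uCat _ Ix) e0.
pose d := Num.min (Num.min 1 e) (Num.min dx (Num.min da db)).
have d0 : 0 < d by rewrite !lt_min; apply/and3P; split=> //; apply/andP; split.
have [[d1 de] ddx [dda ddb]] : [/\ d <= 1 /\ d <= e, d <= dx & d <= da /\ d <= db].
  by rewrite /d; split; rewrite ?ge_min ?lexx ?orbT//; split; rewrite !ge_min lexx ?orbT.
have [a1 a2 Ha] := Hda _ d0 dda; have [b1 b2 Hb] := Hdb _ d0 ddb.
have [x1 x2 Hx] := Hdx _ d0 ddx.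
have dN0 : d != 0 by rewrite gt_eqF.
pose psi y := step2_at H2 (x + z) d y - 2 * step2_at H2 x d y + step2_at H2 (x - z) d y.
pose psi1 y := step_at H (x + z) d y - 2 * step_at H x d y + step_at H (x - z) d y.
pose psi2 y := bump_at r (x + z) d y - 2 * bump_at r x d y + bump_at r (x - z) d y.
have dpsi y : is_derive y (1 : R) psi (psi1 y).
  apply: is_deriveD; last exact: (is_derive_step2_at sp).
  apply: is_deriveB; first exact: (is_derive_step2_at sp).
  by apply: is_deriveZ; exact: (is_derive_step2_at sp).
have dpsi1 y : is_derive y (1 : R) psi1 (psi2 y).
  apply: is_deriveD; last exact: (is_derive_step_at sp).
  apply: is_deriveB; first exact: (is_derive_step_at sp).
  by apply: is_deriveZ; exact: (is_derive_step_at sp).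
have psil y : y <= x - z - d -> psi y = 0.
  move=> ya; have yx : y <= x - d by move: ya z0; clear; lra.
  have yb : y <= x + z - d by move: ya z0; clear; lra.
  have [E1 _ _] := step_left sp d0 ya; have [E2 _ _] := step_left sp d0 yx.
  by have [E3 _ _] := step_left sp d0 yb; rewrite /psi E1 E2 E3; ring.
have psir y : x + z + d <= y -> psi y = 0.
  move=> yb; have yx : x + d <= y by move: yb z0; clear; lra.
  have ya : x - z + d <= y by move: yb z0; clear; lra.
  have [E1 _ _] := step_right sp d0 ya; have [E2 _ _] := step_right sp d0 yx.
  by have [E3 _ _] := step_right sp d0 yb; rewrite /psi E1 E2 E3; ring.
have spsi : smooth psi.
  apply: smoothD; last exact: (smooth_step2_at sp).
  by apply: smoothB; [|apply: smoothZ]; exact: (smooth_step2_at sp).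
have tpsi : test_function psi := test_functionI spsi a1 b2 psil psir.
have psi'' : derive1n 2 psi = psi2.
  have E1 : derive1 psi = psi1 by apply/funext => y; rewrite derive1E; case: (dpsi y).
  rewrite /derive1n/= E1.
  by apply/funext => y; rewrite derive1E; case: (dpsi1 y).
have ta := test_L2 (test_bump_at sp d0 a1 a2); have tb := test_L2 (test_bump_at sp d0 b1 b2).
have tx := test_L2 (test_bump_at sp d0 x1 x2).
have := wd2 _ tpsi.
have t2x : L2 (fun y => 2 * bump_at r x d y) := L2Z 2 tx.
have tbx : L2 (fun y => bump_at r (x + z) d y - 2 * bump_at r x d y) := L2B tb t2x.
rewrite psi'' sqrrN expr1n mul1r L2dotDr// L2dotBr// L2dotZr// => E.
have p1 y : `|psi1 y| <= 2.
  have /andP[s1 s2] := step_at_itv sp (x + z) d y; have /andP[s3 s4] := step_at_itv sp (x - z) d y.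
  have /andP[s5 s6] := step_at_itv sp x d y.
  by rewrite /psi1 ler_norml; move: s1 s2 s3 s4 s5 s6; clear; move=> *; apply/andP; split; lra.
have p0 y : `|psi y| <= 4 * (z + d).
  have [ya|/ltW ya] := leP y (x - z - d); first by rewrite psil// normr0; move: z0 d0; clear; lra.
  have [yb|yb] := leP (x + z + d) y; first by rewrite psir// normr0; move: z0 d0; clear; lra.
  have [q _] := mean_value dpsi ya; rewrite (psil (x - z - d))// subr0 => ->.
  rewrite normrM (_ : 4 * (z + d) = 2 * (2 * (z + d))); last by ring.
  apply: ler_pM => //; rewrite ger0_norm ?subr_ge0//; move: yb; clear; lra.
have Npsi : \int[mu]_(y in I0) `|psi y| <= 4 * (z + d) * ((x + z + d) - (x - z - d)).
  by apply: Rintegral_norm_le => //; [exact/L2_L1/test_L2|move: z0 d0; clear; lra..].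
have := HM _ tpsi; rewrite -E => Hv.
have {Npsi Hv} Hv := le_trans Hv (ler_wpM2l M0 Npsi).
move: E Hv Ha Hb Hx.
set A := L2dot u (bump_at r (x + z) d); set B := L2dot u (bump_at r x d).
set D := L2dot u (bump_at r (x - z) d) => E Hv Ha Hb Hx.
have -> : 2 * u x - u (x + z) - u (x - z) =
   - (A - 2 * B + D) + (A - u (x + z)) - 2 * (B - u x) + (D - u (x - z)) by ring.
have N5 (p q s l : R) : `|- p + q - 2 * s + l| <= `|p| + `|q| + 2 * `|s| + `|l|.
  apply: le_trans (ler_normD _ _) _; rewrite lerD2r.
  apply: le_trans (ler_normB _ _) _; rewrite normrM ger0_norm// lerD2r.
  by apply: le_trans (ler_normD _ _) _; rewrite normrN.
apply: le_trans (N5 _ _ _ _) _.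
have e'E : e' = (8 * M * (2 * z + 1) + 4) * e by rewrite /e mulrC divfK// gt_eqF.
have dd : (z + d) ^+ 2 <= z ^+ 2 + (2 * z + 1) * e by nra.
have Md : M * (z + d) ^+ 2 <= M * (z ^+ 2 + (2 * z + 1) * e) by rewrite ler_wpM2l.
have {}Hv : `|A - 2 * B + D| <= 8 * (M * (z ^+ 2 + (2 * z + 1) * e)).
  apply: le_trans Hv _; apply: (@le_trans _ _ (8 * (M * (z + d) ^+ 2))); last by lra.
  by rewrite le_eqVlt; apply/orP; left; apply/eqP; ring.
by rewrite e'E; move: Hv Ha Hb Hx; clear; lra.
Qed.

End Regularity.

(** * Spectral calculus *)
Section Eigenbasis.
Context {R : realType}.
Local Notation mu := (@lebesgue_measure R).
Local Notation I0 := (`]0, pi[%classic : set R).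
Implicit Types (f g h F u v w phi psi e : R -> R) (t x y z : R).

Definition sb (n : nat) x : R := - (nb n * n%:R) * sin (n%:R * x).

Lemma is_derive_cb n x : is_derive x (1 : R) (cb n) (sb n x).
Proof.
have := is_deriveZ (nb n : R) (is_derive_cosM n%:R x).
by rewrite /GRing.scale/= mulrN mulrA -mulNr.
Qed.

Lemma is_derive_sb n x : is_derive x (1 : R) (sb n) (- n%:R ^+ 2 * cb n x).
Proof.
have d := is_deriveZ (- (nb n * n%:R) : R) (is_derive_sinM n%:R x).
by apply: (is_derive_eq d); rewrite /GRing.scale/= /cb; ring.
Qed.

Lemma smooth_cb n : smooth (@cb R n).
Proof. by apply: smoothZ; exact: smooth_cos. Qed.

Lemma smooth_sb n : smooth (sb n).
Proof. by apply: smoothZ; exact: smooth_sin. Qed.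

Lemma derive1_cb n : derive1 (cb n) = sb n.
Proof. by apply/funext => x; rewrite derive1E; case: (is_derive_cb n x). Qed.

Lemma derive1_sb n : derive1 (sb n) = (fun x => - n%:R ^+ 2 * cb n x).
Proof. by apply/funext => x; rewrite derive1E; case: (is_derive_sb n x). Qed.

Lemma derive1M f g : smooth f -> smooth g ->
  derive1 (fun x => f x * g x) = (fun x => f x * derive1 g x + g x * derive1 f x).
Proof.
move=> sf sg; apply/funext => x; rewrite derive1E.
by have [_ ->] := is_deriveM (smooth_derive sf x) (smooth_derive sg x).
Qed.

Lemma test_ends phi : test_function phi -> phi 0 = 0 /\ phi pi = 0.
Proof.
move=> tp; have [a [b [a0 ab bpi pa pb]]] := test_functionE tp.
by rewrite pa ?pb// ltW.
Qed.

Lemma weak_derivative_smooth f : smooth f -> weak_derivative 1 f (derive1 f).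
Proof.
move=> sf; apply/weak_derivative1E => phi tp.
have sp := test_smooth tp; have [p0 ppi] := test_ends tp.
have s1 := smoothM sf (smooth_derive1 sp); have s2 := smoothM sp (smooth_derive1 sf).
have c5 := smooth_continuous (smoothD s1 s2).
have d (x : R) : is_derive x (1 : R) (fun x => f x * phi x) (f x * derive1 phi x + phi x * derive1 f x).
  exact: is_deriveM (smooth_derive sf x) (smooth_derive sp x).
have := Rintegral_FTC2 (@pi_ge0 R) c5 d; rewrite p0 ppi !mulr0 subrr.
have l1 := continuous_L1 (smooth_continuous s1).
have l2 := continuous_L1 (smooth_continuous s2).
rewrite Rintegral_L1D// => /eqP; rewrite addr_eq0 /L2dot => /eqP ->.
by congr (- _); apply: eq_Rintegral => x _; rewrite mulrC.
Qed.

Lemma weak_derivative_comp (k : nat) u v w : weak_derivative k u v ->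
  weak_derivative 1 v w -> weak_derivative k.+1 u w.
Proof.
move=> hv /weak_derivative1E hw phi tp; rewrite /derive1n iterSr -/(derive1n k _).
by rewrite hv; [rewrite hw// exprS mulN1r mulNr mulrN|exact: test_derive1].
Qed.

Lemma weak_derivative1_cb n : weak_derivative 1 (cb n) (sb n).
Proof. by rewrite -derive1_cb; apply: weak_derivative_smooth; exact: smooth_cb. Qed.

Lemma weak_derivative2_cb n : weak_derivative 2 (cb n) (fun x => - n%:R ^+ 2 * cb n x).
Proof.
apply: weak_derivative_comp (weak_derivative1_cb n) _.
by rewrite -derive1_sb; apply: weak_derivative_smooth; exact: smooth_sb.
Qed.

Lemma neumann_laplacian_cb n : neumann_laplacian (cb n) (fun x => n%:R ^+ 2 * cb n x).
Proof.
have l2 : L2 (fun x => - n%:R ^+ 2 * cb n x) by apply: L2Z; exact: L2_cb.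
have l1 : L2 (sb n) by apply: continuous_L2; apply: smooth_continuous; exact: smooth_sb.
split.
- split; first exact: L2_cb.
  move=> [|[|[|j]]]//= _.
    by exists (sb n) => //; exact: weak_derivative1_cb.
  by exists (fun x => - n%:R ^+ 2 * cb n x) => //; exact: weak_derivative2_cb.
- by apply: L2Z; exact: L2_cb.
- have := weak_derivative2_cb n; congr (weak_derivative _ _ _).
  by apply/funext => x; rewrite mulNr.
- exists (sb n); split.
  + exact: weak_derivative1_cb.
  + by apply: continuous_subspaceT; apply: smooth_continuous; exact: smooth_sb.
  + by rewrite /sb mulr0 sin0 mulr0.
  + by rewrite /sb sin_natpi mulr0.
Qed.

Lemma neumann_eigenbasis_cb : neumann_eigenbasis (@cb R) (fun n => n%:R ^+ 2).
Proof.
split; [exact: neumann_laplacian_cb|exact: L2dot_cb|].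
exact: cosine_complete.
Qed.

Lemma dominated_L1M g (k_ : nat -> R -> R) (k : R -> R) (B : R) : L1 g ->
  (forall n, measurable_fun I0 (k_ n)) -> measurable_fun I0 k ->
  (forall n x, I0 x -> `|k_ n x| <= B) ->
  (forall x, I0 x -> k_ ^~ x @ \oo --> k x) ->
  (fun n => \int[mu]_(x in I0) (g x * k_ n x)) @ \oo --> \int[mu]_(x in I0) (g x * k x).
Proof.
move=> hg mk_ mk kB kk; have mg := measurable_L1 hg.
apply: (@dominated_cvg_L1 _ (fun n x => g x * k_ n x) (fun x => g x * k x) (fun x => B * `|g x|) _ _ _ _ _).2.
- by move=> n; exact: measurable_funM.
- exact: measurable_funM.
- by apply: aeS (ae_neq 0) => x _ Ix; apply: cvgM; [exact: cvg_cst|exact: kk].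
- by apply: L1Z; exact: L1_norm.
- by move=> n x Ix; rewrite normrM mulrC ler_wpM2r// kB.
Qed.

Lemma sin_le (y : R) : 0 <= y -> `|sin y| <= y.
Proof.
move=> y0; have [c _] := mean_value (@is_derive_sin R) y0.
by rewrite sin0 !subr0 => ->; rewrite normrM (ger0_norm y0) ler_piMl// cos_max.
Qed.

(** The derivative of [cb n] vanishes linearly at both ends, which will compensate for the height 1
    / d of the derivative of a cut-off. *)
Lemma sb_le n x : I0 x -> `|sb n x| <= n%:R ^+ 2 * x /\ `|sb n x| <= n%:R ^+ 2 * (pi - x).
Proof.
rewrite /= in_itv/= => /andP[x0 xpi].
have H y : 0 <= y -> `|sin (n%:R * y)| <= n%:R * y.
  by move=> y0; apply: sin_le; rewrite mulr_ge0.
have E y : `|sin (n%:R * y)| <= n%:R * y -> nb n * n%:R * `|sin (n%:R * y)| <= n%:R ^+ 2 * y.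
  move=> Hy; rewrite -mulrA -[leRHS]mul1r; apply: ler_pM; rewrite ?nb_ge0 ?nb_le1 ?mulr_ge0//.
  by rewrite expr2 -mulrA ler_wpM2l.
rewrite /sb normrM normrN (ger0_norm (_ : 0 <= nb n * n%:R)) ?mulr_ge0 ?nb_ge0//.
split; first by apply: E; apply: H; exact: ltW.
have := E _ (H (pi - x) _); rewrite subr_ge0 ltW// => /(_ isT).
suff -> : `|sin (n%:R * (pi - x))| = `|sin (n%:R * x)| by [].
rewrite mulrBr sinB sin_natpi mul0r sub0r normrN normrM.
suff -> : `|cos (n%:R * pi)| = 1 :> R by rewrite mul1r.
by apply/eqP; rewrite norm_cos_eq1 sin_natpi.
Qed.

(** Green's formula against [cb m]. As [cb m] is not a test function, it is multiplied by cut-offs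
    [chi n] that tend to 1. The two boundary terms die for different reasons: one because the
    derivative of [cb m] vanishes at the ends, the other because du does. *)
Lemma neumann_laplacian_sym e f m : neumann_laplacian e f ->
  L2dot f (cb m) = m%:R ^+ 2 * L2dot e (cb m).
Proof.
move=> [[he _] hf wd2 [du [/weak_derivative1E wd1 cdu du0 dupi]]].
have pi0 := @pi_gt0 R.
have mdu : measurable_fun I0 du.
  apply: (@measurable_funS _ _ _ _ `[0, pi]%classic) => //.
    by apply: subset_itv; rewrite bnd_simp.
  exact: subspace_continuous_measurable_fun.
have hdu : L2 du.
  have cN : {within `[0, pi], continuous (fun x => `|du x|)}.
    by move=> x; apply: continuous_comp; [exact: cdu|exact: norm_continuous].
  have [p _ Hp] := EVT_max (@pi_ge0 R) cN.
  apply: (@L2_bounded _ _ `|du p|) => // x; rewrite /= in_itv/= => /andP[x0 xpi].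
  by apply: Hp; rewrite in_itv/= !ltW.
have [H2 [H [r [c [K sp]]]]] := @exists_step R.
(* The cut-off rises on [d, 3 d] and falls on [pi - 3 d, pi - d]; d <= pi / 8 keeps these two
   intervals disjoint. *)
pose d (n : nat) : R := pi / 8 * harmonic n.
have d0 n : 0 < d n by rewrite mulr_gt0 ?harmonic_gt0// divr_gt0.
have d8 n : d n <= pi / 8.
  rewrite /d ler_piMr//; first by rewrite divr_ge0// ltW.
  by rewrite /harmonic/= invf_le1 ?ler1n ?ltr0n.
have dcvg : d @ \oo --> 0.
  rewrite -[X in _ --> X](mulr0 (pi / 8)); apply: cvgM; first exact: cvg_cst.
  exact: cvg_harmonic.
have dsmall (s : R) : 0 < s -> \forall n \near \oo, d n < s.
  move=> s0; move/cvgrPdist_lt : dcvg => /(_ _ s0); apply: filterS => n.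
  by rewrite sub0r normrN gtr0_norm.
pose q n : R := pi - 2 * d n.
pose chi n x := step_at H (2 * d n) (d n) x - step_at H (q n) (d n) x.
pose chi' n x := bump_at r (2 * d n) (d n) x - bump_at r (q n) (d n) x.
have a1 n : 0 < 2 * d n - d n by move: (d0 n); clear; lra.
have a2 n : 2 * d n + d n < pi by move: (d0 n) (d8 n) pi0; clear; lra.
have q1 n : 0 < q n - d n by rewrite /q; move: (d0 n) (d8 n) pi0; clear; lra.
have q2 n : q n + d n < pi by rewrite /q; move: (d0 n); clear; lra.
have aq n : 2 * d n <= q n by rewrite /q; move: (d0 n) (d8 n) pi0; clear; lra.
have tchi n : test_function (chi n) by exact: (test_step_atB sp).
have chi'E n : derive1 (chi n) = chi' n.
  apply/funext => y; rewrite derive1E.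
  by have [_ ->] := is_deriveB (is_derive_step_at sp (2 * d n) (d n) y) (is_derive_step_at sp (q n) (d n) y).
have tb1 n := test_bump_at sp (d0 n) (a1 n) (a2 n).
have tb2 n := test_bump_at sp (d0 n) (q1 n) (q2 n).
have tchi' n : test_function (chi' n) by exact: testB.
have sc := @smooth_cb m; have ss := @smooth_sb m.
have tcc n := testM (tchi n) sc.
have tcs n := testM (tchi n) ss.
(* For phi = chi cb the weak equations give <f, phi> = <du, phi'>. Only the part chi sb of phi' is
   integrated by parts again; the part cb chi' is left paired with du, which is small near the
   ends. *)
have E1 n : L2dot f (fun x => chi n x * cb m x) =
    L2dot du (fun x => cb m x * chi' n x) - L2dot e (fun x => chi' n x * sb m x)
    + m%:R ^+ 2 * L2dot e (fun x => chi n x * cb m x).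
  have := wd2 _ (tcc n); rewrite sqrrN expr1n mul1r /derive1n/=.
  rewrite wd1; last exact: test_derive1.
  rewrite -mulN1r [X in X = _]mulN1r (_ : L2dot (fun x => - f x) _ = - L2dot f (fun x => chi n x * cb m x)); last first.
    rewrite -mulN1r -L2dotZl//; last exact: test_L2.
    by apply: eq_L2dot => // x _; rewrite mulN1r.
  move=> /oppr_inj <-.
  have := wd1 _ (tcs n).
  rewrite (derive1M (test_smooth (tchi n)) sc) (derive1M (test_smooth (tchi n)) ss).
  rewrite derive1_cb derive1_sb chi'E.
  have h1 := test_L2 (tcs n).
  have h2 : L2 (fun x => cb m x * chi' n x).
    have := test_L2 (testM (tchi' n) sc); congr (L2 _).
    by apply/funext => x; rewrite mulrC.
  have h3 : L2 (fun x => chi n x * (- m%:R ^+ 2 * cb m x)).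
    have := L2Z (- m%:R ^+ 2) (test_L2 (tcc n)); congr (L2 _).
    by apply/funext => x; rewrite mulrCA.
  have h4 : L2 (fun x => sb m x * chi' n x).
    have := test_L2 (testM (tchi' n) ss); congr (L2 _).
    by apply/funext => x; rewrite mulrC.
  rewrite L2dotDr// L2dotDr// => E.
  rewrite -[L2dot du (fun x => chi n x * sb m x)]opprK -E.
  rewrite (_ : L2dot e (fun x => chi n x * (- m%:R ^+ 2 * cb m x)) =
    - (m%:R ^+ 2 * L2dot e (fun x => chi n x * cb m x))); last first.
    transitivity ((- m%:R ^+ 2) * L2dot e (fun x => chi n x * cb m x)); last by rewrite mulNr.
    rewrite -L2dotZr//; last exact: test_L2.
    by apply: eq_L2dot => // x _; rewrite mulrCA.
  rewrite (_ : L2dot e (fun x => sb m x * chi' n x) = L2dot e (fun x => chi' n x * sb m x)).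
    by ring.
  by apply: eq_L2dot => // x _; rewrite mulrC.
have chi1 x : I0 x -> (\forall n \near \oo, chi n x = 1) /\ (\forall n \near \oo, chi' n x = 0).
  rewrite /= in_itv/= => /andP[x0 xpi].
  have s0 : 0 < Num.min x (pi - x) / 3 by rewrite divr_gt0// lt_min x0 subr_gt0.
  have H3 n : d n < Num.min x (pi - x) / 3 -> chi n x = 1 /\ chi' n x = 0.
    rewrite ltr_pdivlMr// lt_min => /andP[dx dpx].
    have l1 : 2 * d n + d n <= x by move: dx; clear; lra.
    have l2 : x <= q n - d n by rewrite /q; move: dpx; clear; lra.
    have [_ e1 e2] := step_right sp (d0 n) l1; have [_ e3 e4] := step_left sp (d0 n) l2.
    by rewrite /chi /chi' e1 e2 e3 e4 !subr0.
  by split; apply: filterS (dsmall _ s0) => n /H3[].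
have chib n x : `|chi n x| <= 1.
  have /andP[s1 s2] := step_at_itv sp (2 * d n) (d n) x.
  have /andP[s3 s4] := step_at_itv sp (q n) (d n) x.
  by rewrite /chi ler_norml; move: s1 s2 s3 s4; clear; move=> *; apply/andP; split; lra.
have mcont g : continuous g -> measurable_fun I0 g by move=> cg; exact: continuous_measurable_in.
have cb_cont := @continuous_cb R m.
have lim1 (g : R -> R) : L2 g -> (fun n => L2dot g (fun x => chi n x * cb m x)) @ \oo --> L2dot g (cb m).
  move=> hg; apply: (@dominated_L1M g _ (cb m) 1); [exact: L2_L1| | | |].
  - by move=> n; apply: mcont; exact: test_continuous (tcc n).
  - exact: mcont.
  - move=> n x _; rewrite normrM; apply: mulr_ile1 => //; exact: cb_le1.
  - move=> x Ix; rewrite -[X in _ --> X]mul1r; apply: cvgM; last exact: cvg_cst.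
    by apply: cvg_near_cst; exact: (chi1 x Ix).1.
have K0 : 0 <= K.
  by case: sp => _ _ [_ /(_ 0) /andP[r0 rK]] _ _; exact: le_trans rK.
(* A bump is at most K / d, and on its support, within 3 d of an end, |sb m| is at most 3 d m^2. The
   product stays bounded and tends to 0 pointwise, so integrability of e is enough. *)
have lim2 : (fun n => L2dot e (fun x => chi' n x * sb m x)) @ \oo --> 0.
  have -> : 0 = \int[mu]_(x in I0) (e x * 0).
    by under eq_Rintegral do rewrite mulr0; rewrite Rintegral_I0_cst mul0r.
  apply: (@dominated_L1M e _ (cst 0) (6 * K * m%:R ^+ 2)); [exact: L2_L1| | | |].
  - by move=> n; apply: mcont; exact: test_continuous (testM (tchi' n) ss).
  - exact: measurable_cst.
  - move=> n x Ix; have [sx spx] := sb_le m Ix.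
    have B a y : `|sb m x| <= m%:R ^+ 2 * y -> bump_at r a (d n) x = 0 \/ y <= 3 * d n ->
        `|bump_at r a (d n) x * sb m x| <= 3 * K * m%:R ^+ 2.
      move=> sy [->|yd]; first by rewrite mul0r normr0 mulr_ge0 ?sqr_ge0// mulr_ge0.
      have /andP[b0 bK] := bump_at_itv sp a x (d0 n).
      rewrite normrM ger0_norm//; apply: le_trans (ler_pM b0 (normr_ge0 _) bK sy) _.
      rewrite mulrAC -mulrA ler_pdivrMl//.
      rewrite (_ : d n * (3 * K * m%:R ^+ 2) = (m%:R ^+ 2 * (3 * d n)) * K); last by ring.
      by rewrite ler_wpM2r// ler_wpM2l ?sqr_ge0.
    have b1 : `|bump_at r (2 * d n) (d n) x * sb m x| <= 3 * K * m%:R ^+ 2.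
      apply: (B _ x) => //; have [xr|xr] := leP (2 * d n + d n) x.
        by left; have [_ _] := step_right sp (d0 n) xr.
      by right; move: xr; clear; lra.
    have b2 : `|bump_at r (q n) (d n) x * sb m x| <= 3 * K * m%:R ^+ 2.
      apply: (B _ (pi - x)) => //; have [xr|xr] := leP x (q n - d n).
        by left; have [_ _] := step_left sp (d0 n) xr.
      by right; move: xr; rewrite /q; clear; lra.
    rewrite /chi' mulrBl; apply: le_trans (ler_normB _ _) _.
    by move: b1 b2; clear; lra.
  - move=> x Ix; rewrite -[X in _ --> X](mul0r (sb m x)); apply: cvgM; last exact: cvg_cst.
    by apply: cvg_near_cst; exact: (chi1 x Ix).2.
(* Here [cb m] does not vanish at the ends. The bumps have mass 1 and concentrate there, where du is
   continuous with value 0: this is where the Neumann condition is used. *)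
have lim3 : (fun n => L2dot du (fun x => cb m x * chi' n x)) @ \oo --> 0.
  have [_ du_0 du_pi] := (continuous_within_itvP du pi0).1 cdu.
  apply/cvgrPdist_le => /= eps eps0.
  have e2 : 0 < eps / 2 by rewrite divr_gt0.
  move/cvgrPdist_le : du_0 => /(_ _ e2); rewrite near_withinE => /nbhs_ballP[s1 /= s10 Hs1].
  move/cvgrPdist_le : du_pi => /(_ _ e2); rewrite near_withinE => /nbhs_ballP[s2 /= s20 Hs2].
  have s0 : 0 < Num.min s1 s2 / 3 by rewrite divr_gt0// lt_min s10 s20.
  apply: filterS (dsmall _ s0) => n.
  rewrite ltr_pdivlMr// lt_min => /andP[ds1 ds2].
  have tp : L2 (fun x => cb m x * chi' n x).
    have := test_L2 (testM (tchi' n) sc); congr (L2 _).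
    by apply/funext => x; rewrite mulrC.
  rewrite sub0r normrN; apply: le_trans (le_normr_Rintegral_L1 (L2_L1M hdu tp)) _.
  have l1 := L2_L1 (test_L2 (tb1 n)); have l2 := L2_L1 (test_L2 (tb2 n)).
  have -> : eps = \int[mu]_(x in I0) (eps / 2 * (bump_at r (2 * d n) (d n) x + bump_at r (q n) (d n) x)).
    rewrite Rintegral_L1Z; last exact: L1D.
    rewrite Rintegral_L1D// !(Rintegral_bump_at sp)//; first by field.
  apply: le_Rintegral_L1; [exact/L1_norm/L2_L1M|by apply: L1Z; exact: L1D|].
  move=> x; rewrite /= in_itv/= => /andP[x0 xpi].
  have /andP[b0 _] := bump_at_itv sp (2 * d n) x (d0 n).
  have /andP[b0' _] := bump_at_itv sp (q n) x (d0 n).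
  have step1 : `|du x| * `|chi' n x| <= eps / 2 * (bump_at r (2 * d n) (d n) x + bump_at r (q n) (d n) x).
    have [xl|xl] := leP (2 * d n + d n) x.
      have [xr|xr] := leP x (q n - d n).
        have [_ _ e3] := step_right sp (d0 n) xl; have [_ _ e4] := step_left sp (d0 n) xr.
        by rewrite /chi' e3 e4 subrr normr0 mulr0 addr0 mulr0.
      have dux : `|du x| <= eps / 2.
        suff bx : ball pi s2 x by have := Hs2 x bx xpi; rewrite dupi sub0r normrN.
        by rewrite /ball/= gtr0_norm ?subr_gt0//; move: xr ds2; rewrite /q; clear; lra.
      apply: ler_pM => //; rewrite /chi'; apply: le_trans (ler_normB _ _) _.
      by rewrite !ger0_norm.
    have dux : `|du x| <= eps / 2.
      suff bx : ball 0 s1 x by have := Hs1 x bx x0; rewrite du0 sub0r normrN.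
      by rewrite /ball/= sub0r normrN gtr0_norm//; move: xl ds1; clear; lra.
    apply: ler_pM => //; rewrite /chi'; apply: le_trans (ler_normB _ _) _.
    by rewrite !ger0_norm.
  apply: le_trans step1; rewrite !normrM; apply: ler_wpM2l => //.
  by apply: ler_piMl => //; rewrite -normrM; exact: cb_le1.
have L := lim1 f hf.
have L' : (fun n => L2dot f (fun x => chi n x * cb m x)) @ \oo --> 0 - 0 + m%:R ^+ 2 * L2dot e (cb m).
  under eq_fun do rewrite E1.
  apply: cvgD; first exact: cvgB.
  by apply: cvgM; [exact: cvg_cst|exact: lim1].
by have := cvg_unique _ L L'; rewrite subr0 add0r; apply; exact: Rhausdorff.
Qed.

End Eigenbasis.

(** * Functions of A_N, and identification of the heat kernel *)

Section Calculus.
Context {R : realType}.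
Local Notation mu := (@lebesgue_measure R).
Local Notation I0 := (`]0, pi[%classic : set R).
Implicit Types (f g h F u v w phi psi : R -> R) (t x y z : R) (a : nat -> R).

Lemma ae_exists_itv (P : R -> Prop) (p q : R) : p < q -> {ae mu, forall x, P x} ->
  exists2 x, p < x < q & P x.
Proof.
move=> pq [N [mN N0 NP]]; apply: contrapT => H.
have sub : `]p, q[%classic `<=` N.
  move=> x /=; rewrite in_itv/= => xpq; apply: NP => /= Px.
  by apply: H; exists x.
have : (mu `]p, q[%classic <= mu N)%E.
  by apply: le_measure => //; rewrite inE//; exact: measurable_itv.
by rewrite N0 lebesgue_measure_itv/= lte_fin pq -EFinB lee_fin leNgt subr_gt0 pq.
Qed.

Lemma cosine_unique f g : L2 f -> L2 g -> (forall n, L2dot f (cb n) = L2dot g (cb n)) ->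
  {ae mu, forall x, I0 x -> f x = g x}.
Proof.
move=> hf hg fg; have hfg : L2 (fun x => f x - g x) := L2B hf hg.
have : {ae mu, forall x, I0 x -> f x - g x = 0}.
  by apply: cosine_complete => // n; rewrite L2dotBl ?fg ?subrr//; exact: L2_cb.
by apply: aeS => x H Ix; apply/eqP; rewrite -subr_eq0 H.
Qed.

(* Exactly one member of an eigenbasis is not orthogonal to cb m, and it is
   +-cb m with eigenvalue m^2, by the symmetry of A_N. *)
Lemma calculus_coef (h : R -> R) w v m : neumann_calculus h w v ->
  L2dot v (cb m) = h (m%:R ^+ 2) * L2dot w (cb m).
Proof.
move=> [hw hv [e [lam [[elap eon ecomp] cv]]]].
have he n : L2 (e n) by have [[]] := elap n.
have hc n : L2 (@cb R n) := L2_cb n.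
pose s n := L2dot (e n) (cb m).
have eig n k : (lam n - k%:R ^+ 2) * L2dot (e n) (cb k) = 0.
  have := neumann_laplacian_sym k (elap n); rewrite L2dotZl// => E.
  by rewrite mulrBl E subrr.
have lamE n : s n != 0 -> lam n = m%:R ^+ 2.
  move=> sn; have /eqP := eig n m; rewrite mulf_eq0 (negbTE sn) orbF subr_eq0.
  by move/eqP.
have eae n : s n != 0 -> {ae mu, forall x, I0 x -> e n x = s n * cb m x}.
  move=> sn; apply: cosine_unique => // [|k]; first exact: L2Z.
  rewrite L2dotZl// L2dot_cb; have [<-|mk] := eqVneq m k; first by rewrite mulr1.
  have /eqP := eig n k; rewrite lamE// mulf_eq0 subr_eq0 => /orP[|/eqP->]; last by rewrite mulr0.
  by rewrite -!natrX eqr_nat eqn_exp2r// (negbTE mk).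
have s2 n : s n != 0 -> s n * s n = 1.
  move=> sn; have <- : L2dot (e n) (e n) = 1 by rewrite eon eqxx.
  rewrite -(L2dot_ae (L2Z (s n) (hc m)) (he n) (he n)); last first.
    by apply: aeS (eae n sn) => x H Ix; rewrite H.
  by rewrite L2dotZl// (L2dotC (cb m)).
have [n0 sn0] : exists n, s n != 0.
  apply: contrapT => /forallNP H.
  have cm0 : {ae mu, forall x, I0 x -> cb m x = 0 :> R}.
    apply: ecomp => // n; rewrite L2dotC; have /negP := H n.
    by rewrite negbK => /eqP.
  have := L2dot_cb m m; rewrite eqxx => E.
  have := L2dot_ae (hc m) (L2_cst 0) (hc m) cm0; rewrite E.
  rewrite /L2dot (@eq_Rintegral _ _ _ _ _ (cst 0)) => [|x _]; last by rewrite /= mul0r.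
  by rewrite Rintegral_cst// mul0r => /eqP; rewrite oner_eq0.
have sN n : n != n0 -> s n = 0.
  move=> nn0; apply/eqP; apply: contraT => sn.
  have E : L2dot (e n0) (e n) = 0 by rewrite eon eq_sym (negbTE nn0).
  have : s n0 * s n = 0.
    rewrite -[RHS]E -(L2dot_ae (L2Z (s n0) (hc m)) (he n0) (he n)).
      by rewrite L2dotZl// (L2dotC (cb m)).
    by apply: aeS (eae n0 sn0) => x H Ix; rewrite H.
  by move/eqP; rewrite mulf_eq0 (negbTE sn0) (negbTE sn).
have wE : L2dot w (cb m) = L2dot w (e n0) * s n0.
  rewrite (L2dotC w (e n0)) (L2dot_ae (he n0) (L2Z (s n0) (hc m)) hw (eae n0 sn0)).
  by rewrite L2dotZl// (L2dotC _ w) mulrAC s2// mul1r.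
pose S (N : nat) x := \sum_(n < N) h (lam n) * L2dot w (e n) * e n x.
have hS N : L2 (S N).
  by apply: (@L2_sum R N (fun n x => h (lam n) * L2dot w (e n) * e n x)) => n; exact: L2Z.
have SE N : (n0 < N)%N -> L2dot (S N) (cb m) = h (m%:R ^+ 2) * L2dot w (cb m).
  move=> n0N; rewrite (@L2dot_suml R N (fun n x => h (lam n) * L2dot w (e n) * e n x))//; last first.
    by move=> n; exact: L2Z.
  rewrite (bigD1 (Ordinal n0N))//= big1 ?addr0.
    by rewrite L2dotZl// -/(s n0) lamE// wE mulrA.
  move=> i ii; rewrite L2dotZl// -/(s i) sN ?mulr0//.
(* Convergence in L^2 gives convergence of the m-th coefficient by the Cauchy-Schwarz inequality,
   and past n0 that coefficient of the partial sums is constant. *)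
have cd : (fun N => L2dot (fun x => v x - S N x) (fun x => v x - S N x)) @ \oo --> 0.
  move: cv; under eq_fun do rewrite (L2dist2E hv (hS _)).
  by move=> /fine_cvg.
have : (L2dot v (cb m) - h (m%:R ^+ 2) * L2dot w (cb m)) ^+ 2 <= 0.
  rewrite -(cvg_lim _ cd)//; apply: limr_ge; first by apply/cvg_ex; exists 0.
  exists n0.+1 => // N /= n0N; rewrite -(SE N)// -L2dotBl//.
  have hvS : L2 (fun x => v x - S N x) := L2B hv (hS N).
  by apply: le_trans (L2dot_CS hvS (hc m)) _; rewrite L2dot_cb eqxx mulr1.
by rewrite real_exprn_even_le0 ?num_real//= subr_eq0 => /eqP.
Qed.

(** The uniform tail bound makes the squared L^2 distance to the N-th partial sum at most pi (tl
    N)^2. *)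
Lemma neumann_calculus_cser (h : R -> R) w :
  L2 w -> nsum (fun n => h (n%:R ^+ 2) * L2dot w (cb n)) ->
  neumann_calculus h w (cser (fun n => h (n%:R ^+ 2) * L2dot w (cb n))).
Proof.
move=> hw na; have cc := continuous_cser na.
split=> //; first exact: continuous_L2.
exists (@cb R), (fun n => n%:R ^+ 2); split; first exact: neumann_eigenbasis_cb.
have [tl [tl0 tlge0 Htl]] := cser_tail na.
set a := (fun n : nat => h (n%:R ^+ 2) * L2dot w (cb n)) in na cc Htl *.
pose S (N : nat) x := \sum_(n < N) a n * cb n x.
have hS N : L2 (S N).
  by apply: (@L2_sum R N (fun n x => a n * cb n x)) => n; apply: L2Z; exact: L2_cb.
have hC := continuous_L2 cc.
under eq_fun do rewrite (L2dist2E hC (hS _)).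
apply: cvg_EFin; first exact: nearW.
have bnd N : `|L2dot (fun x => cser a x - S N x) (fun x => cser a x - S N x)| <= tl N * tl N * pi.
  have hB := L2B hC (hS N).
  rewrite -Rintegral_I0_cst; apply: le_trans (le_normr_Rintegral_L1 (L2_L1M hB hB)) _.
  apply: le_Rintegral_L1; [exact/L1_norm/L2_L1M|exact: L1_cst|].
  by move=> x _; rewrite normrM; apply: ler_pM => //; exact: Htl.
have c0 : (fun N => tl N * tl N * pi) @ \oo --> 0.
  rewrite -[X in _ --> X](mul0r (pi : R)) -[X in X * pi](mulr0 (0 : R)).
  by apply: cvgM; [exact: cvgM|exact: cvg_cst].
apply/cvgrPdist_le => /= eps eps0.
move/cvgrPdist_le : c0 => /(_ _ eps0); apply: filterS => N.
rewrite !sub0r !normrN => H; exact: le_trans (bnd N) (le_trans (ler_norm _) H).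
Qed.

Lemma hk_is_heat_kernel : is_neumann_heat_kernel (@hk R).
Proof.
move=> t t0; split.
  move=> x y _ _.
  have -> : (fun z : R * R => hk t z.1 z.2) =
            (fun z : R * R => theta t (z.1 - z.2) + theta t (z.1 + z.2)).
    by apply/funext => p; rewrite hkE.
  have ct := continuous_theta t0.
  have c1 : {for (x, y), continuous (fun z : R * R => theta t (z.1 - z.2))}.
    apply: (@continuous_comp _ _ _ (fun z : R * R => z.1 - z.2) (theta t)); last exact: ct.
    by apply: cvgB; [exact: cvg_fst|exact: cvg_snd].
  have c2 : {for (x, y), continuous (fun z : R * R => theta t (z.1 + z.2))}.
    apply: (@continuous_comp _ _ _ (fun z : R * R => z.1 + z.2) (theta t)); last exact: ct.
    by apply: cvgD; [exact: cvg_fst|exact: cvg_snd].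
  exact: cvgD.
move=> f hf; split.
  apply: aeS (ae_neq 0) => x _ Ix.
  apply: (@L2_L1M R (hk t x) f) => //; apply: continuous_L2; exact: continuous_hk.
have E : (fun x => \int[mu]_(y in I0) (hk t x y * f y)) =
   cser (fun n => expR (- (t * n%:R ^+ 2)) * L2dot f (cb n)).
  by apply/funext => x; exact: heat_opE.
rewrite E; apply: (@neumann_calculus_cser (fun l => expR (- (t * l)))) => //.
exact: nsum_coef.
Qed.

(** By [calculus_coef] both kernels define the same operator, but only at almost every first
    argument. If they differed at (x, y), the difference would keep its sign on a ball by
    continuity; a bump near y, evaluated at a point x' close to x where the operators agree, gives a
    contradiction. *)
Lemma heat_kernel_unique k t x y : is_neumann_heat_kernel k -> 0 < t -> I0 x -> I0 y ->
  k t x y = hk t x y.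
Proof.
move=> kP t0 Ix Iy; apply: contrapT => /eqP; rewrite -subr_eq0 => D0.
have [kc kop] := kP _ t0; have [hc _] := hk_is_heat_kernel t0.
pose D x y := k t x y - hk t x y.
pose sg := Num.sg (D x y).
have e0 : 0 < `|D x y| / 2 by rewrite divr_gt0// normr_gt0.
set e := `|D x y| / 2 in e0.
have cD : {for (x, y), continuous (fun z : R * R => D z.1 z.2)}.
  by apply: cvgB; [exact: kc|exact: hc].
move/cvgrPdist_le : cD => /(_ _ e0)/nbhs_ballP[d1 /= d10 Hd].
have [H2 [H [r [c [K sp]]]]] := @exists_step R.
move: Ix Iy; rewrite /= !in_itv/= => /andP[x0 xpi] /andP[y0 ypi].
pose d := Num.min (d1 / 2) (Num.min (Num.min x (pi - x) / 2) (Num.min y (pi - y) / 2)).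
have dp : 0 < d by rewrite !lt_min !divr_gt0// !lt_min ?x0 ?y0 ?subr_gt0 ?xpi.
have dd1 : d < d1.
  have : d <= d1 / 2 by rewrite /d ge_min lexx.
  by move: d10; clear; lra.
have dx : 2 * d <= Num.min x (pi - x).
  have : d <= Num.min x (pi - x) / 2 by rewrite /d !ge_min lexx !orbT.
  by clear; lra.
have dy : 2 * d <= Num.min y (pi - y).
  have : d <= Num.min y (pi - y) / 2 by rewrite /d !ge_min lexx !orbT.
  by clear; lra.
move: dx dy; rewrite !le_min => /andP[dx1 dx2] /andP[dy1 dy2].
have y1 : 0 < y - d by move: dy1 dp; clear; lra.
have y2 : y + d < pi by move: dy2 dp; clear; lra.
have tf := test_bump_at sp dp y1 y2; set f := bump_at r y d in tf.
have hf := test_L2 tf.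
have [kint kcalc] := kop _ hf.
have hcalc : neumann_calculus (fun l => expR (- (t * l))) f (heat_op t f).
  by have [_ H'] := hk_is_heat_kernel t0; have [] := H' _ hf.
have aeE : {ae mu, forall x, I0 x -> \int[mu]_(y in I0) (k t x y * f y) = heat_op t f x}.
  apply: cosine_unique; [by case: kcalc|by case: hcalc|] => n.
  by rewrite (calculus_coef n kcalc) (calculus_coef n hcalc).
have xd : x - d < x + d by move: dp; clear; lra.
have [x' /andP[xx1 xx2] [ki E]] := ae_exists_itv xd (aeI kint aeE).
have Ix' : I0 x'.
  by rewrite /= in_itv/=; move: xx1 xx2 dx1 dx2 dp; clear; move=> *; apply/andP; split; lra.
have {}ki := ki Ix'; have {}E := E Ix'.
have hki : L1 (fun y => hk t x' y * f y).
  by apply: L1_hkM => //; exact: test_continuous.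
have f0 z : 0 <= f z by have /andP[] := bump_at_itv sp y z dp.
have DE : \int[mu]_(z in I0) (D x' z * f z) = 0.
  rewrite -[RHS](subrr (heat_op t f x')) -[X in X - _]E /heat_op -Rintegral_L1B//.
  by apply: eq_Rintegral => z _; rewrite mulrBl.
have DL : L1 (fun z => D x' z * f z).
  by apply: eq_L1 (L1B ki hki) => z _; rewrite mulrBl.
have fL := L2_L1 hf.
have Df z : I0 z -> e * f z <= sg * (D x' z * f z).
  move=> Iz; have [zl|zl] := leP z (y - d).
    by have [_ _ E0] := step_left sp dp zl; rewrite /f E0 !mulr0.
  have [zr|zr] := leP (y + d) z.
    by have [_ _ E0] := step_right sp dp zr; rewrite /f E0 !mulr0.
  rewrite (mulrA sg); apply: ler_wpM2r => //.
  have B : ball (x, y) d1 (x', z).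
    split; rewrite /ball/= ltr_distlC; apply/andP; split.
    - by move: xx1 dd1; clear; lra.
    - by move: xx2 dd1; clear; lra.
    - by move: zl dd1; clear; lra.
    - by move: zr dd1; clear; lra.
  have := Hd _ B; rewrite /= => Hz.
  have sg1 : `|sg| = 1 by rewrite /sg normr_sg D0.
  have : sg * (D x y - D x' z) <= e.
    by apply: le_trans (ler_norm _) _; rewrite normrM sg1 mul1r.
  rewrite mulrBr {1}/sg -normrEsg.
  by rewrite /e; clear; lra.
have : \int[mu]_(z in I0) (e * f z) <= \int[mu]_(z in I0) (sg * (D x' z * f z)).
  by apply: le_Rintegral_L1 => //; exact: L1Z.
rewrite (Rintegral_L1Z e fL) (Rintegral_L1Z sg DL) DE mulr0 (Rintegral_bump_at sp dp y1 y2) mulr1.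
by rewrite leNgt e0.
Qed.

Lemma neumann_heat_kernelE t x y : 0 < t -> I0 x -> I0 y ->
  neumann_heat_kernel t x y = hk t x y.
Proof.
move=> t0 Ix Iy; apply: heat_kernel_unique => //.
rewrite /neumann_heat_kernel; apply: (@xgetPex _ _ [set k | is_neumann_heat_kernel k]).
by exists (@hk R); exact: hk_is_heat_kernel.
Qed.

End Calculus.

(** * Fractional powers *)
Section Dilation.
Context {R : realType}.
Local Notation mu := (@lebesgue_measure R).

Definition dilR (c : R) : measurableTypeR R -> measurableTypeR R := fun x => c * x.

Let mdil (c : R) : measurable_fun setT (dilR c).
Proof. exact: measurable_funM. Qed.

HB.instance Definition _ c := isMeasurableFun.Build _ _ _ _ _ (mdil c).

(** By uniqueness, c times the image of Lebesgue measure under the dilation is Lebesgue measure. *)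
Lemma integral_dilate (c : R) (f : R -> \bar R) : 0 < c ->
  measurable_fun setT f -> (forall x, 0 <= f x)%E ->
  (\int[mu]_x f x = c%:E * \int[mu]_x f (c * x)%R)%E.
Proof.
move=> c0 mf f0; pose c' : {nonneg R} := NngNum (ltW c0).
have cV0 : 0 <= c^-1 by rewrite invr_ge0 ltW.
pose cV : {nonneg R} := NngNum cV0.
pose nu0 := measure_function_pushforward__canonical__measure_function_Measure mu (mdil c).
pose nu : {measure set (measurableTypeR R) -> \bar R} := mscale c' nu0.
have nuE A : nu A = (c%:E * pushforward mu (dilR c) A)%E by [].
have E (A : set (measurableTypeR R)) : measurable A ->
    pushforward mu (dilR c) A = (c^-1%:E * mu A)%E.
  move=> mA; have -> : mu A = (c%:E * pushforward mu (dilR c) A)%E.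
    rewrite -nuE; apply: lebesgue_measure_unique mA => _ [[a b]] _ <-.
    rewrite nuE /pushforward (_ : dilR c @^-1` _ = `]a / c, b / c]%classic); last first.
      by apply/seteqP; split => x /=; rewrite !in_itv/= /dilR ltr_pdivrMr// ler_pdivlMr// mulrC.
    rewrite !lebesgue_measure_itv/= !lte_fin ltr_pM2r ?invr_gt0//.
    case: ifP => _; last by rewrite mule0.
    by rewrite -!EFinB -EFinM; congr EFin; field; rewrite gt_eqF.
  by rewrite muleA -EFinM mulVf ?gt_eqF// mul1e.
have <- : (\int[nu0]_x f x = \int[mu]_x f (c * x)%R)%E.
  by rewrite (@ge0_integral_pushforward _ _ _ _ _ _ (mdil c) mu setT f).
have -> : (\int[nu0]_x f x = \int[mscale cV mu]_x f x)%E.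
  apply: eq_measure_integral => A mA _.
  exact: E.
by rewrite ge0_integral_mscale// muleA -EFinM mulfV ?gt_eqF// mul1e.
Qed.
End Dilation.

(** * The Gamma integral and the power l^alpha as an integral over time *)

Section GammaIdentity.
Context {R : realType}.
Local Notation mu := (@lebesgue_measure R).
Variable alpha : R.
Hypotheses (alpha_gt0 : 0 < alpha) (alpha_lt1 : alpha < 1).

(** Gamma (1 - alpha) as an extended real. The real-valued [Gamma] takes the default value 0 on a
    divergent integral, so finiteness has to be settled before the two are identified in
    [Gamma1B]. *)
Let G0 := (\int[mu]_(r in `]0%R, +oo[) (r `^ (- alpha) * expR (- r))%R%:E)%E.

Lemma continuous_powR_gt0 (a x : R) : 0 < x -> {for x, continuous (@powR R ^~ a)}.
Proof.
move=> x0; apply: differentiable_continuous; apply/derivable1_diffP.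
by case: (is_derive1_powR a x0).
Qed.

Lemma powRN_cvg_pinfty : (s `^ (- alpha)) @[s --> +oo%R] --> 0.
Proof.
apply/cvgrPdist_le => /= e e0; near=> s.
have s0 : 0 < s by near: s; exact: nbhs_pinfty_gt.
rewrite sub0r normrN ger0_norm ?powR_ge0// powRN.
rewrite -[leRHS]invrK lef_pV2 ?posrE ?invr_gt0 ?powR_gt0//.
rewrite (_ : e^-1 = ((e^-1) `^ alpha^-1) `^ alpha); last first.
  by rewrite -powRrM mulVf ?gt_eqF// powRr1// invr_ge0 ltW.
apply: ge0_ler_powR; [exact: ltW|by rewrite nnegrE powR_ge0|by rewrite nnegrE ltW|].
by near: s; apply: nbhs_pinfty_ge; exact: num_real.
Unshelve. all: by end_near. Qed.

Let is_derive_powR_div (b s : R) : b != 0 -> 0 < s ->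
  is_derive s (1 : R) (fun s => s `^ b / b) (s `^ (b - 1)).
Proof.
move=> b0 s0; have d := is_deriveZ b^-1 (is_derive1_powR b s0).
rewrite (_ : (fun s => _) = b^-1 \*: (@powR R ^~ b)); last first.
  by apply/funext => y; rewrite /= /GRing.scale/= mulrC.
by apply: (is_derive_eq d); rewrite /GRing.scale/= mulKf.
Qed.

Lemma integral_powR_tail (r : R) : 0 < r ->
  (\int[mu]_(s in `]r, +oo[) (s `^ (- alpha - 1))%:E = (r `^ (- alpha) / alpha)%:E)%E.
Proof.
move=> r0; pose F (s : R) := - (s `^ (- alpha) / alpha).
have dF (s : R) : 0 < s -> is_derive s (1 : R) F (s `^ (- alpha - 1)).
  have aN0 : - alpha != 0 by rewrite oppr_eq0 gt_eqF.
  move=> /(is_derive_powR_div aN0); congr (is_derive _ _ _ _).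
  by apply/funext => y; rewrite /F invrN mulrN.
have c1 (s : R) : 0 < s -> {for s, continuous (@powR R ^~ (- alpha - 1))}.
  exact: continuous_powR_gt0.
rewrite integral_itv_obnd_cbnd; last first.
  apply/measurable_EFinP; apply: measurable_funTS; exact: measurable_powR.
rewrite (@ge0_continuous_FTC2y _ _ F r 0).
- by rewrite sub0e /F EFinN oppeK.
- by move=> x _; exact: powR_ge0.
- apply/continuous_within_itvcyP; split.
    by move=> x; rewrite in_itv/= andbT => rx; apply: c1; exact: lt_trans rx.
  by apply: cvg_at_right_filter; exact: c1.
- rewrite -oppr0 -(mul0r alpha^-1); apply: cvgN; apply: cvgM; last exact: cvg_cst.
  exact: powRN_cvg_pinfty.
- by move=> x rx; case: (dF x (lt_trans r0 rx)).
- apply: cvg_at_right_filter; apply: differentiable_continuous; apply/derivable1_diffP.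
  by case: (dF r r0).
- move=> x; rewrite in_itv/= andbT => rx; rewrite derive1E.
  by case: (dF x (lt_trans r0 rx)).
Qed.

Lemma measurable_gamma_integrand : measurable_fun setT (fun r : R => r `^ (- alpha) * expR (- r)).
Proof.
apply: measurable_funM; first exact: measurable_powR.
by apply: measurableT_comp; [exact: measurable_expR|exact: oppr_measurable].
Qed.

Let gamma_integrand_ge0 r : 0 <= r `^ (- alpha) * expR (- r).
Proof. by rewrite mulr_ge0 ?powR_ge0 ?expR_ge0. Qed.

Let mgi (A : set R) : measurable_fun A (fun r : R => (r `^ (- alpha) * expR (- r))%:E).
Proof. by apply: measurable_funTS; apply/measurable_EFinP; exact: measurable_gamma_integrand. Qed.

(** The integrand is singular at 0: the fundamental theorem of calculus is applied on []harmonic n,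
    1]], and monotone convergence passes to the union of these intervals. *)
Lemma integral_powR_unit :
  (\int[mu]_(r in `]0%R, 1%R]) (r `^ (- alpha))%:E <= ((1 - alpha)^-1)%:E)%E.
Proof.
have b0 : 0 < 1 - alpha by rewrite subr_gt0.
pose F (n : nat) : set R := `]harmonic n, 1]%classic.
have UF : \bigcup_n F n = `]0, 1]%classic.
  apply/seteqP; split => [x [n _]|x]; rewrite /F /= !in_itv/=.
    by move=> /andP[nx ->]; rewrite andbT (lt_trans _ nx)// harmonic_gt0.
  move=> /andP[x0 x1]; have := @cvg_harmonic R.
  move/cvgrPdist_lt => /(_ _ x0) [N _ /(_ N (leqnn N))].
  rewrite /= sub0r normrN gtr0_norm ?harmonic_gt0// => Nx.
  by exists N => //=; rewrite /F /= in_itv/= Nx.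
have ndF : nondecreasing_seq F.
  move=> m n mn; rewrite subsetEset => x; rewrite /F /= !in_itv/= => /andP[mx ->].
  rewrite andbT (le_lt_trans _ mx)// /harmonic/= lef_pV2 ?posrE ?ltr0n// ler_nat.
  by rewrite ltnS.
have mf (i : nat) : measurable_fun (F i) (fun r => (r `^ (- alpha))%:E).
  by apply: measurable_funTS; apply/measurable_EFinP; exact: measurable_powR.
have f0 i x : F i x -> (0 <= (x `^ (- alpha))%:E)%E by move=> _; rewrite lee_fin powR_ge0.
have mF i : measurable (F i) by exact: measurable_itv.
have := @ge0_nondecreasing_set_cvg_integral _ (measurableTypeR R) R F (fun r => (r `^ (- alpha))%:E) mu ndF mF mf f0.
rewrite UF => c; rewrite -(cvg_lim _ c)//; apply: lime_le.
  by apply/cvg_ex; eexists; exact: c.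
apply: nearW => n; rewrite /F.
(* For n = 0 the interval is empty, as [harmonic 0] is 1. *)
have [h1|h1] := leP 1 (harmonic n : R).
  by rewrite set_itv_ge ?bnd_simp -?leNgt// integral_set0 lee_fin invr_ge0 ltW.
rewrite integral_itv_obnd_cbnd; last exact: mf.
pose G (s : R) := s `^ (1 - alpha) / (1 - alpha).
have dG (s : R) : 0 < s -> is_derive s (1 : R) G (s `^ (- alpha)).
  have bN0 : 1 - alpha != 0 by rewrite gt_eqF.
  have -> : - alpha = 1 - alpha - 1 by ring.
  exact: is_derive_powR_div.
have hn0 : 0 < harmonic n :> R := harmonic_gt0 n.
have cG (s : R) : 0 < s -> {for s, continuous G}.
  by move=> s0; apply: differentiable_continuous; apply/derivable1_diffP; case: (dG s s0).
rewrite (@continuous_FTC2 _ _ G)//.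
- rewrite -EFinB lee_fin /G powR1 mul1r lerBlDr lerDl.
  by rewrite divr_ge0 ?powR_ge0// ltW.
- apply/(continuous_within_itvP _ h1); split.
  + by move=> x; rewrite in_itv/= => /andP[hx _]; apply: continuous_powR_gt0; exact: lt_trans hx.
  + by apply: cvg_at_right_filter; exact: continuous_powR_gt0.
  + by apply: cvg_at_left_filter; apply: continuous_powR_gt0.
- split.
  + by move=> x; rewrite in_itv/= => /andP[hx _]; case: (dG x (lt_trans hn0 hx)).
  + by apply: cvg_at_right_filter; exact: cG.
  + by apply: cvg_at_left_filter; exact: cG.
- move=> x; rewrite in_itv/= => /andP[hx _]; rewrite derive1E.
  by case: (dG x (lt_trans hn0 hx)).
Qed.

Let split_half_line : `]0, +oo[%classic = `]0, 1]%classic `|` `]1, +oo[%classic :> set R.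
Proof.
apply/seteqP; split => x /=; rewrite !in_itv/= ?andbT.
  by move=> x0; have [x1|x1] := leP x 1; [left; rewrite x0|right].
by case=> [/andP[]//|]; exact: lt_trans.
Qed.

Let disj_half_line : [disjoint `]0, 1]%classic & `]1, +oo[%classic : set R].
Proof.
apply/disj_setPS => x [/=]; rewrite !in_itv/= andbT => /andP[_ x1].
by rewrite ltNge x1.
Qed.

(** The exponential is at most 1 on (0, 1] and at most 1 / r beyond, which leaves two explicit power
    integrals. *)
Lemma gamma_integral_fin : (G0 < +oo)%E.
Proof.
rewrite /G0 split_half_line ge0_integral_setU//=; last 2 first.
- exact: mgi.
- by move=> r _; rewrite lee_fin; exact: gamma_integrand_ge0.
apply: (@le_lt_trans _ _ (((1 - alpha)^-1)%:E + (1 `^ (- alpha) / alpha)%:E)%E); last by rewrite ltry.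
apply: leeD.
  apply: le_trans integral_powR_unit; apply: ge0_le_integral => //=.
  - by move=> r _; rewrite lee_fin; exact: gamma_integrand_ge0.
  - exact: mgi.
  - by apply: measurable_funTS; apply/measurable_EFinP; exact: measurable_powR.
  - move=> r; rewrite in_itv/= => /andP[r0 _]; rewrite lee_fin ler_piMr ?powR_ge0//.
    by rewrite -expR0 ler_expR oppr_le0 ltW.
rewrite -integral_powR_tail//; apply: ge0_le_integral => //=.
- by move=> r _; rewrite lee_fin; exact: gamma_integrand_ge0.
- exact: mgi.
- by apply: measurable_funTS; apply/measurable_EFinP; exact: measurable_powR.
- move=> r; rewrite in_itv/= andbT => r1; have r0 : 0 < r by exact: lt_trans r1.
  have -> : r `^ (- alpha - 1) = r `^ (- alpha) * r^-1.
    have rn0 : r != 0 by rewrite gt_eqF.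
    by rewrite powRD ?rn0 ?implybT// powR_inv1// ltW.
  rewrite lee_fin ler_wpM2l ?powR_ge0// expRN lef_pV2 ?posrE ?expR_gt0//.
  by apply: le_trans (expR_ge1Dx r); rewrite lerDr.
Qed.

Lemma gamma_integral_gt0 : (0 < G0)%E.
Proof.
rewrite /G0 split_half_line ge0_integral_setU//=; last 2 first.
- exact: mgi.
- by move=> r _; rewrite lee_fin; exact: gamma_integrand_ge0.
apply: (@lt_le_trans _ _ (expR (- 1))%:E); first by rewrite lte_fin expR_gt0.
rewrite -[leLHS]adde0; apply: leeD; last by apply: integral_ge0 => r _; rewrite lee_fin.
have -> : (expR (- 1))%:E = (\int[mu]_(r in `]0%R, 1%R]) (expR (- 1))%:E)%E.
  rewrite integral_cst//= lebesgue_measure_itv/= lte_fin ltr01.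
  by rewrite -EFinB subr0 mule1.
apply: ge0_le_integral => //=; first exact: mgi.
move=> r; rewrite in_itv/= => /andP[r0 r1]; rewrite lee_fin -[leLHS]mul1r.
apply: ler_pM => //; rewrite ?expR_ge0//; last by rewrite ler_expR lerN2.
rewrite powRN -[leLHS]invr1 lef_pV2 ?posrE ?powR_gt0//.
have <- : (1:R) `^ alpha = 1 by rewrite powR1.
apply: ge0_ler_powR => //; first exact: ltW.
- by rewrite nnegrE ltW.
- by rewrite nnegrE ler01.
Qed.

(** Write 1 - exp (- l s) as the integral of l exp (- l r) over 0 < r < s and exchange: the integral
    of s^(-alpha-1) over s > r is r^(-alpha) / alpha, and the dilation r -> l r leaves the Gamma
    integral. *)
Lemma integral_1Bexp (l : R) : 0 < l ->
  (\int[mu]_(s in `]0%R, +oo[) ((1 - expR (- (l * s))) * s `^ (- alpha - 1))%R%:E =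
   (l `^ alpha / alpha)%:E * G0)%E.
Proof.
move=> l0.
pose q (s r : R) : R := if r < s then l * expR (- (l * r)) * s `^ (- alpha - 1) else 0.
have mq : measurable_fun setT (fun z : R * R => q z.1 z.2).
  apply: measurable_fun_ifT; last exact: measurable_cst.
    by apply: measurable_fun_ltr; [exact: measurable_snd|exact: measurable_fst].
  apply: measurable_funM.
    apply: measurable_funM; first exact: measurable_cst.
    apply: measurableT_comp; first exact: measurable_expR.
    apply: measurableT_comp; first exact: oppr_measurable.
    by apply: measurable_funM; [exact: measurable_cst|exact: measurable_snd].
  apply: (@measurableT_comp _ _ _ _ _ _ (@powR R ^~ (- alpha - 1))); first exact: measurable_powR.
  exact: measurable_fst.
have q0 s r : 0 <= q s r.
  by rewrite /q; case: ifP => // _; rewrite mulr_ge0 ?powR_ge0// mulr_ge0 ?expR_ge0// ltW.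
have E1 s : 0 < s -> (\int[mu]_(r in `]0%R, +oo[) (q s r)%:E =
    ((1 - expR (- (l * s))) * s `^ (- alpha - 1))%R%:E)%E.
  move=> s0; pose f r := l * expR (- (l * r)) * s `^ (- alpha - 1).
  have cf : continuous f.
    move=> r; apply: cvgM; last exact: cvg_cst.
    apply: cvgM; first exact: cvg_cst.
    apply: (@continuous_comp _ _ _ (fun r => - (l * r)) (@expR R)); last exact: continuous_expR.
    by apply: cvgN; apply: cvgM; [exact: cvg_cst|exact: cvg_id].
  have dF (r : R) : is_derive r (1 : R) (fun r => - expR (- l * r + 0) * s `^ (- alpha - 1)) (f r).
    have d1 := is_deriveN (is_derive_comp_affine (is_derive_expR (- l * r + 0))).
    have d2 := is_deriveM d1 (is_derive_cst (s `^ (- alpha - 1)) r 1).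
    apply: (is_derive_eq d2); rewrite /f /GRing.scale/= !mulr0 add0r addr0 !mulNr opprK.
    by rewrite mulrC.
  transitivity (\int[mu]_(r in `]0%R, s[) (f r)%:E)%E.
    rewrite integral_mkcond [RHS]integral_mkcond; apply: eq_integral => r _.
    rewrite !patchE; case: (boolP (r \in `]0, s[%classic)) => [/set_mem|] rs.
      move: rs; rewrite /= in_itv/= => /andP[r0 rs].
      by rewrite mem_set/= ?in_itv/= ?r0// /q rs.
    case: ifP => // /set_mem; rewrite /= in_itv/= andbT => r0.
    rewrite /q ifF//; apply/negbTE; apply: contra rs => rs.
    by rewrite inE/= in_itv/= r0.
  have := Rintegral_FTC2 (ltW s0) cf dF; rewrite /Rintegral => E.
  rewrite -[LHS]fineK ?E.
    by congr EFin; rewrite !addr0 mulr0 expR0 (mulNr l s); ring.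
  by apply: integrable_fin_num => //; exact: continuous_integrable_oo.
have E2 r : 0 < r -> (\int[mu]_(s in `]0%R, +oo[) (q s r)%:E =
    (l * expR (- (l * r)) * (r `^ (- alpha) / alpha))%R%:E)%E.
  move=> r0; rewrite [RHS]EFinM -integral_powR_tail// -ge0_integralZl//; last 3 first.
  - by apply/measurable_EFinP; apply: measurable_funTS; exact: measurable_powR.
  - by move=> x _; rewrite lee_fin powR_ge0.
  - by rewrite lee_fin mulr_ge0 ?expR_ge0// ltW.
  rewrite [LHS]integral_mkcond [RHS]integral_mkcond; apply: eq_integral => s _.
  rewrite !patchE; case: (boolP (s \in `]r, +oo[%classic)) => [/set_mem|] rs.
    move: rs; rewrite /= in_itv/= andbT => rs.
    by rewrite mem_set/= ?in_itv/= ?(lt_trans r0 rs)// /q rs EFinM.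
  case: ifP => // /set_mem; rewrite /= in_itv/= andbT => s0.
  rewrite /q ifF//; apply/negbTE; apply: contra rs => rs.
  by rewrite inE/= in_itv/= rs.
transitivity (\int[mu]_(s in `]0%R, +oo[) \int[mu]_(r in `]0%R, +oo[) (q s r)%:E)%E.
  by apply: eq_integral => s /set_mem; rewrite /= in_itv/= andbT => /E1.
rewrite tonelli_in//; last 2 first.
- apply: measurable_funTS; apply/measurable_EFinP; exact: mq.
- by move=> s r _ _; rewrite lee_fin.
pose g r := (r `^ (- alpha) * expR (- r))%:E.
pose gI := g \_ `]0, +oo[%classic.
have mg : measurable_fun setT gI.
  apply/(measurable_restrictT _ _).1 => //; exact: mgi.
have g0 r : (0 <= gI r)%E.
  by rewrite /gI patchE; case: ifP => // _; rewrite lee_fin mulr_ge0 ?powR_ge0 ?expR_ge0.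
have -> : G0 = (\int[mu]_r gI r)%E by rewrite [G0]integral_mkcond.
rewrite (integral_dilate l0 mg g0) muleA -EFinM.
have mgl : measurable_fun setT (gI \o *%R l).
  by apply: measurableT_comp mg _; exact: mulrl_measurable.
have k0 : (0 <= (l `^ alpha / alpha * l)%:E)%E.
  by rewrite lee_fin mulr_ge0 ?divr_ge0 ?powR_ge0// ltW.
have g0l r : setT r -> (0 <= (gI \o *%R l) r)%E by move=> _; exact: g0.
have := ge0_integralZl mu measurableT mgl g0l k0.
move=> /= <-.
rewrite integral_mkcond; apply: eq_integral => r _.
rewrite /gI !patchE; case: (boolP (r \in `]0, +oo[%classic)) => [/set_mem|] r0.
  move: r0; rewrite /= in_itv/= andbT => r0; rewrite E2// mem_set; last first.
    by rewrite /= in_itv/= andbT mulr_gt0.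
  rewrite /g -EFinM; congr EFin; rewrite powRM ?ltW//.
  have la : l `^ alpha != 0 by rewrite gt_eqF// powR_gt0.
  have a0 : alpha != 0 by rewrite gt_eqF.
  by rewrite [l `^ (- alpha)]powRN; field; rewrite ?la ?a0.
rewrite memNset ?mule0//= in_itv/= andbT => lr; move/negP: r0; apply.
by rewrite inE/= in_itv/= andbT -(pmulr_rgt0 _ l0).
Qed.

Lemma Gamma1B : (Gamma (1 - alpha))%:E = G0.
Proof.
rewrite /Gamma /Rintegral -[RHS]fineK; last first.
  by rewrite ge0_fin_numE ?gamma_integral_fin// ltW// gamma_integral_gt0.
do 2 congr (_ _); apply: eq_integral => r _; do 2 congr (_ _).
by congr (_ `^ _ * _); ring.
Qed.

Lemma Gamma1B_gt0 : 0 < Gamma (1 - alpha).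
Proof. by rewrite -lte_fin Gamma1B gamma_integral_gt0. Qed.

(** The subordination formula for l^alpha; it explains the constant in front of the jump kernel. *)
Lemma integral_1Bexp_Gamma (l : R) : 0 <= l ->
  ((alpha / Gamma (1 - alpha))%:E *
   \int[mu]_(s in `]0%R, +oo[) ((1 - expR (- (l * s))) * s `^ (- alpha - 1))%R%:E =
   (l `^ alpha)%:E)%E.
Proof.
rewrite le_eqVlt => /predU1P[<-|l0].
  rewrite integral0_eq ?mule0 ?powR0 ?gt_eqF// => s _.
  by rewrite mul0r oppr0 expR0 subrr mul0r.
rewrite integral_1Bexp// -Gamma1B -!EFinM; congr EFin; field.
by rewrite gt_eqF//= gt_eqF// Gamma1B_gt0.
Qed.

End GammaIdentity.

(** * Summability of the coefficients of functions in X_N^3 *)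

Section PowerCoefficients.
Context {R : realType}.
Local Notation mu := (@lebesgue_measure R).
Local Notation I0 := (`]0, pi[%classic : set R).
Implicit Types (f v w : R -> R).

(** Telescoping, from (a + 1)^-2 <= a^-1 - (a + 1)^-1. *)
Lemma summable_inv_sqr : cvgn (series (fun n => n.+1%:R ^- 2 : R)).
Proof.
apply: nondecreasing_is_cvgn.
  by apply/nondecreasing_seqP => n; rewrite seriesSr lerDl invr_ge0 exprn_ge0.
exists 2 => _ [n _ <-].
suff H k : series (fun n => n.+1%:R ^- 2 : R) k.+1 <= 2 - k.+1%:R^-1.
  case: n => [|n]; first by rewrite /series/= big_geq.
  by apply: le_trans (H n) _; rewrite lerBlDr lerDl invr_ge0.
elim: k => [|k IH]; first by rewrite seriesSr /series/= big_geq// add0r expr1n invr1; lra.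
rewrite seriesSr; apply: (le_trans (lerD IH (lexx _))).
have : 0 < k.+1%:R :> R by rewrite ltr0n.
have -> : k.+2%:R = k.+1%:R + 1 :> R by rewrite -natr1.
move: (k.+1%:R : R) => a a0; rewrite -subr_ge0.
have -> : 2 - (a + 1)^-1 - (2 - a^-1 + (a + 1) ^- 2) = (a * (a + 1) ^+ 2)^-1.
  by field; rewrite !gt_eqF// addr_gt0.
by rewrite invr_ge0 mulr_ge0 ?sqr_ge0// ltW.
Qed.

Lemma bessel v : L2 v -> cvgn (series (fun n => L2dot v (cb n) ^+ 2)).
Proof.
move=> hv; apply: nondecreasing_is_cvgn.
  by apply/nondecreasing_seqP => n; rewrite seriesSr lerDl sqr_ge0.
exists (L2dot v v) => _ [N _ <-].
have hc n : L2 (@cb R n) := L2_cb n.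
pose F n x := L2dot v (cb n) * cb n x; have hF n : L2 (F n) by exact: L2Z.
pose g x := \sum_(n < N) F n x; have hg : L2 g by exact: L2_sum.
have Ev : L2dot g v = \sum_(n < N) L2dot v (cb n) ^+ 2.
  by rewrite /g L2dot_suml//; apply: eq_bigr => n _; rewrite L2dotZl// expr2 (L2dotC (cb n)).
have gE n : (n < N)%N -> L2dot g (cb n) = L2dot v (cb n).
  move=> nN; rewrite /g L2dot_suml// (bigD1 (Ordinal nN))//= L2dotZl// L2dot_cb eqxx mulr1.
  rewrite big1 ?addr0// => i ni; rewrite L2dotZl// L2dot_cb.
  by rewrite -[_ == n]/(i == Ordinal nN) (negbTE ni) mulr0.
have Eg : L2dot g g = \sum_(n < N) L2dot v (cb n) ^+ 2.
  rewrite {1}/g L2dot_suml//; apply: eq_bigr => n _; rewrite L2dotZl// (L2dotC (cb n)) gE//.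
have := L2dot_ge0 (fun x => v x - g x).
rewrite L2dotBl// ?L2dotBr//; last exact: L2B.
rewrite (L2dotC v g) Ev Eg subrr subr0 subr_ge0; congr (_ <= _).
by rewrite /series/= big_mkord.
Qed.

Lemma neumann_space3_coef w : neumann_space 3 w ->
  exists2 v, L2 v & forall n, L2dot v (cb n) = n%:R ^+ 3 * L2dot w (cb n).
Proof.
move=> [v wv]; exists v; first by case: wv.
move=> n; rewrite (calculus_coef n wv); congr (_ * _).
(* For n = 0 both factors are 0, since [powR] sends 0 to 0 for a nonzero exponent. *)
case: n => [|n]; first by rewrite !expr0n powR0//= gt_eqF//; lra.
rewrite -powR_mulrn ?ler0n// -powRrM.
have -> : 2%:R * (3 / 2) = 3%:R :> R by lra.
by rewrite powR_mulrn.
Qed.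

(** For m >= 1 the arithmetic-geometric inequality gives m^2 |w_m| <= (m^-2 + (m^3 w_m)^2) / 2,
    where the last square is summable by Bessel's inequality for A_N^(3/2) w; and m^(2 alpha) <=
    m^2. *)
Lemma neumann_space3_nsum (alpha : R) w : 0 < alpha -> alpha < 1 -> neumann_space 3 w ->
  nsum (fun n => L2dot w (cb n)) /\
  nsum (fun n => (n%:R ^+ 2) `^ alpha * L2dot w (cb n)).
Proof.
move=> a0 a1 /neumann_space3_coef[v hv vw].
(* The summand |w_0| covers the index 0, about which m^3 w_m says nothing; the 2 absorbs the shift
   of index, as m + 1 <= 2 m gives m^-2 / 2 <= 2 (m + 1)^-2. *)
pose b n := (`|L2dot w (cb 0)| + 2) * n.+1%:R ^- 2 + 2^-1 * L2dot v (cb n) ^+ 2.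
have cvb : cvgn (series b).
  have c1 := is_cvg_seriesZ (k := `|L2dot w (cb 0)| + 2) summable_inv_sqr.
  have c2 := is_cvg_seriesZ (k := 2^-1) (bessel hv).
  exact: is_cvg_seriesD c1 c2.
have H n : n.+1%:R ^+ 2 * `|L2dot w (cb n.+1)| <= b n.+1.
  have m1 : 1 <= n.+1%:R :> R by rewrite ler1n.
  rewrite /b vw -[n.+2%:R]natr1; set c := `|L2dot w (cb 0)|; have c0 : 0 <= c by exact: normr_ge0.
  rewrite exprMn -[X in _ <= _ + _ * (_ * X)]real_normK ?num_real//; move: m1 c0 (normr_ge0 (L2dot w (cb n.+1))).
  move: (n.+1%:R : R) c `|_| => m c x m1 c0 x0.
  have m0 : 0 < m by exact: lt_le_trans m1.
  have h1 : m ^+ 2 * x <= 2^-1 * (m ^- 2 + (m ^+ 3) ^+ 2 * x ^+ 2).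
    rewrite -subr_ge0.
    have -> : 2^-1 * (m ^- 2 + (m ^+ 3) ^+ 2 * x ^+ 2) - m ^+ 2 * x = 2^-1 * (m^-1 - m ^+ 3 * x) ^+ 2.
      by field; rewrite gt_eqF.
    by rewrite mulr_ge0 ?sqr_ge0.
  have h2 : 2^-1 * m ^- 2 <= (c + 2) * (m + 1) ^- 2.
    have : 2 * (m + 1) ^- 2 <= (c + 2) * (m + 1) ^- 2.
      by rewrite ler_wpM2r ?invr_ge0 ?sqr_ge0// lerDr.
    apply: le_trans; rewrite -subr_ge0.
    have -> : 2 * (m + 1) ^- 2 - 2^-1 * m ^- 2 =
      (m - 1) * (3 * m + 1) / (2 * m ^+ 2 * (m + 1) ^+ 2).
      by field; rewrite !gt_eqF// addr_gt0.
    by rewrite divr_ge0 ?mulr_ge0 ?sqr_ge0 ?subr_ge0 ?addr_ge0 ?mulr_ge0// ltW.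
  by apply: (le_trans h1); rewrite mulrDr; exact: lerD.
have H0 : `|L2dot w (cb 0)| <= b 0.
  rewrite /b expr1n invr1 mulr1; apply: (@le_trans _ _ (`|L2dot w (cb 0)| + 2)).
    by rewrite lerDl.
  by rewrite lerDl mulr_ge0 ?sqr_ge0.
have m1 n : 1 <= n.+1%:R ^+ 2 :> R by rewrite exprn_ege1// ler1n.
split; apply: nsum_le cvb => -[|n]; rewrite ?normrM.
- exact: H0.
- by apply: le_trans (H n); rewrite ler_peMl.
- rewrite expr0n/= powR0 ?gt_eqF// normr0 mul0r; exact: le_trans H0.
apply: le_trans (H n); rewrite ler_wpM2r// ger0_norm ?powR_ge0//.
rewrite -[leRHS]powRr1 ?sqr_ge0//; apply: ler_powR => //; exact: ltW.
Qed.

(** [neumann_power] is a representative picked by [xget], once the cosine series has shown that one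
    exists; its coefficients are forced, hence so are its values almost everywhere. *)
Lemma neumann_power_cser (alpha : R) w : 0 < alpha -> alpha < 1 -> neumann_space 3 w ->
  L2 (neumann_power alpha w) /\
  {ae mu, forall x, I0 x -> neumann_power alpha w x =
     cser (fun n => (n%:R ^+ 2) `^ alpha * L2dot w (cb n)) x}.
Proof.
move=> a0 a1 w3; have [_ na] := neumann_space3_nsum a0 a1 w3.
have hw : L2 w by case: w3 => v [].
have E : neumann_calculus (fun l => l `^ alpha) w (neumann_power alpha w).
  rewrite /neumann_power.
  apply: (@xgetPex _ _ [set v | neumann_calculus (fun l => l `^ alpha) w v]).
  eexists; exact: (neumann_calculus_cser (h := fun l => l `^ alpha) hw na).
have hp : L2 (neumann_power alpha w) by case: E.
split=> //; apply: cosine_unique => //; first exact: continuous_L2 (continuous_cser na).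
by move=> n; rewrite (calculus_coef n E) L2dot_cser.
Qed.

Lemma neumann_space3_cser w : neumann_space 3 w ->
  {ae mu, forall x, I0 x -> w x = cser (fun n => L2dot w (cb n)) x}.
Proof.
(* Any exponent in (0, 1) serves, since the conclusion kept does not involve it. *)
move=> w3; have h0 : 0 < 2^-1 :> R by [].
have [na _] := neumann_space3_nsum h0 ltac:(lra) w3.
have hw : L2 w by case: w3 => v [].
apply: cosine_unique => //; first exact: continuous_L2 (continuous_cser na).
by move=> n; rewrite L2dot_cser.
Qed.

End PowerCoefficients.

(** * The jump kernel *)
Section Intervals.
Context {R : realType}.
Local Notation mu := (@lebesgue_measure R).
Implicit Types (f g : R -> R) (a b c : R).

Lemma integrable_reflect c a b f : mu.-integrable `]a, b[ (EFin \o f) ->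
  mu.-integrable `](c - b), (c - a)[ (EFin \o (fun x => f (c - x))) /\
  \int[mu]_(x in `](c - b)%R, (c - a)%R[) f (c - x) = \int[mu]_(x in `]a, b[) f x.
Proof.
move=> /integrableP[mf fi]; split; last by rewrite /Rintegral -(integral_reflect_oo c mf).
apply/integrableP; split.
  apply: (@measurable_comp _ _ _ _ _ _ `]a, b[%classic (EFin \o f) _ (fun x : R => c - x)) => //.
    by move=> _ [x + <-]; rewrite /= !in_itv/= => /andP[? ?]; apply/andP; split; lra.
  by apply: measurable_funB; [exact: measurable_cst|exact: measurable_id].
move: fi; rewrite -(integral_reflect_oo c (measurableT_comp (@abse_measurable R setT) mf)).
by [].
Qed.

Lemma integrable_shift c a b f : mu.-integrable `]a, b[ (EFin \o f) ->
  mu.-integrable `](a - c), (b - c)[ (EFin \o (fun x => f (c + x))) /\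
  \int[mu]_(x in `](a - c)%R, (b - c)%R[) f (c + x) = \int[mu]_(x in `]a, b[) f x.
Proof.
move=> fi; have [gi <-] := integrable_reflect c fi.
have fE : (fun x => f (c - (0 - x))) = (fun x => f (c + x)).
  by apply/funext => x; rewrite sub0r opprK.
by have := integrable_reflect 0 gi; rewrite fE !sub0r !opprB.
Qed.

Lemma integrable_split a b c f : a < b -> b < c ->
  mu.-integrable `]a, b[ (EFin \o f) -> mu.-integrable `]b, c[ (EFin \o f) ->
  mu.-integrable `]a, c[ (EFin \o f) /\
  \int[mu]_(x in `]a, c[) f x = \int[mu]_(x in `]a, b[) f x + \int[mu]_(x in `]b, c[) f x.
Proof.
move=> ab bc i1 i2.
have sub : `]a, c[%classic = `]a, b[ `|` `[b, c[ :> set R.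
  apply/seteqP; split => x /=; rewrite !in_itv/=.
    by move=> /andP[ax xc]; have [xb|bx] := ltP x b; [left; rewrite ax|right; rewrite xc].
  by case=> /andP[h1 h2]; apply/andP; split=> //; [exact: lt_trans bc|exact: lt_le_trans h1].
have i2' : mu.-integrable `[b, c[ (EFin \o f).
  move: i2 => /integrableP[m2 f2]; apply/integrableP; split.
    exact/emeasurable_fun_itv_obnd_cbndP.
  by move: f2; rewrite integral_itv_obnd_cbnd//; exact: measurableT_comp.
have dis : [disjoint `]a, b[%classic & `[b, c[%classic : set R].
  apply/disj_setPS => x [/=]; rewrite !in_itv/= => /andP[_ xb] /andP[bx _].
  by move: bx; rewrite leNgt xb.
have i3 : mu.-integrable `]a, c[ (EFin \o f).
  move: i1 i2' => /integrableP[m1 f1] /integrableP[m2 f2]; rewrite sub; apply/integrableP.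
  have m3 : measurable_fun (`]a, b[ `|` `[b, c[) (EFin \o f) by apply/measurable_funU.
  split=> //; rewrite ge0_integral_setU//=; first exact: lte_add_pinfty.
  by have := measurableT_comp (@abse_measurable R setT) m3.
split=> //; rewrite sub Rintegral_setU//; last by rewrite -sub.
congr (_ + _); rewrite /Rintegral integral_itv_obnd_cbnd//.
by have /integrableP[] := i2.
Qed.

Lemma integrable_sub a b a' b' f : a <= a' -> b' <= b ->
  mu.-integrable `]a, b[ (EFin \o f) -> mu.-integrable `]a', b'[ (EFin \o f).
Proof.
move=> aa bb; apply: integrableS => // x; rewrite /= !in_itv/= => /andP[h1 h2].
by rewrite (le_lt_trans aa)//= (lt_le_trans h2).
Qed.

Lemma eq_integrable_oo a b f g : (forall x, a < x -> x < b -> f x = g x) ->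
  mu.-integrable `]a, b[ (EFin \o f) ->
  mu.-integrable `]a, b[ (EFin \o g) /\
  \int[mu]_(x in `]a, b[) f x = \int[mu]_(x in `]a, b[) g x.
Proof.
move=> fg fi.
have E x : `]a, b[%classic x -> f x = g x by rewrite /= in_itv/= => /andP[/fg]; apply.
split; last by apply: eq_Rintegral => x /set_mem/E.
by apply: eq_integrable fi => //= x /set_mem/E ->.
Qed.

End Intervals.

(** * Unfolding an integral over half a period *)

Section Fold.
Context {R : realType}.
Local Notation mu := (@lebesgue_measure R).
Local Notation I0 := (`]0, pi[%classic : set R).
Implicit Types (f g k : R -> R) (x y z : R).

(* The even 2pi-periodic folding of [- pi, 2 * pi] onto [0, pi]. *)
Definition foldpi y : R := pi - `|pi - `|y| |.

Lemma foldN y : foldpi (- y) = foldpi y. Proof. by rewrite /foldpi normrN. Qed.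

Lemma fold_id y : 0 <= y -> y <= pi -> foldpi y = y.
Proof.
by move=> y0 yp; rewrite /foldpi (ger0_norm y0) ger0_norm ?subr_ge0// subKr.
Qed.

Lemma fold_2piB y : 0 <= y -> y <= pi -> foldpi (2 * pi - y) = y.
Proof.
move=> y0 yp; have p0 := pi_gt0 R; rewrite /foldpi.
move: (pi : R) p0 yp => p p0 yp.
rewrite (@ger0_norm _ (2 * p - y)); last by lra.
by rewrite ler0_norm; lra.
Qed.

Lemma fold_lipschitz a b : `|foldpi a - foldpi b| <= `|a - b|.
Proof.
rewrite /foldpi; set A := `|pi - `|a| |; set B := `|pi - `|b| |.
have -> : pi - A - (pi - B) = B - A by ring.
apply: le_trans (ler_dist_dist _ _) _.
have -> : pi - `|b| - (pi - `|a|) = `|a| - `|b| by ring.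
exact: ler_dist_dist.
Qed.

(** The folded arguments change branch at z = pi - x and at z = x. On the four pieces substitute y =
    x + z, 2 pi - x - z, x - z and z - x: the first and third carry k (x - y), the others k (x + y).
    Integrability travels along, and k may be any even 2pi-periodic function, such as a cosine or an
    indicator. *)
Lemma unfolding x g k : I0 x -> (forall z, k (- z) = k z) ->
  (forall z, k (2 * pi - z) = k z) ->
  L1 (fun z => g (foldpi (x + z)) * k z) -> L1 (fun z => g (foldpi (x - z)) * k z) ->
  L1 (fun y => g y * (k (x - y) + k (x + y))) /\
  \int[mu]_(z in I0) ((g (foldpi (x + z)) + g (foldpi (x - z))) * k z) =
  \int[mu]_(y in I0) (g y * (k (x - y) + k (x + y))).
Proof.
rewrite /= in_itv/= => /andP[x0 xp] kN k2 A B.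
pose h1 y := g y * k (x - y); pose h2 y := g y * k (x + y).
have xp0 : 0 < pi - x by rewrite subr_gt0.
have xpp : pi - x < pi by rewrite ltrBlDr ltrDl.
have A1 := integrable_sub (lexx 0) (ltW xpp) A.
have A2 := integrable_sub (ltW xp0) (lexx pi) A.
have B1 := integrable_sub (lexx 0) (ltW xp) B.
have B2 := integrable_sub (ltW x0) (lexx pi) B.
have [_ EA] := integrable_split xp0 xpp A1 A2.
have [_ EB] := integrable_split x0 xp B1 B2.
have [A1' EA1] := integrable_shift (- x) A1.
have [A2' EA2] := integrable_reflect (2 * pi - x) A2.
have [B1' EB1] := integrable_reflect x B1.
have [B2' EB2] := integrable_shift x B2.
have e1 : 2 * pi - x - pi = pi - x by ring.
have e2 : 2 * pi - x - (pi - x) = pi by ring.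
have e3 : pi - x + x = pi by ring.
rewrite e1 e2 in A2' EA2; rewrite sub0r opprK e3 in A1' EA1.
rewrite subrr subr0 in B1' EB1; rewrite subrr in B2' EB2.
have [H1 E1] : mu.-integrable `]x, pi[ (EFin \o h1) /\
    \int[mu]_(y in `]x, pi[) h1 y = \int[mu]_(z in `]0, pi - x[) (g (foldpi (x + z)) * k z).
  rewrite -EA1; have := eq_integrable_oo _ A1'; move=> /(_ h1)[] //.
  move=> y xy yp; rewrite /h1 (_ : x + (- x + y) = y); last by ring.
  rewrite fold_id ?ltW// ?(lt_trans x0)//.
  by rewrite -(kN (x - y)) opprB addrC.
have [H2 E2] : mu.-integrable `]pi - x, pi[ (EFin \o h2) /\
    \int[mu]_(y in `]pi - x, pi[) h2 y = \int[mu]_(z in `]pi - x, pi[) (g (foldpi (x + z)) * k z).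
  rewrite -EA2; have := eq_integrable_oo _ A2'; move=> /(_ h2)[] //.
  move=> y xy yp; rewrite /h2 (_ : x + (2 * pi - x - y) = 2 * pi - y); last by ring.
  rewrite fold_2piB ?ltW// ?(lt_trans xp0)//.
  by rewrite (_ : 2 * pi - x - y = 2 * pi - (x + y)) ?k2//; ring.
have [H3 E3] : mu.-integrable `]0, x[ (EFin \o h1) /\
    \int[mu]_(y in `]0, x[) h1 y = \int[mu]_(z in `]0, x[) (g (foldpi (x - z)) * k z).
  rewrite -EB1; have := eq_integrable_oo _ B1'; move=> /(_ h1)[] //.
  move=> y xy yp; rewrite /h1 subKr fold_id// ltW//; exact: lt_trans xp.
have [H4 E4] : mu.-integrable `]0, pi - x[ (EFin \o h2) /\
    \int[mu]_(y in `]0, pi - x[) h2 y = \int[mu]_(z in `]x, pi[) (g (foldpi (x - z)) * k z).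
  rewrite -EB2; have := eq_integrable_oo _ B2'; move=> /(_ h2)[] //.
  move=> y y0 yx; rewrite /h2 (_ : x - (x + y) = - y); last by ring.
  by rewrite foldN fold_id// ltW//; exact: lt_trans xpp.
have [H5 E5] := integrable_split x0 xp H3 H1.
have [H6 E6] := integrable_split xp0 xpp H4 H2.
have [H7 E7] := eq_integrable_oo (g := fun y => g y * (k (x - y) + k (x + y)))
  (fun y _ _ => esym (mulrDr (g y) (k (x - y)) (k (x + y)))) (L1D H5 H6).
split=> //; rewrite -E7 Rintegral_L1D// E5 E6 E1 E2 E3 E4.
rewrite (_ : (fun z => _) = (fun z => g (foldpi (x + z)) * k z + g (foldpi (x - z)) * k z)); last first.
  by apply/funext => z; rewrite mulrDl.
rewrite Rintegral_L1D// EA EB; ring.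
Qed.

End Fold.

(** * The kernel K: its moments and its finiteness almost everywhere *)

Section Kernel.
Context {R : realType}.
Local Notation mu := (@lebesgue_measure R).
Local Notation I0 := (`]0, pi[%classic : set R).
Variable alpha : R.
Hypotheses (alpha_gt0 : 0 < alpha) (alpha_lt1 : alpha < 1).
Implicit Types (x y z t : R) (m n : nat).

Let c0 : 0 <= alpha / Gamma (1 - alpha).
Proof. by rewrite divr_ge0 ?ltW// Gamma1B_gt0. Qed.

(** Kept extended-valued, as finiteness is only deduced almost everywhere, from integrals of K
    against nonnegative weights. *)
Definition torus_kernel z : \bar R :=
  ((alpha / Gamma (1 - alpha))%:E *
   \int[mu]_(t in `]0%R, +oo[) (theta t z * t `^ (- alpha - 1))%R%:E)%E.

Local Notation K := torus_kernel.

Let pos_in t : `]0, +oo[%classic t -> 0 < t.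
Proof. by rewrite /= in_itv/= andbT. Qed.

Let integrand_ge0 t z : `]0, +oo[%classic t -> (0 <= (theta t z * t `^ (- alpha - 1))%:E)%E.
Proof. by move=> /pos_in t0; rewrite lee_fin mulr_ge0 ?theta_ge0 ?powR_ge0. Qed.

Lemma torus_kernel_ge0 z : (0 <= K z)%E.
Proof. by rewrite mule_ge0 ?lee_fin//; apply: integral_ge0 => t; exact: integrand_ge0. Qed.

Lemma torus_kernelN z : K (- z) = K z.
Proof. by congr (_ * _)%E; apply: eq_integral => t _; rewrite thetaN. Qed.

Lemma torus_kernel2piB z : K (2 * pi - z) = K z.
Proof. by congr (_ * _)%E; apply: eq_integral => t _; rewrite theta2piB. Qed.

(** A pointwise limit of partial sums. The abstract domain covers both theta as a function of t
    alone and theta as a function of the pair. *)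
Lemma measurable_theta d (T : measurableType d) (E : set T) (a b : T -> R) :
  measurable_fun E a -> measurable_fun E b -> (forall p, E p -> 0 < a p) ->
  measurable_fun E (fun p => theta (a p) (b p)).
Proof.
move=> ma mb a0.
apply: (@measurable_fun_cvg _ _ _ _
  (fun N p => \sum_(n < N) gcoef (a p) n * (nb n / 2) * cb n (b p))).
  move=> N; apply: measurable_sum => n.
  apply: measurable_funM; first (apply: measurable_funM => //).
    apply: (@measurableT_comp _ _ _ _ _ _ (@expR R)); first exact: measurable_expR.
    apply: (@measurableT_comp _ _ _ _ _ _ (@GRing.opp R)); first exact: oppr_measurable.
    by apply: measurable_funM.
  apply: (@measurableT_comp _ _ _ _ _ _ (cb n)) => //.
  by apply: continuous_measurable_fun; exact: continuous_cb.
move=> p /a0 t0; have := @cser_cvg _ _ (b p) (nsum_theta t0).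
by apply: cvg_trans; apply: near_eq_cvg; apply: nearW => N; rewrite /series/= big_mkord.
Qed.

Let measurable_integrand d (T : measurableType d) (E : set T) (a b : T -> R) :
  measurable_fun E a -> measurable_fun E b -> (forall p, E p -> 0 < a p) ->
  measurable_fun E (fun p => (theta (a p) (b p) * (a p) `^ (- alpha - 1))%:E).
Proof.
move=> ma mb a0; apply/measurable_EFinP; apply: measurable_funM; first exact: measurable_theta.
by apply: (@measurableT_comp _ _ _ _ _ _ (@powR R ^~ (- alpha - 1))); first exact: measurable_powR.
Qed.

Let mfst E : measurable_fun E (fst : R * R -> R).
Proof. by apply: measurable_funTS; exact: measurable_fst. Qed.

Let msnd E : measurable_fun E (snd : R * R -> R).
Proof. by apply: measurable_funTS; exact: measurable_snd. Qed.

Lemma measurable_torus_kernel : measurable_fun setT K.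
Proof.
apply: measurable_funeM.
apply: (@measurable_tonelli_in _ setT `]0, +oo[
  (fun z t => (theta t z * t `^ (- alpha - 1))%:E)) => //; last first.
  by move=> z t _; exact: integrand_ge0.
apply: measurable_integrand => // p [_]; exact: pos_in.
Qed.

(** Positivity of theta lets the integral split in the extended reals, even where a term is
    infinite. *)
Lemma jump_kernelE x y : I0 x -> I0 y -> jump_kernel alpha x y = (K (x - y) + K (x + y))%E.
Proof.
move=> Ix Iy; rewrite /jump_kernel /K -ge0_muleDr; last 2 first.
- by apply: integral_ge0 => t; exact: integrand_ge0.
- by apply: integral_ge0 => t; exact: integrand_ge0.
congr (_ * _)%E.
have mz z : measurable_fun (`]0, +oo[%classic : set R) (fun t => (theta t z * t `^ (- alpha - 1))%:E).
  by apply: measurable_integrand => // p; exact: pos_in.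
have := ge0_integralD mu (measurable_itv _) (fun t => @integrand_ge0 t (x - y)) (mz (x - y))
  (fun t => @integrand_ge0 t (x + y)) (mz (x + y)) => <-.
apply: eq_integral => t /set_mem /pos_in t0.
by rewrite neumann_heat_kernelE// hkE// -EFinD mulrDl.
Qed.

Let B_ge0 m z : 0 <= 2 - 2 * cos (m%:R * z) :> R.
Proof. by rewrite subr_ge0 ler_piMr// cos_le1. Qed.

Let measurable_1B (E : set R) m : measurable_fun E (fun z : R => 2 - 2 * cos (m%:R * z)).
Proof.
apply: measurable_funTS; apply: continuous_measurable_fun => z.
by apply: cvgB; [exact: cvg_cst|apply: cvgM; [exact: cvg_cst|exact: continuous_cosM]].
Qed.

Lemma integral_1B_torus_kernel m :
  (\int[mu]_(z in I0) ((2 - 2 * cos (m%:R * z))%:E * K z) =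
   ((m%:R ^+ 2) `^ alpha)%:E)%E.
Proof.
set c := alpha / Gamma (1 - alpha); rewrite -integral_1Bexp_Gamma ?sqr_ge0// -/c.
pose q z t := ((2 - 2 * cos (m%:R * z)) * (theta t z * t `^ (- alpha - 1)))%:E.
have mT z : measurable_fun (`]0, +oo[%classic : set R) (fun t => (theta t z * t `^ (- alpha - 1))%:E).
  by apply: measurable_integrand => // p; exact: pos_in.
have q0 z t : `]0, +oo[%classic t -> (0 <= q z t)%E.
  by move=> /pos_in t0; rewrite lee_fin mulr_ge0 ?B_ge0// mulr_ge0 ?theta_ge0 ?powR_ge0.
have mq : measurable_fun (I0 `*` (`]0, +oo[%classic : set R)) (fun p : R * R => q p.1 p.2).
  apply: (@emeasurable_funM _ _ _ _ (fun p : R * R => (2 - 2 * cos (m%:R * p.1))%:E)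
    (fun p : R * R => (theta p.2 p.1 * p.2 `^ (- alpha - 1))%:E)); last first.
    by apply: measurable_integrand => // p [_]; exact: pos_in.
  apply/measurable_EFinP.
  apply: (@measurableT_comp _ _ _ _ _ _ (fun z : R => 2 - 2 * cos (m%:R * z))) => //.
have E1 z : ((2 - 2 * cos (m%:R * z))%:E * K z =
    c%:E * \int[mu]_(t in `]0%R, +oo[) q z t)%E.
  rewrite /K -/c muleCA; congr (_ * _)%E.
  have B0 : (0 <= (2 - 2 * cos (m%:R * z))%:E)%E by rewrite lee_fin.
  by have := ge0_integralZl mu (measurable_itv _) (mT z) (fun t => @integrand_ge0 t z) B0 => <-.
under eq_integral do rewrite E1.
have mq1 : measurable_fun I0 (fun z => \int[mu]_(t in `]0%R, +oo[) q z t)%E.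
  by apply: measurable_tonelli_in => // z t _; exact: q0.
have q10 z : I0 z -> (0 <= \int[mu]_(t in `]0%R, +oo[) q z t)%E.
  by move=> _; apply: integral_ge0 => t; exact: q0.
have c0' : (0 <= c%:E)%E by rewrite lee_fin.
have := ge0_integralZl mu (measurable_itv _) mq1 q10 c0' => ->.
congr (_ * _)%E; rewrite tonelli_in//; last by move=> z t _; exact: q0.
apply: eq_integral => t /set_mem /pos_in t0.
have ct : L1 (fun z => (2 - 2 * cos (m%:R * z)) * theta t z).
  apply: continuous_L1 => z; apply: cvgM; last exact: continuous_theta.
  by apply: cvgB; [exact: cvg_cst|apply: cvgM; [exact: cvg_cst|exact: continuous_cosM]].
rewrite [m%:R ^+ 2 * t]mulrC -[expR _]/(gcoef t m) -Rintegral_theta_1B// mulrC -Rintegral_L1Z//.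
rewrite EFin_Rintegral_L1; last exact: L1Z.
by apply: eq_integral => z _; rewrite /q; congr EFin; ring.
Qed.

Let integrable_1B_K m :
  mu.-integrable I0 (fun z => (2 - 2 * cos (m%:R * z))%:E * K z)%E.
Proof.
apply/integrableP; split.
  apply: emeasurable_funM; last by apply: measurable_funTS; exact: measurable_torus_kernel.
  apply/measurable_EFinP; exact: measurable_1B.
rewrite (_ : integral _ _ _ = ((m%:R ^+ 2) `^ alpha)%:E) ?ltry// -integral_1B_torus_kernel.
by apply: eq_integral => z _; rewrite gee0_abs// mule_ge0 ?lee_fin ?torus_kernel_ge0.
Qed.

(** With z = 2 w one has 2 - 2 cos z = 4 sin^2 w. From w cos w <= sin w and w <= pi follows w^2 =
    w^2 cos^2 w + w^2 sin^2 w <= (1 + pi^2) sin^2 w. *)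
Lemma sqr_le_1B_cos z : I0 z -> z ^+ 2 <= (1 + pi ^+ 2) * (2 - 2 * cos z).
Proof.
rewrite /= in_itv/= => /andP[z0 zp].
have [w zw] : exists w, z = w *+ 2 by exists (z / 2); lra.
have w0 : 0 <= w by lra.
have wp : w <= pi / 2 by lra.
have dF x : is_derive x (1 : R) (fun x => sin x - x * cos x) (x * sin x).
  have d := is_deriveB (is_derive_sin x) (is_deriveM (is_derive_id x 1) (is_derive_cos x)).
  by apply: (is_derive_eq d); rewrite /GRing.scale/=; ring.
have [c /andP[cge cle] E] := mean_value dF w0.
have cw : w * cos w <= sin w.
  rewrite -subr_ge0; move: E; rewrite sin0 mul0r !subr0 => ->.
  rewrite mulr_ge0// mulr_ge0// sin_ge0_pi// cge/=.
  by rewrite (le_trans cle)// (le_trans wp)//; have := pi_gt0 R; lra.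
have cos0w : 0 <= cos w.
  by apply: cos_ge0_pihalf; rewrite wp andbT; have := pi_gt0 R; lra.
have h : w ^+ 2 * cos w ^+ 2 <= sin w ^+ 2.
  have sw : 0 <= sin w := le_trans (mulr_ge0 w0 cos0w) cw.
  rewrite -exprMn; apply: lerXn2r => //; rewrite ?nnegrE ?mulr_ge0//.
have wpi : w ^+ 2 <= pi ^+ 2.
  apply: lerXn2r; rewrite ?nnegrE ?pi_ge0//; apply: le_trans wp _; have := pi_gt0 R; lra.
have cs := cos2Dsin2 w.
rewrite zw cos_mulr2n.
have -> : (w *+ 2) ^+ 2 = 4 * w ^+ 2 by ring.
have s0 := sqr_ge0 (sin w).
move: (cos w ^+ 2) (sin w ^+ 2) cs h s0 wpi => C S cs h s0.
move: (w ^+ 2) h (pi ^+ 2) => W h P WP.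
have C1 : C = 1 - S by rewrite -cs; ring.
have : W * S <= P * S by rewrite ler_wpM2r.
by rewrite C1 mulrBr mulr1 in h * => h2; lra.
Qed.

(** Where K is infinite this is 0; inside (0, pi) that happens on a null set. *)
Definition torus_kernelR z : R := fine (K z).
Local Notation k := torus_kernelR.

Lemma torus_kernelR_ge0 z : 0 <= k z.
Proof. exact/fine_ge0/torus_kernel_ge0. Qed.

Lemma torus_kernelRN z : k (- z) = k z.
Proof. by rewrite /k torus_kernelN. Qed.

Lemma torus_kernelR2piB z : k (2 * pi - z) = k z.
Proof. by rewrite /k torus_kernel2piB. Qed.

Lemma measurable_torus_kernelR : measurable_fun setT k.
Proof. exact: measurableT_comp (fine_measurable measurableT) measurable_torus_kernel. Qed.

(** For m = 1 the weight 2 - 2 cos z is positive on (0, pi) and its product with K is integrable,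
    hence finite almost everywhere. *)
Lemma torus_kernel_ae_fin : {ae mu, forall z, I0 z -> K z = (k z)%:E}.
Proof.
have := @integrable_ae _ _ _ mu I0 (measurable_itv _) _ (integrable_1B_K 1).
apply: aeS => z H Iz; rewrite fineK//; move: (H Iz).
have B0 : 0 < 2 - 2 * cos (1 * z) :> R.
  have z0 : 0 < z by move: Iz; rewrite /= in_itv/= => /andP[].
  have := lt_le_trans (exprn_gt0 2 z0) (sqr_le_1B_cos Iz).
  by rewrite mul1r pmulr_rgt0// addr_gt0// exprn_gt0// pi_gt0.
rewrite ge0_fin_numE; last by rewrite mule_ge0 ?lee_fin ?torus_kernel_ge0// ltW.
rewrite ge0_fin_numE ?torus_kernel_ge0//.
move: (torus_kernel_ge0 z); case: (K z) => [r|//|//] _; first by move=> _; rewrite ltry.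
by rewrite gt0_muley ?lte_fin.
Qed.

Lemma L1_1B_torus_kernelR m : L1 (fun z => (2 - 2 * cos (m%:R * z)) * k z).
Proof.
have [mI fI] := integrableP _ _ _ (integrable_1B_K m).
apply/integrableP; split.
  apply/measurable_EFinP; apply: measurable_funM; first exact: measurable_1B.
  by apply: measurable_funTS; exact: measurable_torus_kernelR.
apply: le_lt_trans fI; rewrite le_eqVlt; apply/orP; left; apply/eqP.
apply: ae_eq_integral => //.
- apply: measurableT_comp; first exact: abse_measurable.
  apply/measurable_EFinP; apply: measurable_funM; first exact: measurable_1B.
  by apply: measurable_funTS; exact: measurable_torus_kernelR.
- by apply: measurableT_comp mI; exact: abse_measurable.
by apply: aeS torus_kernel_ae_fin => z H Iz; rewrite H.
Qed.

Lemma Rintegral_1B_torus_kernelR m :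
  \int[mu]_(z in I0) ((2 - 2 * cos (m%:R * z)) * k z) = (m%:R ^+ 2) `^ alpha.
Proof.
apply: EFin_inj; rewrite EFin_Rintegral_L1; last exact: L1_1B_torus_kernelR.
rewrite -integral_1B_torus_kernel; apply: ae_eq_integral => //.
- by have /integrableP[] := L1_1B_torus_kernelR m.
- by have /integrableP[] := integrable_1B_K m.
by apply: aeS torus_kernel_ae_fin => z H Iz; rewrite H.
Qed.

Lemma L1_sqr_torus_kernelR : L1 (fun z => z ^+ 2 * k z).
Proof.
apply: (@le_L1 _ _ (fun z => (1 + pi ^+ 2) * ((2 - 2 * cos (1 * z)) * k z))).
- apply: measurable_funM; first by apply: measurable_funX.
  by apply: measurable_funTS; exact: measurable_torus_kernelR.
- exact/L1Z/(L1_1B_torus_kernelR 1).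
move=> z Iz; have k0 := torus_kernelR_ge0 z.
have q0 : 0 <= z ^+ 2 * k z by rewrite mulr_ge0// sqr_ge0.
rewrite (ger0_norm q0) mul1r [leRHS]mulrA.
by rewrite ler_wpM2r ?torus_kernelR_ge0// sqr_le_1B_cos.
Qed.

(* Transfers the null set where the kernel is infinite: unfold its indicator. *)
Lemma jump_kernel_ae x : I0 x ->
  {ae mu, forall y, I0 y -> jump_kernel alpha x y = (k (x - y) + k (x + y))%:E}.
Proof.
move=> Ix; pose kappa : R -> R := \1_(K @^-1` [set +oo%E]).
have kE z : kappa z = (K z == +oo%E)%:R.
  by rewrite /kappa indicE; congr (nat_of_bool _)%:R; apply/idP/eqP => [/set_mem|h]; last exact/mem_set.
have mkappa : measurable_fun setT kappa.
  by apply: measurable_indic; rewrite -[X in measurable X]setTI; exact: measurable_torus_kernel.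
have kapN z : kappa (- z) = kappa z by rewrite !kE torus_kernelN.
have kap2 z : kappa (2 * pi - z) = kappa z.
  by rewrite !kE torus_kernel2piB.
have kap0 z : 0 <= kappa z by rewrite kE ler0n.
have kap1 z : kappa z <= 1 by rewrite kE lern1 leq_b1.
have Lk : L1 (fun z => 1 * kappa z).
  apply: (@L1_bounded _ _ 1).
    by apply: measurable_funM => //; apply: measurable_funTS.
  by move=> z _; rewrite mul1r ger0_norm.
have [h1 h2] := unfolding (g := fun=> 1) Ix kapN kap2 Lk Lk.
have : \int[mu]_(y in I0) (1 * (kappa (x - y) + kappa (x + y))) = 0.
  rewrite -h2 /Rintegral (_ : integral _ _ _ = 0%E)// -(integral0 mu I0).
  apply: ae_eq_integral => //.
    apply/measurable_EFinP; apply: measurable_funM => //; exact: measurable_funTS.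
  apply: aeS torus_kernel_ae_fin => z H Iz; rewrite kE H//= mulr0//.
move=> e0; have {}e0 := congr1 EFin e0; rewrite EFin_Rintegral_L1// in e0.
have : (\int[mu]_(y in I0) `|(1 * (kappa (x - y) + kappa (x + y)))%:E| = 0)%E.
  by rewrite -[RHS]e0; apply: eq_integral => y _; rewrite gee0_abs// lee_fin mul1r addr_ge0.
have mh : measurable_fun I0 (fun y => (1 * (kappa (x - y) + kappa (x + y)))%:E).
  by have /integrableP[] := h1.
move/(ae_eq_integral_abs mu (measurable_itv _) mh).
apply: aeS => y H Iy; have /= /eqP := congr1 fine (H Iy); rewrite mul1r.
rewrite paddr_eq0// !kE !pnatr_eq0 !eqb0 => /andP[e1 e2].
rewrite jump_kernelE// EFinD /k !fineK// ge0_fin_numE ?torus_kernel_ge0//.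
  by rewrite lt_neqAle e2 leey.
by rewrite lt_neqAle e1 leey.
Qed.

End Kernel.

(** * The extended fractional Laplacian *)
Section Extension.
Context {R : realType}.
Implicit Types (A : set R) (u : R -> R).

Lemma lipschitz_continuous u (L : R) : 0 <= L ->
  (forall a b, `|u a - u b| <= L * `|a - b|) -> continuous u.
Proof.
move=> L0 hu x; apply/cvgrPdist_le => /= e e0.
have Lp : 0 < L + 1 by rewrite ltr_wpDl.
near=> y; apply: (le_trans (hu _ _)); apply: (@le_trans _ _ ((L + 1) * `|x - y|)).
  by apply: ler_wpM2r => //; rewrite lerDl.
rewrite -ler_pdivlMl//; near: y; apply: cvgr_dist_le; first exact: cvg_id.
by rewrite mulr_gt0 ?invr_gt0.
Unshelve. all: by end_near. Qed.

(** McShane's formula. Folded arguments may hit 0 and pi, where the values of u are arbitrary; the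
    extension supplies the continuous ones. *)
Lemma lipschitz_extension A u (L : R) : 0 <= L -> A !=set0 ->
  (forall a b, A a -> A b -> `|u a - u b| <= L * `|a - b|) ->
  exists U : R -> R, (forall a b, `|U a - U b| <= L * `|a - b|) /\
                     (forall a, A a -> U a = u a).
Proof.
move=> L0 [a0 Aa0] hu.
pose S x := [set u y - L * `|x - y| | y in A]; pose U x := sup (S x).
have S0 x : S x !=set0 by exists (u a0 - L * `|x - a0|), a0.
have Sub x : has_ubound (S x).
  exists (u a0 + L * `|a0 - x|) => _ [y Ay <-].
  have := hu y a0 Ay Aa0; rewrite ler_norml => /andP[_].
  have : L * `|y - a0| <= L * (`|x - y| + `|a0 - x|).
    by rewrite ler_wpM2l// (distrC y) [leRHS]addrC; exact: ler_distD.
  rewrite mulrDr; lra.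
have half a b : U a <= U b + L * `|a - b|.
  apply: ge_sup => // _ [y Ay <-].
  have : u y - L * `|b - y| <= U b by apply: ub_le_sup => //; exists y.
  have : L * `|b - y| <= L * (`|a - b| + `|a - y|).
    by rewrite ler_wpM2l// (distrC a b); exact: ler_distD.
  rewrite mulrDr; lra.
exists U; split=> [a b|a Aa].
  rewrite ler_norml; have := half a b; have := half b a; rewrite (distrC b a).
  by move=> *; apply/andP; split; lra.
apply/eqP; rewrite eq_le; apply/andP; split.
  apply: ge_sup => // _ [y Ay <-].
  have := hu y a Ay Aa; rewrite ler_norml (distrC y a) => /andP[_]; lra.
have : S a (u a) by exists a => //; rewrite subrr normr0 mulr0 subr0.
exact: ub_le_sup.
Qed.
End Extension.

Section RealFubini.
Context {R : realType}.
Local Notation mu := (@lebesgue_measure R).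
Local Notation I0 := (`]0, pi[%classic : set R).

(** Tonelli's theorem is applied with the integral over x inside, the order in which the second
    difference is O(z^2); absolute integrability then gives both conclusions. *)
Lemma fubini_L1 (f : R -> R -> R) (B : R -> R) :
  measurable_fun (I0 `*` I0) (fun p : R * R => f p.1 p.2) -> L1 B ->
  (forall x, I0 x -> L1 (f x)) -> (forall z, I0 z -> L1 (f ^~ z)) ->
  (forall z, I0 z -> \int[mu]_(x in I0) `|f x z| <= B z) ->
  measurable_fun I0 (fun x => \int[mu]_(z in I0) f x z) ->
  L1 (fun x => \int[mu]_(z in I0) f x z) /\
  \int[mu]_(x in I0) \int[mu]_(z in I0) f x z = \int[mu]_(z in I0) \int[mu]_(x in I0) f x z.
Proof.
move=> mf hB hx hz hfB mF.
have mn : measurable_fun (I0 `*` I0) (fun p : R * R => (`|f p.1 p.2|)%:E).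
  by apply/measurable_EFinP; apply: measurableT_comp.
have fin : (\int[mu]_(x in I0) \int[mu]_(z in I0) (`|f x z|)%:E < +oo)%E.
  rewrite tonelli_in//.
  apply: (@le_lt_trans _ _ (\int[mu]_(z in I0) (B z)%:E)%E); last first.
    by rewrite -EFin_Rintegral_L1// ltry.
  apply: ge0_le_integral => //.
  - by move=> z _; apply: integral_ge0 => x _; rewrite lee_fin.
  - apply: (@measurable_tonelli_in _ I0 I0 (fun z x => (`|f x z|)%:E)) => //.
    apply: (@measurable_comp _ _ _ _ _ _ (I0 `*` I0)
      (fun p : R * R => (`|f p.1 p.2|)%:E) (I0 `*` I0) (fun p : R * R => (p.2, p.1))) => //.
    - exact: measurableX.
    - by move=> _ [[a b] [/= h1 h2] <-].
    - by apply: measurable_funTS; exact: measurable_swap.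
  - by apply/measurable_EFinP; exact: measurable_L1.
  - by move=> z Iz; rewrite -EFin_Rintegral_L1 ?lee_fin ?hfB//; apply: L1_norm; exact: hz.
split.
  apply/integrableP; split; first exact/measurable_EFinP.
  apply: le_lt_trans fin; apply: ge0_le_integral => //.
  - by apply/measurable_EFinP; apply: measurableT_comp.
  - exact: measurable_tonelli_in.
  - move=> x Ix /=; rewrite -EFin_Rintegral_L1; last exact/L1_norm/hx.
    by rewrite lee_fin; apply: le_normr_Rintegral_L1; exact: hx.
have E := @fubini_in _ I0 I0 (fun x z => (f x z)%:E) (measurable_itv _) (measurable_itv _).
rewrite /Rintegral.
transitivity (fine (\int[mu]_(x in I0) \int[mu]_(z in I0) (f x z)%:E)%E).
  by congr fine; apply: eq_integral => x /set_mem Ix; rewrite -EFin_Rintegral_L1//; exact: hx.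
rewrite E//; last exact/measurable_EFinP.
by congr fine; apply: eq_integral => z /set_mem Iz; rewrite -EFin_Rintegral_L1//; exact: hz.
Qed.

End RealFubini.

(** * Second differences of the even periodic extension *)

Section SecondDifference.
Context {R : realType}.
Local Notation mu := (@lebesgue_measure R).
Local Notation I0 := (`]0, pi[%classic : set R).
Implicit Types (a b x y z : R).

Lemma L1_indic a b : L1 (\1_`[a, b] : R -> R).
Proof.
apply: (@L1_bounded _ _ 1) => [|x _]; first exact: measurable_indic.
by rewrite ger0_norm// indicE lern1 leq_b1.
Qed.

Lemma Rintegral_indic_le a b : a <= b -> \int[mu]_(x in I0) \1_`[a, b] x <= b - a.
Proof.
move=> ab; rewrite -lee_fin EFin_Rintegral_L1; last exact: L1_indic.
rewrite integral_indic//.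
apply: (@le_trans _ _ (mu `[a, b])).
  by apply: le_measure; rewrite ?inE//; exact: measurableI.
by rewrite lebesgue_measure_itv/=; case: ifP => // _; rewrite lee_fin subr_ge0.
Qed.

Variables (U : R -> R) (L C : R).
Hypotheses (L_ge0 : 0 <= L) (C_ge0 : 0 <= C).
Hypothesis U_lip : forall a b, `|U a - U b| <= L * `|a - b|.
Hypothesis U_diff : forall x z, 0 < z -> I0 (x - z) -> I0 (x + z) ->
  `|2 * U x - U (x + z) - U (x - z)| <= C * z ^+ 2.

Definition fold_diff x z := 2 * U x - U (foldpi (x + z)) - U (foldpi (x - z)).
Local Notation D := fold_diff.

Lemma continuous_U : continuous U.
Proof. exact: lipschitz_continuous L_ge0 U_lip. Qed.

Lemma continuous_Ufold : continuous (U \o foldpi).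
Proof.
apply: lipschitz_continuous L_ge0 _ => a b; apply: le_trans (U_lip _ _) _.
by rewrite ler_wpM2l//; exact: fold_lipschitz.
Qed.

Lemma fold_in x : I0 x -> foldpi x = x.
Proof. by rewrite /= in_itv/= => /andP[x0 xp]; rewrite fold_id// ltW. Qed.

Lemma dist_foldD x z : I0 x -> 0 <= z -> `|x - foldpi (x + z)| <= z.
Proof.
move=> /fold_in Ix z0; rewrite -{1}Ix; apply: le_trans (fold_lipschitz _ _) _.
by rewrite opprD addrA subrr sub0r normrN ger0_norm.
Qed.

Lemma dist_foldB x z : I0 x -> 0 <= z -> `|x - foldpi (x - z)| <= z.
Proof.
move=> /fold_in Ix z0; rewrite -{1}Ix; apply: le_trans (fold_lipschitz _ _) _.
by rewrite subKr ger0_norm.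
Qed.

Lemma fold_diff_lip x z : I0 x -> 0 <= z -> `|D x z| <= 2 * L * z.
Proof.
move=> Ix z0; rewrite /D.
have -> : 2 * U x - U (foldpi (x + z)) - U (foldpi (x - z)) =
  (U x - U (foldpi (x + z))) + (U x - U (foldpi (x - z))) by ring.
apply: le_trans (ler_normD _ _) _; rewrite -mulrA mulr_natl mulr2n.
apply: lerD; apply: le_trans (U_lip _ _) _; rewrite ler_wpM2l//.
  exact: dist_foldD.
exact: dist_foldB.
Qed.

Lemma fold_diff_sqr x z : 0 < z -> I0 (x - z) -> I0 (x + z) -> `|D x z| <= C * z ^+ 2.
Proof. by move=> z0 h1 h2; rewrite /D !fold_in//; exact: U_diff. Qed.

(** For z < d neither x - z nor x + z is folded and the second difference is at most C z^2; for z >=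
    d the Lipschitz bound 2 L z is at most (2 L / d) z^2. *)
Lemma fold_diff_bound x z d : 0 < d -> d <= x -> x <= pi - d -> 0 < z ->
  `|D x z| <= (C + 2 * L / d) * z ^+ 2.
Proof.
move=> d0 dx xd z0.
have Ix : I0 x by rewrite /= in_itv/=; apply/andP; split; lra.
have [zd|dz] := ltP z d.
  apply: (@le_trans _ _ (C * z ^+ 2)); last first.
    by rewrite ler_wpM2r ?sqr_ge0// lerDl divr_ge0 ?mulr_ge0// ltW.
  by apply: fold_diff_sqr => //; rewrite /= in_itv/=; apply/andP; split; lra.
apply: le_trans (fold_diff_lip Ix (ltW z0)) _.
apply: (@le_trans _ _ (2 * L / d * z ^+ 2)); last first.
  by rewrite ler_wpM2r ?sqr_ge0// lerDr.
have -> : 2 * L / d * z ^+ 2 = (2 * L * z) * (z / d) by field; rewrite gt_eqF.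
have Lz : 0 <= 2 * L * z by rewrite !mulr_ge0// ltW.
by rewrite ler_peMr// ler_pdivlMr// mul1r.
Qed.

Lemma measurable_fold_diff : measurable_fun setT (fun p : R * R => D p.1 p.2).
Proof.
have mUf : measurable_fun setT (U \o foldpi) := continuous_measurable_fun continuous_Ufold.
apply: measurable_funB; first apply: measurable_funB.
- apply: measurable_funM => //; apply: (@measurableT_comp _ _ _ _ _ _ U).
    exact: continuous_measurable_fun continuous_U.
  exact: measurable_fst.
- apply: (@measurableT_comp _ _ _ _ _ _ (U \o foldpi)) => //.
  by apply: measurable_funD; [exact: measurable_fst|exact: measurable_snd].
- apply: (@measurableT_comp _ _ _ _ _ _ (U \o foldpi)) => //.
  by apply: measurable_funB; [exact: measurable_fst|exact: measurable_snd].
Qed.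

Lemma continuous_fold_diff_l z : continuous (D ^~ z).
Proof.
move=> x; apply: cvgB; first apply: cvgB.
- by apply: cvgM; [exact: cvg_cst|exact: continuous_U].
- apply: (@continuous_comp _ _ _ (fun x => x + z) (U \o foldpi)); last exact: continuous_Ufold.
  by apply: cvgD; [exact: cvg_id|exact: cvg_cst].
- apply: (@continuous_comp _ _ _ (fun x => x - z) (U \o foldpi)); last exact: continuous_Ufold.
  by apply: cvgB; [exact: cvg_id|exact: cvg_cst].
Qed.

Lemma measurable_fold_diff_r x : measurable_fun setT (D x).
Proof.
have := measurableT_comp measurable_fold_diff (@pair1_measurable _ _ _ _ x).
exact.
Qed.

(* The Lipschitz bound is used only where x < z or x > pi - z, a set of measure 2 z. *)
Lemma Rintegral_fold_diff z : I0 z ->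
  \int[mu]_(x in I0) `|D x z| <= (C * pi + 4 * L) * z ^+ 2.
Proof.
rewrite /= in_itv/= => /andP[z0 zp].
have mi := L1_indic.
pose g x := C * z ^+ 2 + (2 * L * z) * (\1_`[0, z] x + \1_`[pi - z, pi] x).
have Lg : L1 g by apply: L1D; [exact: L1_cst|apply: L1Z; exact: L1D].
apply: (@le_trans _ _ (\int[mu]_(x in I0) g x)).
  apply: le_Rintegral_L1 => //; first exact/L1_norm/continuous_L1/continuous_fold_diff_l.
  move=> x Ix; move: (Ix); rewrite /= in_itv/= => /andP[x0 xp].
  have Cz : 0 <= C * z ^+ 2 by rewrite mulr_ge0 ?sqr_ge0.
  have Lz : 0 <= 2 * L * z by rewrite !mulr_ge0// ltW.
  have i1 : 0 <= \1_`[0, z] x :> R by [].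
  have i2 : 0 <= \1_`[pi - z, pi] x :> R by [].
  have bad : 1 <= \1_`[0, z] x + \1_`[pi - z, pi] x :> R -> `|D x z| <= g x.
    move=> h; apply: le_trans (fold_diff_lip Ix (ltW z0)) _.
    apply: (@le_trans _ _ ((2 * L * z) * (\1_`[0, z] x + \1_`[pi - z, pi] x))).
      by rewrite ler_peMr.
    by rewrite lerDr.
  have [xz|zx] := leP x z.
    apply: bad; rewrite (_ : \1_`[0, z] x = 1) ?lerDl//.
    by rewrite indicE mem_set//= in_itv/= ltW.
  have [pzx|xpz] := leP (pi - z) x.
    apply: bad; rewrite (_ : \1_`[pi - z, pi] x = 1) ?lerDr//.
    by rewrite indicE mem_set//= in_itv/= pzx ltW.
  apply: (@le_trans _ _ (C * z ^+ 2)); last by rewrite lerDl mulr_ge0// addr_ge0.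
  by apply: fold_diff_sqr => //; rewrite /= in_itv/=; apply/andP; split; lra.
rewrite Rintegral_L1D; [|exact: L1_cst|by apply: L1Z; exact: L1D].
rewrite Rintegral_I0_cst Rintegral_L1Z; last exact: L1D.
rewrite Rintegral_L1D//.
have h1 := Rintegral_indic_le (ltW z0).
have h2 : \int[mu]_(x in I0) \1_`[pi - z, pi] x <= pi - (pi - z).
  by apply: Rintegral_indic_le; rewrite lerBlDr lerDl ltW.
apply: (@le_trans _ _ (C * z ^+ 2 * pi + 2 * L * z * (z - 0 + (pi - (pi - z))))).
  by rewrite lerD2l ler_wpM2l ?lerD// !mulr_ge0// ltW.
by rewrite le_eqVlt; apply/orP; left; apply/eqP; ring.
Qed.

End SecondDifference.

(** * The folded operator, its cosine coefficients and the principal value *)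

Section FoldedLaplacian.
Context {R : realType}.
Local Notation mu := (@lebesgue_measure R).
Local Notation I0 := (`]0, pi[%classic : set R).
Implicit Types (x y z : R) (m n : nat).
Variables (alpha : R) (U : R -> R) (L C : R).
Hypotheses (alpha_gt0 : 0 < alpha) (alpha_lt1 : alpha < 1).
Hypotheses (L_ge0 : 0 <= L) (C_ge0 : 0 <= C).
Hypothesis U_lip : forall a b, `|U a - U b| <= L * `|a - b|.
Hypothesis U_diff : forall x z, 0 < z -> I0 (x - z) -> I0 (x + z) ->
  `|2 * U x - U (x + z) - U (x - z)| <= C * z ^+ 2.

Local Notation D := (fold_diff U).
Local Notation k := (torus_kernelR alpha).

Let k_ge0 z : 0 <= k z. Proof. exact: torus_kernelR_ge0. Qed.

Let mk (E : set R) : measurable_fun E k.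
Proof. by apply: measurable_funTS; exact: measurable_torus_kernelR. Qed.

Let L1k : L1 (fun z => z ^+ 2 * k z). Proof. exact: L1_sqr_torus_kernelR. Qed.

Let in_I0 x : I0 x -> 0 < x /\ x < pi.
Proof. by rewrite /= in_itv/= => /andP[]. Qed.

Definition folded_laplacian x : R := \int[mu]_(z in I0) (D x z * k z).
Local Notation F := folded_laplacian.

Lemma fold_diffM_bound x z d : 0 < d -> d <= x -> x <= pi - d -> I0 z ->
  `|D x z * k z| <= (C + 2 * L / d) * (z ^+ 2 * k z).
Proof.
move=> d0 dx xd /in_I0[z0 _]; rewrite normrM (ger0_norm (k_ge0 z)) mulrA.
by rewrite ler_wpM2r//; exact: (fold_diff_bound L_ge0 C_ge0 U_lip U_diff).
Qed.

Let margin x : I0 x -> exists d, [/\ 0 < d, d <= x & x <= pi - d].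
Proof.
move=> /in_I0[x0 xp]; have [h|h] := leP x (pi - x).
  by exists x; split=> //; lra.
by exists (pi - x); split; lra.
Qed.

Let mD x (E : set R) : measurable_fun E (D x).
Proof. by apply: measurable_funTS; exact: measurable_fold_diff_r L_ge0 U_lip x. Qed.

Lemma L1_fold_diffM x : I0 x -> L1 (fun z => D x z * k z).
Proof.
move=> /margin[d [d0 dx xd]].
apply: (@le_L1 _ _ (fun z => (C + 2 * L / d) * (z ^+ 2 * k z))).
- by apply: measurable_funM => //; exact: mD.
- exact: L1Z.
- by move=> z Iz; exact: fold_diffM_bound.
Qed.

Lemma continuous_folded_laplacian : {in `]0, pi[, continuous F}.
Proof.
move=> x; rewrite in_itv/= => xI; have Ix : I0 x by rewrite /= in_itv.
have [d [d0 dx xd]] := margin Ix.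
(* Halving the margin makes the dominating function uniform over the neighbourhood []e, pi - e[] of
   x. *)
pose e := d / 2; have e0 : 0 < e by rewrite /e; lra.
have ed : e < d by rewrite /e; lra.
have sub y : `]e, pi - e[%classic y -> [/\ e <= y, y <= pi - e & I0 y].
  rewrite /= !in_itv/= => /andP[h1 h2]; split; [exact: ltW|exact: ltW|].
  by apply/andP; split; lra.
apply: (@continuity_under_integral _ _ _ mu (fun x z => D x z * k z) I0 (measurable_itv _) e (pi - e) _ _
  (fun z => (C + 2 * L / e) * (z ^+ 2 * k z))).
- by move=> y /sub[_ _ Iy]; exact: L1_fold_diffM.
- apply: aeW => z _ y _; apply: cvgM; last exact: cvg_cst.
  exact: (continuous_fold_diff_l L_ge0 U_lip).
- exact: L1Z.
- by move=> y /sub[h1 h2 _]; apply: aeW => z Iz; exact: fold_diffM_bound.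
- by rewrite inE/= in_itv/=; apply/andP; split; lra.
Qed.

Lemma measurable_folded_laplacian : measurable_fun I0 F.
Proof.
apply: open_continuous_measurable_fun; first exact: interval_open.
by move=> x; rewrite inE => Ix; exact: continuous_folded_laplacian.
Qed.

(** Taken with phi = 1 for the integrability of F and with phi = [cb m] for its coefficients. *)
Lemma folded_laplacian_fubini (phi : R -> R) : continuous phi ->
  L1 (fun x => F x * phi x) /\
  \int[mu]_(x in I0) (F x * phi x) =
  \int[mu]_(z in I0) (k z * \int[mu]_(x in I0) (D x z * phi x)).
Proof.
move=> cphi; have [M HM] := continuous_bounded_I0 cphi.
pose f x z := phi x * (D x z * k z).
have M0 : 0 <= M.
  have h : I0 (pi / 2) by have := pi_gt0 R; rewrite /= in_itv/= => p0; apply/andP; split; lra.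
  exact: le_trans (HM _ h).
have hD z : L1 (D ^~ z) by apply: continuous_L1; exact: continuous_fold_diff_l L_ge0 U_lip z.
have hDp z : L1 (fun x => D x z * phi x).
  by apply: continuous_L1 => x; apply: cvgM; [exact: (continuous_fold_diff_l L_ge0 U_lip)|exact: cphi].
have Ef x z : f x z = k z * (D x z * phi x) by rewrite /f; ring.
have EF x : I0 x -> F x * phi x = \int[mu]_(z in I0) f x z.
  by move=> Ix; rewrite /f Rintegral_L1Z; [rewrite mulrC|exact: L1_fold_diffM].
have hz z : L1 (f ^~ z) by rewrite (_ : f ^~ z = fun x => k z * (D x z * phi x));
  [exact: L1Z|apply/funext => x; exact: Ef].
have [h1 h2] : L1 (fun x => \int[mu]_(z in I0) f x z) /\
    \int[mu]_(x in I0) \int[mu]_(z in I0) f x z = \int[mu]_(z in I0) \int[mu]_(x in I0) f x z.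
  apply: (@fubini_L1 _ f (fun z => (M * (C * pi + 4 * L)) * (z ^+ 2 * k z))) => //.
  - apply: measurable_funTS; apply: measurable_funM.
      apply: (@measurableT_comp _ _ _ _ _ _ phi); last exact: measurable_fst.
      exact: continuous_measurable_fun.
    apply: measurable_funM; first exact: measurable_fold_diff L_ge0 U_lip.
    by apply: (@measurableT_comp _ _ _ _ _ _ k); [exact: mk|exact: measurable_snd].
  - exact: L1Z.
  - by move=> x Ix; apply: L1Z; exact: L1_fold_diffM.
  - move=> z Iz; apply: (@le_trans _ _ (\int[mu]_(x in I0) ((M * k z) * `|D x z|))).
      apply: le_Rintegral_L1; [exact: L1_norm|by apply: L1Z; exact: L1_norm|].
      move=> x Ix; rewrite /f !normrM (ger0_norm (k_ge0 z)) [`|D x z| * _]mulrC -[leRHS]mulrA.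
      by apply: ler_wpM2r; [rewrite mulr_ge0|exact: HM].
    rewrite Rintegral_L1Z; last exact: L1_norm.
    have := Rintegral_fold_diff L_ge0 C_ge0 U_lip U_diff Iz.
    move=> h; apply: (@le_trans _ _ (M * k z * ((C * pi + 4 * L) * z ^+ 2))).
      by rewrite ler_wpM2l// mulr_ge0.
    by rewrite le_eqVlt; apply/orP; left; apply/eqP; ring.
  - apply: (@eq_measurable_fun _ _ _ _ _ (fun x => F x * phi x)).
      by move=> x /set_mem Ix; exact: EF.
    apply: measurable_funM; first exact: measurable_folded_laplacian.
    exact: continuous_measurable_in.
split; first by apply: eq_L1 h1 => x Ix; rewrite EF.
transitivity (\int[mu]_(x in I0) \int[mu]_(z in I0) f x z).
  by apply: eq_Rintegral => x /set_mem Ix; exact: EF.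
rewrite h2; apply: eq_Rintegral => z _.
rewrite -(Rintegral_L1Z (k z) (hDp z)); apply: eq_Rintegral => x _; exact: Ef.
Qed.

(** Here [unfolding] is used with the roles exchanged: z is the fixed point and [cb m], itself even
    and 2pi-periodic, is the kernel. It yields cb m (z - y) + cb m (z + y) = 2 cos (m z) cb m y. *)
Lemma Rintegral_fold_diff_cos m z : I0 z ->
  \int[mu]_(x in I0) (D x z * cb m x) =
  (2 - 2 * cos (m%:R * z)) * \int[mu]_(x in I0) (U x * cb m x).
Proof.
move=> Iz; have cU := continuous_U L_ge0 U_lip; have cUf := continuous_Ufold L_ge0 U_lip.
have cN y : cb m (- y) = cb m y by rewrite /cb mulrN cosN.
have c2 y : cb m (2 * pi - y) = cb m y by rewrite /cb cos_nat2piB.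
have A (s : R -> R) : continuous s -> L1 (fun x => U (foldpi (s x)) * cb m x).
  move=> cs; apply: continuous_L1 => x; apply: cvgM; last exact: continuous_cb.
  by apply: (@continuous_comp _ _ _ s (U \o foldpi)); [exact: cs|exact: cUf].
have A1 : L1 (fun x => U (foldpi (z + x)) * cb m x).
  by apply: A => x; apply: cvgD; [exact: cvg_cst|exact: cvg_id].
have A2 : L1 (fun x => U (foldpi (z - x)) * cb m x).
  by apply: A => x; apply: cvgB; [exact: cvg_cst|exact: cvg_id].
have A0 : L1 (fun x => U x * cb m x).
  by apply: continuous_L1 => x; apply: cvgM; [exact: cU|exact: continuous_cb].
have [_ E] := unfolding (g := U) Iz cN c2 A1 A2.
transitivity (\int[mu]_(x in I0) (2 * (U x * cb m x) -
    (U (foldpi (z + x)) + U (foldpi (z - x))) * cb m x)).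
  apply: eq_Rintegral => x _; rewrite /D (addrC x z) -(foldN (x - z)) opprB; ring.
rewrite Rintegral_L1B; [|exact: L1Z|].
  rewrite E (Rintegral_L1Z 2 A0) mulrBl -(Rintegral_L1Z (2 * cos (m%:R * z)) A0).
  congr (_ - _); apply: eq_Rintegral => y _.
  by rewrite /cb (mulrBr m%:R) (mulrDr m%:R) cosB cosD; ring.
by apply: eq_L1 (L1D A1 A2) => x _; rewrite mulrDl.
Qed.

Lemma folded_laplacian_coef m :
  \int[mu]_(x in I0) (F x * cb m x) =
  (m%:R ^+ 2) `^ alpha * \int[mu]_(x in I0) (U x * cb m x).
Proof.
have [_ ->] := folded_laplacian_fubini (@continuous_cb R m).
set um := \int[mu]_(x in I0) (U x * cb m x).
transitivity (\int[mu]_(z in I0) (um * ((2 - 2 * cos (m%:R * z)) * k z))).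
  apply: eq_Rintegral => z /set_mem Iz; rewrite Rintegral_fold_diff_cos// -/um; ring.
rewrite (Rintegral_L1Z um (L1_1B_torus_kernelR alpha_gt0 alpha_lt1 m)).
by rewrite Rintegral_1B_torus_kernelR// mulrC.
Qed.

(** The increment of the truncated integral, set to 0 near x so that it lives on the whole interval
    and can be unfolded. *)
Let cut x (eps : R) y : R := if eps <= `|x - y| then U x - U y else 0.

Let measurable_cut x eps : measurable_fun setT (cut x eps).
Proof.
have mU := continuous_measurable_fun (continuous_U L_ge0 U_lip).
apply: measurable_fun_ifT => //; last by apply: measurable_funB.
by apply: measurable_fun_ler => //; apply: measurableT_comp => //; apply: measurable_funB.
Qed.

Let cut_lip x eps y z : `|x - y| <= z -> `|cut x eps y| <= L * z.
Proof.
move=> xyz; have Lz : 0 <= L * z by rewrite mulr_ge0// (le_trans _ xyz).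
rewrite /cut; case: ifP => _; last by rewrite normr0.
by apply: le_trans (U_lip _ _) _; rewrite ler_wpM2l.
Qed.

(** The cut increment vanishes when z < eps, and otherwise z / eps >= 1 may multiply the Lipschitz
    bound. For each fixed eps this makes it integrable against the kernel. *)
Let cut_sqr x eps y z : 0 < eps -> `|x - y| <= z -> `|cut x eps y| <= L / eps * z ^+ 2.
Proof.
move=> e0 xyz; have z0 : 0 <= z := le_trans (normr_ge0 _) xyz.
have [ez|ze] := leP eps z.
  apply: le_trans (cut_lip _ xyz) _.
  have -> : L / eps * z ^+ 2 = (L * z) * (z / eps) by field; rewrite gt_eqF.
  by rewrite ler_peMr ?mulr_ge0// ler_pdivlMr// mul1r.
rewrite /cut ifF ?normr0; last by apply/negbTE; rewrite -ltNge (le_lt_trans xyz ze).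
by rewrite mulr_ge0 ?sqr_ge0// divr_ge0// ltW.
Qed.

Let fold_cut x eps z := cut x eps (foldpi (x + z)) + cut x eps (foldpi (x - z)).

Let cfold : continuous (@foldpi R).
Proof. by apply: (@lipschitz_continuous _ _ 1) => // a b; rewrite mul1r fold_lipschitz. Qed.

Let mcutD x eps : measurable_fun setT (fun z => cut x eps (foldpi (x + z))).
Proof.
apply: measurableT_comp; first exact: measurable_cut.
apply: measurableT_comp; first exact: continuous_measurable_fun cfold.
by apply: measurable_funD.
Qed.

Let mcutB x eps : measurable_fun setT (fun z => cut x eps (foldpi (x - z))).
Proof.
apply: measurableT_comp; first exact: measurable_cut.
apply: measurableT_comp; first exact: continuous_measurable_fun cfold.
by apply: measurable_funB.
Qed.

(** For fixed eps each one-sided piece is integrable, so that unfolding is legitimate before any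
    cancellation; the extended jump kernel is replaced by its real version almost everywhere. *)
Lemma truncated_laplacianE u x eps : (forall y, I0 y -> U y = u y) -> I0 x -> 0 < eps ->
  truncated_laplacian alpha u x eps = (\int[mu]_(z in I0) (fold_cut x eps z * k z))%:E.
Proof.
move=> uU Ix e0.
have A (phi : R -> R) : measurable_fun setT (cut x eps \o phi) ->
    (forall z, 0 <= z -> `|x - phi z| <= z) -> L1 (fun z => cut x eps (phi z) * k z).
  move=> mphi xphi; apply: (@le_L1 _ _ (fun z => L / eps * (z ^+ 2 * k z))).
  - by apply: measurable_funM => //; exact: measurable_funTS.
  - exact: L1Z.
  - move=> z /in_I0[z0 _]; rewrite normrM (ger0_norm (k_ge0 z)) mulrA ler_wpM2r//.
    by apply: cut_sqr => //; apply: xphi; exact: ltW.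
have A1 := A _ (mcutD x eps) (fun z => @dist_foldD _ x z Ix).
have A2 := A _ (mcutB x eps) (fun z => @dist_foldB _ x z Ix).
have [h1 ->] := unfolding (g := cut x eps) Ix (torus_kernelRN alpha) (torus_kernelR2piB alpha) A1 A2.
rewrite EFin_Rintegral_L1// /truncated_laplacian.
rewrite (_ : truncated_domain x eps = I0 `&` [set y | eps <= `|x - y|])// integral_mkcondr.
transitivity (\int[mu]_(y in I0) ((cut x eps y)%:E *
    (torus_kernel alpha (x - y) + torus_kernel alpha (x + y))))%E.
  apply: eq_integral => y /set_mem Iy; rewrite patchE /cut -(uU _ Ix) -(uU _ Iy).
  have -> : (y \in [set y | eps <= `|x - y|]) = (eps <= `|x - y|).
    by apply/idP/idP => [/set_mem//|h]; exact/mem_set.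
  by case: ifP => _; rewrite ?mul0e// jump_kernelE.
have mK := measurable_torus_kernel alpha.
apply: ae_eq_integral => //.
- apply: measurable_funTS; apply: emeasurable_funM; first by apply/measurable_EFinP; exact: measurable_cut.
  apply: emeasurable_funD.
    by apply: (measurableT_comp mK); exact: measurable_funB.
  by apply: (measurableT_comp mK); exact: measurable_funD.
- by have /integrableP[] := h1.
apply: aeS (jump_kernel_ae alpha_gt0 alpha_lt1 Ix) => y H Iy.
by rewrite -jump_kernelE// H// EFinM.
Qed.

Lemma truncated_laplacian_cvg u x : (forall y, I0 y -> U y = u y) -> I0 x ->
  truncated_laplacian alpha u x eps @[eps --> 0^'+] --> (F x)%:E.
Proof.
move=> uU Ix; have [x0 xp] := in_I0 Ix; have [d [d0 dx xd]] := margin Ix.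
suff H : (\int[mu]_(z in I0) (fold_cut x eps z * k z)) @[eps --> 0^'+] --> F x.
  apply: cvg_EFin.
    by near=> e; rewrite truncated_laplacianE//; near: e; exact: nbhs_right_gt.
  apply: cvg_trans H; apply: near_eq_cvg; near=> e.
  by rewrite /= truncated_laplacianE//; near: e; exact: nbhs_right_gt.
(* Dominated convergence is about sequences, so eps runs along an arbitrary sequence of positive
   reals tending to 0. *)
apply/cvg_at_rightP => e [e0 ecv].
have mf n : measurable_fun I0 (fun z => fold_cut x (e n) z * k z).
  by apply: measurable_funM => //; apply: measurable_funD; exact: measurable_funTS.
have mg : measurable_fun I0 (fun z => D x z * k z).
  by apply: measurable_funM => //; exact: mD.
have lim : {ae mu, forall z, I0 z ->
    (fun n => fold_cut x (e n) z * k z) @ \oo --> D x z * k z}.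
  apply: aeW => z _; apply: cvgM; last exact: cvg_cst.
  have c y : (fun n => cut x (e n) y) @ \oo --> U x - U y.
    have [<-|xy] := eqVneq x y.
      rewrite /cut !subrr (_ : (fun n => _) = fun=> 0); first exact: cvg_cst.
      by apply/funext => n; case: ifP.
    apply: cvg_near_cst; near=> n.
    rewrite /cut ifT//; near: n.
    have xy0 : 0 < `|x - y| by rewrite normr_gt0 subr_eq0.
    move/cvgrPdist_le : (ecv) => /(_ _ xy0); apply: filterS => n.
    by rewrite sub0r normrN; apply: le_trans; exact: ler_norm.
  have -> : D x z = (U x - U (foldpi (x + z))) + (U x - U (foldpi (x - z))).
    by rewrite /D; ring.
  exact: cvgD.
apply: (proj2 (dominated_cvg_L1 mf mg lim (L1Z (C + 2 * L / d) L1k) _)).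
move=> n z Iz; have [z0 _] := in_I0 Iz.
rewrite normrM (ger0_norm (k_ge0 z)) mulrA ler_wpM2r//.
(* For z < d the points x - z and x + z are both at distance z from x, so the symmetric truncation
   keeps or drops both: the sum is D x z or 0, bounded independently of eps. For z >= d the
   Lipschitz bound suffices. *)
have [zd|dz] := ltP z d.
  apply: (@le_trans _ _ `|D x z|); last exact: (fold_diff_bound L_ge0 C_ge0 U_lip U_diff d0).
  have f1 : foldpi (x + z) = x + z by rewrite fold_in//= in_itv/=; apply/andP; split; lra.
  have f2 : foldpi (x - z) = x - z by rewrite fold_in//= in_itv/=; apply/andP; split; lra.
  rewrite /fold_cut /D f1 f2 /cut subKr opprD addrA subrr sub0r normrN.
  case: ifP => _; last by rewrite addr0 normr0.
  by rewrite le_eqVlt; apply/orP; left; apply/eqP; congr `|_|; ring.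
apply: (@le_trans _ _ (2 * L / d * z ^+ 2)); last first.
  by rewrite ler_wpM2r ?sqr_ge0// lerDr.
have -> : 2 * L / d * z ^+ 2 = (L * z + L * z) * (z / d) by field; rewrite gt_eqF.
apply: (@le_trans _ _ (L * z + L * z)).
  apply: le_trans (ler_normD _ _) _; apply: lerD; apply: cut_lip.
    by apply: dist_foldD => //; exact: ltW.
  by apply: dist_foldB => //; exact: ltW.
have s0 : 0 <= L * z + L * z by rewrite addr_ge0 ?mulr_ge0 ?(ltW z0).
by rewrite ler_peMr// ler_pdivlMr// mul1r.
Unshelve. all: by end_near. Qed.

End FoldedLaplacian.

Theorem theorem2 (R : realType) (alpha : R) (u w : R -> R)
    (alpha_gt0 : 0 < alpha) (alpha_lt1 : alpha < 1)
    (* u is the continuous representative of an element of H^3(0, pi) *)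
    (uH3 : sobolevH 3 u) (uC : {in `]0, pi[, continuous u})
    (wX3 : neumann_space 3 w) :
  [/\ (* the principal value exists at every point of (0, pi) *)
      {in `]0, pi[, forall x,
         truncated_laplacian alpha u x eps @[eps --> 0^'+] -->
           (extended_laplacian alpha u x)%:E},
      {in `]0, pi[, continuous (extended_laplacian alpha u)},
      lebesgue_measure.-integrable `]0, pi[
        (fun x => (extended_laplacian alpha u x)%:E) &
      (\int[lebesgue_measure]_(x in `]0%R, pi[)
          (extended_laplacian alpha u x * w x)%R%:E =
       \int[lebesgue_measure]_(x in `]0%R, pi[)
          (u x * neumann_power alpha w x)%R%:E)%E].
Proof.
have [uL2 uW] := uH3.
have [v1 v1L2 uv1] := uW 1%N isT.
have [v2 v2L2 uv2] := uW 2%N isT.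
have [v3 v3L2 uv3] := uW 3%N isT.
have [L L0 uL] := sobolev_lipschitz uL2 v1L2 v2L2 uv1 uv2 uC.
have [C C0 uC2] := sobolev_second_diff uL2 v2L2 v3L2 uv2 uv3 uC.
have I0n : (`]0, pi[%classic : set R) !=set0.
  by exists (pi / 2); have := pi_gt0 R; rewrite /= in_itv/= => p0; apply/andP; split; lra.
have [U [U_lip Uu]] := lipschitz_extension L0 I0n uL.
have U_diff x z : 0 < z -> `]0, pi[%classic (x - z) -> `]0, pi[%classic (x + z) ->
    `|2 * U x - U (x + z) - U (x - z)| <= C * z ^+ 2.
  move=> z0 h1 h2; rewrite !Uu//; first exact: uC2.
  by move: h1 h2; rewrite /= !in_itv/= => /andP[? ?] /andP[? ?]; apply/andP; split; lra.
set F := folded_laplacian alpha U.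
have pv x : `]0, pi[%classic x ->
    truncated_laplacian alpha u x eps @[eps --> 0^'+] --> (F x)%:E.
  exact: (truncated_laplacian_cvg alpha_gt0 alpha_lt1 L0 C0 U_lip U_diff).
have EF x : `]0, pi[%classic x -> extended_laplacian alpha u x = F x.
  by move=> /pv Fx; rewrite /extended_laplacian (cvg_lim _ Fx).
have FL1 : L1 F.
  have c1 : continuous (fun _ : R => 1 : R) by move=> y; exact: cvg_cst.
  have [h _] := folded_laplacian_fubini alpha_gt0 alpha_lt1 L0 C0 U_lip U_diff c1.
  by apply: eq_L1 h => x _; rewrite mulr1.
have [na nb] := neumann_space3_nsum alpha_gt0 alpha_lt1 wX3.
have [Aw2 Aw] := neumann_power_cser alpha_gt0 alpha_lt1 wX3.
have ww := neumann_space3_cser wX3.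
have wL2 : L2 w by case: wX3 => v [].
have uL1 : L1 u := L2_L1 uL2.
split.
- by move=> x xI; rewrite EF//; exact: pv.
- move=> x xI.
  have cF := continuous_folded_laplacian alpha_gt0 alpha_lt1 L0 C0 U_lip U_diff.
  rewrite /continuous_at EF//.
  apply: cvg_trans (cF x xI); apply: near_eq_cvg; near=> y; rewrite EF//=.
  by near: y; exact: near_in_itvoo.
- by apply: eq_L1 FL1 => x Ix; rewrite EF.
(* Both w and A_N^alpha w agree with their cosine series only almost everywhere, which is enough
   under the integral. *)
have aeE (f g g' : R -> R) (a : nat -> R) : L1 g -> measurable_fun `]0, pi[ f -> nsum a ->
    (forall x, `]0, pi[%classic x -> g' x = g x) ->
    {ae lebesgue_measure, forall x, `]0, pi[%classic x -> f x = cser a x} ->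
    (\int[lebesgue_measure]_(x in `]0%R, pi[) (g' x * f x)%R%:E =
    (\int[lebesgue_measure]_(x in `]0%R, pi[) (g x * cser a x))%R%:E)%E.
  move=> hg mf ha gg fa; have cc := continuous_cser ha.
  have [M HM] := continuous_bounded_I0 cc.
  have mc := continuous_measurable_in (measurable_itv `]0, pi[) cc.
  rewrite EFin_Rintegral_L1; last exact: (L1M_bounded hg mc HM).
  transitivity (\int[lebesgue_measure]_(x in `]0%R, pi[) (g x * f x)%R%:E)%E.
    by apply: eq_integral => x /set_mem Ix; rewrite gg.
  have mg := measurable_L1 hg.
  apply: ae_eq_integral => //; [by apply/measurable_EFinP; apply: measurable_funM..|].
  by apply: aeS fa => x H Ix; rewrite H.
rewrite (aeE _ _ _ _ FL1 wL2.1 na EF ww) (aeE _ _ _ _ uL1 Aw2.1 nb (fun _ _ => erefl) Aw).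
congr EFin.
(* Both integrals are sums of series in the coefficients, whose n-th terms agree because the factor
   n^(2 alpha) moves from the coefficients of F to those of A_N^alpha w. *)
have c1 := @RintegralM_cser _ _ _ FL1 na.
have c2 := @RintegralM_cser _ _ _ uL1 nb.
rewrite -(cvg_lim _ c1)// -(cvg_lim _ c2)//; congr (limn (series _)); apply/funext => n.
rewrite (folded_laplacian_coef alpha_gt0 alpha_lt1 L0 C0 U_lip U_diff) mulrCA mulrA.
congr (_ * _); apply: eq_Rintegral => x /set_mem Ix; rewrite Uu//.
Unshelve. all: by end_near. Qed.
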